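(* Let $m\ge3$, $\rho=\frac12+\frac1m$, and $0<\delta\le\frac{\pi}{m+2}$. Then $$f(0,a,\lambda)=\bigl[1+O(\lambda^{-\rho})\bigr]\lambda^{-\frac14}\exp[L(a,\lambda)],\qquad f'(0,a,\lambda)=-\bigl[1+O(\lambda^{-\rho})\bigr]\lambda^{\frac14}\exp[L(a,\lambda)]$$ as $\lambda\to\infty$ in the sector $|\arg\lambda|\le\pi-\delta$, uniformly for $a$ in any compact subset of $\mathbb C^m$ (powers of $\lambda$ are principal branches).
   Context: For $a=(a_1,\dots,a_m)\in\mathbb C^m$ let $P(z)=a_1z^{m-1}+\dots+a_m$. Let $b_{j,k}(a)$ ($j\ge1$, $1\le k\le j$) be the coefficient of $z^{mk-j}$ in $\binom{1/2}{k}P(z)^k$, $b_j(a)=\sum_{k=1}^jb_{j,k}(a)$, $\nu(a)=0$ for $m$ odd, $\nu(a)=b_{\frac m2+1}(a)$ for $m$ even, and $\mu(a)=\frac m4-\nu(a)$. Let $F(z,a,\lambda)=\frac{2}{m+2}z^{\frac{m+2}2}+\sum_{1\le j<\frac{m+2}2}\frac{2}{m+2-2j}b_j(a)z^{\frac12(m+2-2j)}$. $f(z,a,\lambda)$ denotes Sibuya's solution of $-y''+(z^m+P(z)+\lambda)y=0$ in the complex $z$-plane: the solution, entire in $(z,a,\lambda)$, with $f(z,a,\lambda)=z^{\mu(a)-\frac m2}(1+O(z^{-1/2}))\exp[-F(z,a,\lambda)]$ and $f'(z,a,\lambda)=-z^{\mu(a)}(1+O(z^{-1/2}))\exp[-F(z,a,\lambda)]$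 as $z\to\infty$ in $|\arg z|\le\frac{3\pi}{m+2}-\varepsilon$ for every $\varepsilon>0$ (principal branches); $f'=\partial f/\partial z$. Further $$L(a,\lambda)=\int_0^{\infty}\Bigl(\sqrt{x^m+P(x)+\lambda}-x^{\frac m2}-\sum_{j=1}^{\lfloor\frac{m+1}2\rfloor}b_j(a)x^{\frac m2-j}-\frac{\nu(a)}{x+1}\Bigr)dx,$$ with principal square root, defined for $|\lambda|$ large in $|\arg\lambda|\le\pi-\delta$. *)

(* Defs.v *)
From Stdlib Require Import Reals Lra.
Open Scope R_scope.

Definition Cx : Type := (R * R)%type.
Definition RtoC (x : R) : Cx := (x, 0).
Definition C0 : Cx := (0, 0).
Definition C1 : Cx := (1, 0).
Definition Cadd (z w : Cx) : Cx := (fst z + fst w, snd z + snd w).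
Definition Copp (z : Cx) : Cx := (- fst z, - snd z).
Definition Csub (z w : Cx) : Cx := Cadd z (Copp w).
Definition Cmul (z w : Cx) : Cx :=
  (fst z * fst w - snd z * snd w, fst z * snd w + snd z * fst w).
Definition Cnorm (z : Cx) : R := sqrt (fst z ^ 2 + snd z ^ 2).
Definition Cinv (z : Cx) : Cx :=
  let d := fst z ^ 2 + snd z ^ 2 in (fst z / d, - snd z / d).
Definition Cdiv (z w : Cx) : Cx := Cmul z (Cinv w).
Definition Cexp (z : Cx) : Cx := (exp (fst z) * cos (snd z), exp (fst z) * sin (snd z)).

(** principal argument, with values in (-PI, PI] *)
Definition Carg (z : Cx) : R :=
  let x := fst z in let y := snd z in
  if Rlt_dec 0 x then atan (y / x)
  else if Rlt_dec x 0 then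
         (if Rle_dec 0 y then atan (y / x) + PI else atan (y / x) - PI)
  else if Rlt_dec 0 y then PI / 2
  else if Rlt_dec y 0 then - (PI / 2) else 0.

Definition Clog (z : Cx) : Cx := (ln (Cnorm z), Carg z).
Definition Cpow (z w : Cx) : Cx :=
  if Rlt_dec 0 (Cnorm z) then Cexp (Cmul w (Clog z)) else C0.
Definition Csqrt (z : Cx) : Cx := Cpow z (RtoC (/ 2)).

Fixpoint Cpown (z : Cx) (n : nat) : Cx :=
  match n with O => C1 | S n' => Cmul z (Cpown z n') end.

Fixpoint Csum (f : nat -> Cx) (n : nat) : Cx :=
  match n with O => C0 | S n' => Cadd (Csum f n') (f n') end.

Definition Cderiv (g : Cx -> Cx) (z l : Cx) : Prop :=
  forall eps, 0 < eps -> exists d, 0 < d /\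
    forall h : Cx, h <> C0 -> Cnorm h < d ->
      Cnorm (Csub (Cdiv (Csub (g (Cadd z h)) (g z)) h) l) < eps.

(** * The polynomial P(z) = a_1 z^(m-1) + ... + a_m ; a : nat -> Cx, only a_1..a_m used *)
Definition Peval (m : nat) (a : nat -> Cx) (z : Cx) : Cx :=
  Csum (fun i => Cmul (a (S i)) (Cpown z (m - S i))) m.

Definition Pcoef (m : nat) (a : nat -> Cx) (i : nat) : Cx :=
  if Nat.ltb i m then a (m - i)%nat else C0.

Fixpoint Ppow_coef (m : nat) (a : nat -> Cx) (k n : nat) : Cx :=
  match k with
  | O => if Nat.eqb n 0 then C1 else C0
  | S k' => Csum (fun i => Cmul (Pcoef m a i) (Ppow_coef m a k' (n - i))) (S n)
  end.

Fixpoint binom_half (k : nat) : R :=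
  match k with O => 1 | S k' => binom_half k' * (/ 2 - INR k') / INR (S k') end.

Definition bjk (m : nat) (a : nat -> Cx) (j k : nat) : Cx :=
  Cmul (RtoC (binom_half k)) (Ppow_coef m a k (m * k - j)).

Definition bj (m : nat) (a : nat -> Cx) (j : nat) : Cx :=
  Csum (fun i => bjk m a j (S i)) j.

Definition nu (m : nat) (a : nat -> Cx) : Cx :=
  if Nat.even m then bj m a (Nat.div m 2 + 1) else C0.

Definition mu (m : nat) (a : nat -> Cx) : Cx := Csub (RtoC (INR m / 4)) (nu m a).

(** F(z,a,lambda); the range 1 <= j < (m+2)/2 is j = 1 .. (m+1)/2 (nat division) *)
Definition Ffun (m : nat) (a : nat -> Cx) (z : Cx) : Cx :=
  Cadd (Cmul (RtoC (2 / (INR m + 2))) (Cpow z (RtoC ((INR m + 2) / 2))))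
       (Csum (fun i => let j := S i in
          Cmul (RtoC (2 / (INR m + 2 - 2 * INR j)))
               (Cmul (bj m a j) (Cpow z (RtoC ((INR m + 2 - 2 * INR j) / 2)))))
          (Nat.div (m + 1) 2)).

Definition Lintegrand (m : nat) (a : nat -> Cx) (lam : Cx) (x : R) : Cx :=
  Csub (Csub (Csub
    (Csqrt (Cadd (Cadd (Cpown (RtoC x) m) (Peval m a (RtoC x))) lam))
    (RtoC (Rpower x (INR m / 2))))
    (Csum (fun i => Cmul (bj m a (S i)) (RtoC (Rpower x (INR m / 2 - INR (S i)))))
          (Nat.div (m + 1) 2)))
    (Cdiv (nu m a) (RtoC (x + 1))).

Definition is_RInt (g : R -> R) (lo hi v : R) : Prop :=
  exists pr : Riemann_integrable g lo hi, RiemannInt pr = v.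

Definition is_improper_integral_0_inf (g : R -> Cx) (v : Cx) : Prop :=
  forall eta, 0 < eta -> exists eps0 X0, 0 < eps0 /\
    forall eps X, 0 < eps < eps0 -> X0 < X ->
      exists vr vi, is_RInt (fun x => fst (g x)) eps X vr /\
                    is_RInt (fun x => snd (g x)) eps X vi /\
                    Cnorm (Csub (vr, vi) v) < eta.

Definition is_L (m : nat) (a : nat -> Cx) (lam v : Cx) : Prop :=
  is_improper_integral_0_inf (Lintegrand m a lam) v.

Definition is_Sibuya_solution (m : nat) (f f1 : Cx -> (nat -> Cx) -> Cx -> Cx) : Prop :=
  forall (a : nat -> Cx) (lam : Cx),
    (forall z : Cx,
       Cderiv (fun w => f w a lam) z (f1 z a lam) /\
       Cderiv (fun w => f1 w a lam) z
         (Cmul (Cadd (Cadd (Cpown z m) (Peval m a z)) lam) (f z a lam))) /\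
    (forall eps, 0 < eps -> exists K R0, forall z : Cx,
       Rabs (Carg z) <= 3 * PI / (INR m + 2) - eps -> R0 <= Cnorm z ->
       let main0 := Cmul (Cpow z (Csub (mu m a) (RtoC (INR m / 2))))
                         (Cexp (Copp (Ffun m a z))) in
       let main1 := Cmul (Cpow z (mu m a)) (Cexp (Copp (Ffun m a z))) in
       Cnorm (Csub (f z a lam) main0) <= K * Rpower (Cnorm z) (- / 2) * Cnorm main0 /\
       Cnorm (Cadd (f1 z a lam) main1) <= K * Rpower (Cnorm z) (- / 2) * Cnorm main1).

(* Main.v *)
(** On the real half-line put [Q x = x^m + P x + lam] and [xi x] the integral of [sqrt Q] from
    [0] to [x].  In the sector [Q] avoids the negative half-line, so [Re (sqrt Q) > 0] and the
    WKB coordinates [h = y Q^(1/4) exp xi], [k = h' / sqrt Q] are defined for a solution [y].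
    With [H = h - k/2] the equation [y'' = Q y] becomes
      [H' = e (H + k/2)],   [k' = 2 sqrt Q k - 2 e (H + k/2)],
    where [e = (5 Q'^2 / (16 Q^2) - Q'' / (4 Q)) / (2 sqrt Q)] satisfies
    [|e x| <= A (x + T)^(-2-m/2)] for [T = |lam|^(1/m)], hence has total integral
    [O(|lam|^(-1/2-1/m))].  The energy [|H|^2 + |k|^2/4] controls the system from infinity down
    to [0], the growing term [2 sqrt Q k] having the favourable sign.  Sibuya's asymptotics give
    [H -> exp L] and [k -> 0] at infinity, because [xi - F - nu ln (x + 1)] is a primitive of the
    integrand of [L] vanishing at [0]; it converges since the [b_j] are the Taylor
    coefficients of [sqrt (1 + P/x^m)] in powers of [1/x].  So [h 0] and [k 0] are known up to
    [O(|lam|^(-1/2-1/m))], and these are the boundary values of [y] and [y'] up to [Q(0)^(1/4)]. *)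

Require Import Defs.
From Stdlib Require Import Reals Lra Lia Psatz.
From Coquelicot Require Import Coquelicot.
Open Scope R_scope.

(** * Complex-valued functions of a real variable *)

(** The constants [K] and [R0] in [is_Sibuya_solution] may depend on [a] and [lam], so the
    asymptotics at infinity cannot by themselves give a uniform error. They serve only to identify
    two limits; every uniform constant comes from the differential system on the half-line. That
    system is linear, so all errors appear as multiples of [|exp L|], as a relative estimate
    requires, however large or small [exp L] may be.

    The function [e] is the WKB defect: [2 sqrt Q e = Q^(1/4) (Q^(-1/4))''], the relative amount by
    which [Q^(-1/4) exp (-xi)] fails to solve the equation. Since [h' = sqrt Q k], the coordinate
    [h] alone meets an unbounded coefficient; subtracting [k/2] cancels it and leaves [H'] driven by
    [e] only. In the equation for [k] the large coefficient remains, but there only the sign of its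
    real part matters, so no upper bound on [sqrt Q] enters the energy estimate. *)

Definition cexp (z : C) : C := Cexp z.

Lemma is_derive_eq (f : R -> R) x l l' : is_derive f x l -> l = l' -> is_derive f x l'.
Proof. now intros H <-. Qed.

Lemma is_derive_Rmult (f g : R -> R) x df dg :
  is_derive f x df -> is_derive g x dg ->
  is_derive (fun t => f t * g t) x (df * g x + f x * dg).
Proof. intros Hf Hg. apply (is_derive_mult f g x df dg Hf Hg). intros; apply Rmult_comm. Qed.

(** Componentwise, so that each rule reduces to a real one and the mean value theorem can be applied
    to real and imaginary parts. *)
Definition cder (f : R -> C) (x : R) (l : C) : Prop :=
  is_derive (fun t => Re (f t)) x (Re l) /\ is_derive (fun t => Im (f t)) x (Im l).

Lemma cder_eq f x l l' : cder f x l -> l = l' -> cder f x l'.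
Proof. now intros H <-. Qed.

Lemma cder_ext_loc f g x l :
  locally x (fun t => f t = g t) -> cder f x l -> cder g x l.
Proof.
  intros E [H1 H2]; split;
  (eapply is_derive_ext_loc; [|eassumption]; revert E; apply filter_imp; now intros t ->).
Qed.

Lemma cder_ext f g x l : (forall t, f t = g t) -> cder f x l -> cder g x l.
Proof. intros E; apply cder_ext_loc; now apply filter_forall. Qed.

Lemma cder_unique f x l l' : cder f x l -> cder f x l' -> l = l'.
Proof.
  intros [A B] [A' B'].
  apply is_derive_unique in A, B, A', B'.
  apply injective_projections; unfold Re, Im in *; congruence.
Qed.

Lemma cder_const (c : C) x : cder (fun _ => c) x 0.
Proof. split; apply (is_derive_const (K := R_AbsRing) (V := R_NormedModule)). Qed.

Lemma cder_plus f g x df dg :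
  cder f x df -> cder g x dg -> cder (fun t => f t + g t)%C x (df + dg)%C.
Proof.
  intros [A B] [A' B']; split;
    [apply (is_derive_plus _ _ _ _ _ A A') | apply (is_derive_plus _ _ _ _ _ B B')].
Qed.

Lemma cder_opp f x df : cder f x df -> cder (fun t => - f t)%C x (- df)%C.
Proof. intros [A B]; split; [apply (is_derive_opp _ _ _ A) | apply (is_derive_opp _ _ _ B)]. Qed.

Lemma cder_minus f g x df dg :
  cder f x df -> cder g x dg -> cder (fun t => f t - g t)%C x (df - dg)%C.
Proof. intros A B; apply cder_plus; [|apply cder_opp]; assumption. Qed.

Lemma cder_mult f g x df dg :
  cder f x df -> cder g x dg -> cder (fun t => f t * g t)%C x (df * g x + f x * dg)%C.
Proof.
  intros [A B] [A' B']; split; simpl.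
  - eapply is_derive_eq.
    + apply (is_derive_minus _ _ _ _ _ (is_derive_Rmult _ _ _ _ _ A A') (is_derive_Rmult _ _ _ _ _ B B')).
    + unfold minus, plus, opp, Re, Im; simpl; ring.
  - eapply is_derive_eq.
    + apply (is_derive_plus _ _ _ _ _ (is_derive_Rmult _ _ _ _ _ A B') (is_derive_Rmult _ _ _ _ _ B A')).
    + unfold minus, plus, opp, Re, Im; simpl; ring.
Qed.

Lemma cder_RtoC (f : R -> R) x l : is_derive f x l -> cder (fun t => RtoC (f t)) x (RtoC l).
Proof.
  intros H; split; simpl; [exact H|].
  apply (is_derive_const (K := R_AbsRing) (V := R_NormedModule)).
Qed.

Lemma Cnorm2_neq0 (z : C) : z <> 0 -> fst z ^ 2 + snd z ^ 2 <> 0.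
Proof.
  intros Hz E. apply Hz.
  assert (fst z = 0 /\ snd z = 0) as [H1 H2] by (split; nra).
  now apply injective_projections.
Qed.

Lemma cder_inv f x df :
  cder f x df -> (f x <> 0)%C -> cder (fun t => / f t)%C x (- df / (f x * f x))%C.
Proof.
  intros [A B] Hf. assert (N := Cnorm2_neq0 _ Hf).
  assert (N2 : fst (f x) * fst (f x) + snd (f x) * snd (f x) <> 0) by (simpl in N; lra).
  assert (D : is_derive (fun t => fst (f t) ^ 2 + snd (f t) ^ 2) x
            (2 * fst (f x) * fst df + 2 * snd (f x) * snd df)).
  { eapply is_derive_eq.
    - apply (is_derive_plus _ _ _ _ _ (is_derive_pow _ 2 _ _ A) (is_derive_pow _ 2 _ _ B)).
    - unfold plus, Re, Im; simpl; ring. }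
  assert (M : (fst (f x) * fst (f x) - snd (f x) * snd (f x)) ^ 2
      + (fst (f x) * snd (f x) + snd (f x) * fst (f x)) ^ 2 <> 0).
  { replace (_ + _) with ((fst (f x) ^ 2 + snd (f x) ^ 2) ^ 2) by ring. now apply pow_nonzero. }
  split; unfold Re, Im; simpl.
  - eapply is_derive_eq; [apply (is_derive_div _ _ _ _ _ A D N)|].
    unfold Re, Im; simpl; field. simpl in *; lra.
  - eapply is_derive_eq; [apply (is_derive_div _ _ _ _ _ (is_derive_opp _ _ _ B) D N)|].
    unfold opp, Re, Im; simpl; field. simpl in *; lra.
Qed.

Lemma cder_cexp f x df : cder f x df -> cder (fun t => cexp (f t)) x (cexp (f x) * df)%C.
Proof.
  intros [A B].
  assert (E : is_derive (fun t => exp (Re (f t))) x (Re df * exp (Re (f x))))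
    by exact (is_derive_comp exp _ x _ _ (is_derive_exp _) A).
  assert (Co : is_derive (fun t => cos (Im (f t))) x (Im df * - sin (Im (f x))))
    by exact (is_derive_comp cos _ x _ _ (is_derive_cos _) B).
  assert (Si : is_derive (fun t => sin (Im (f t))) x (Im df * cos (Im (f x))))
    by exact (is_derive_comp sin _ x _ _ (is_derive_sin _) B).
  split; unfold cexp, Cexp; simpl;
    (eapply is_derive_eq; [apply is_derive_Rmult; eassumption|]);
    unfold Re, Im; simpl; ring.
Qed.

Lemma cexp_plus (z w : C) : cexp (z + w) = (cexp z * cexp w)%C.
Proof.
  apply injective_projections; unfold cexp, Cexp; simpl; rewrite exp_plus, ?cos_plus, ?sin_plus; ring.
Qed.

Lemma Cmod_cexp z : Cmod (cexp z) = exp (fst z).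
Proof.
  unfold Cmod, cexp; simpl.
  replace (_ + _) with (Rsqr (exp (fst z)) * (Rsqr (sin (snd z)) + Rsqr (cos (snd z)))) by (unfold Rsqr; ring).
  rewrite sin2_cos2, Rmult_1_r. apply sqrt_Rsqr. left; apply exp_pos.
Qed.

Lemma cexp_neq0 z : (cexp z <> 0)%C.
Proof. apply Cmod_gt_0. rewrite Cmod_cexp. apply exp_pos. Qed.

Lemma cexp_0 : cexp (RtoC 0) = 1%C.
Proof. apply injective_projections; unfold cexp, Cexp; simpl; rewrite exp_0, ?cos_0, ?sin_0; ring. Qed.

Lemma cexp_opp z : cexp (- z) = (/ cexp z)%C.
Proof.
  assert (E : (cexp (- z) * cexp z = 1)%C).
  { rewrite <- cexp_plus. rewrite Cplus_comm. unfold cexp, Cexp.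
    replace (z + - z)%C with (RtoC 0) by (apply injective_projections; simpl; ring). apply cexp_0. }
  assert (H := cexp_neq0 z).
  rewrite <- (Cmult_1_l (/ cexp z)). rewrite <- E. field. assumption.
Qed.

Lemma Re_le_Cmod (z : C) : Re z <= Cmod z.
Proof. eapply Rle_trans; [apply Rle_abs|]. apply re_le_Cmod. Qed.

Lemma Cmod_sqr (z : C) : Cmod z ^ 2 = fst z ^ 2 + snd z ^ 2.
Proof. unfold Cmod. apply pow2_sqrt. nra. Qed.

(** The half-angle formula for the principal root. Unlike the polar form it avoids [Carg] and is
    built from real operations that can be differentiated. The condition [0 < Cmod z + Re z] says
    that [z] lies off the closed negative half-line. *)
Definition csqrt (z : C) : C :=
  let u := sqrt ((Cmod z + Re z) / 2) in (u, Im z / (2 * u)).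

Lemma csqrt_Re_pos z : 0 < Cmod z + Re z -> 0 < Re (csqrt z).
Proof. intros H. apply sqrt_lt_R0. lra. Qed.

Lemma csqrt_sqr z : 0 < Cmod z + Re z -> (csqrt z * csqrt z = z)%C.
Proof.
  intros H. assert (U := csqrt_Re_pos z H). unfold csqrt, Re in *; simpl in U.
  set (u := sqrt _) in *.
  assert (U2 : u * u = (Cmod z + Re z) / 2) by (apply sqrt_sqrt; unfold Re; lra).
  assert (N := Cmod_sqr z). destruct z as [a b]; unfold Re in *; simpl in *.
  assert (Bq : b * b = 4 * (u * u) * (u * u - a)) by (rewrite U2; nra).
  apply injective_projections; simpl.
  - replace (b / (2 * u) * (b / (2 * u))) with ((b * b) / (4 * (u * u))) by (field; lra).
    rewrite Bq. field. lra.
  - field. lra.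
Qed.

(** The difference of the squares factors, and [w + csqrt z] has positive real part, so the other
    factor must vanish. *)
Lemma csqrt_unique z w : 0 < Cmod z + Re z -> (w * w = z)%C -> 0 <= Re w -> w = csqrt z.
Proof.
  intros H E W. assert (U := csqrt_Re_pos z H). assert (S := csqrt_sqr z H).
  assert (P : ((w - csqrt z) * (w + csqrt z) = 0)%C)
    by (replace ((w - csqrt z) * (w + csqrt z))%C with (w * w - csqrt z * csqrt z)%C by ring;
        rewrite E, S; ring).
  assert (N : (w + csqrt z <> 0)%C).
  { intros Z. apply (f_equal Re) in Z. unfold Re in *; simpl in *. lra. }
  assert (w - csqrt z = 0)%C.
  { replace (w - csqrt z)%C with ((w - csqrt z) * (w + csqrt z) / (w + csqrt z))%C by (field; assumption).
    rewrite P. field. assumption. }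
  replace w with ((w - csqrt z) + csqrt z)%C by ring. rewrite H0. ring.
Qed.

Lemma cder_continuous f x df : cder f x df ->
  continuous (fun t => Re (f t)) x /\ continuous (fun t => Im (f t)) x.
Proof. intros [A B]; split; apply (ex_derive_continuous (K:=R_AbsRing) (V:=R_NormedModule)); eexists; eassumption. Qed.

Lemma continuous_Cmod (f : R -> C) x :
  continuous (fun t => Re (f t)) x -> continuous (fun t => Im (f t)) x ->
  continuous (fun t => Cmod (f t)) x.
Proof.
  intros A B. unfold Cmod. apply continuous_sqrt_comp.
  apply (continuous_plus (V := R_NormedModule)); simpl.
  - apply (continuous_mult (K := R_AbsRing)); [exact A|]. apply (continuous_mult (K := R_AbsRing)); [exact A|apply continuous_const].
  - apply (continuous_mult (K := R_AbsRing)); [exact B|]. apply (continuous_mult (K := R_AbsRing)); [exact B|apply continuous_const].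
Qed.

Lemma slit_open (f : R -> C) x :
  continuous (fun t => Re (f t)) x -> continuous (fun t => Im (f t)) x ->
  0 < Cmod (f x) + Re (f x) -> locally x (fun t => 0 < Cmod (f t) + Re (f t)).
Proof.
  intros A B H.
  assert (K : continuous (fun t => Cmod (f t) + Re (f t)) x)
    by (apply (continuous_plus (V := R_NormedModule)); [now apply continuous_Cmod|assumption]).
  apply (K (fun y => 0 < y)). now apply (open_gt 0).
Qed.

Lemma is_derive_sqrt_comp (f : R -> R) x df :
  is_derive f x df -> 0 < f x -> is_derive (fun t => sqrt (f t)) x (df / (2 * sqrt (f x))).
Proof.
  intros. auto_derive; [split; [eexists; eassumption|split; auto]|].
  replace (Derive (fun x0 => f x0) x) with df by (symmetry; exact (is_derive_unique _ _ _ H)). field. apply Rgt_not_eq, sqrt_lt_R0; assumption.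
Qed.

(* The derivative is found by differentiating csqrt (f t) ^ 2 = f t. *)
Lemma cder_csqrt f x df :
  cder f x df -> 0 < Cmod (f x) + Re (f x) ->
  cder (fun t => csqrt (f t)) x (df / (2 * csqrt (f x)))%C.
Proof.
  intros D H. assert (U := csqrt_Re_pos _ H).
  destruct (cder_continuous _ _ _ D) as [cA cB].
  assert (Hl := slit_open _ _ cA cB H).
  assert (ex : exists l, cder (fun t => csqrt (f t)) x l).
  { destruct D as [A B].
    assert (NZ : (f x <> 0)%C).
    { intros Z. rewrite Z, Cmod_0 in H. unfold Re in H; simpl in H; lra. }
    assert (Np : 0 < fst (f x) ^ 2 + snd (f x) ^ 2) by (generalize (Cnorm2_neq0 _ NZ); nra).
    assert (DM : exists l, is_derive (fun t => Cmod (f t)) x l).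
    { eexists. apply is_derive_sqrt_comp; [|exact Np].
      apply (is_derive_plus _ _ _ _ _ (is_derive_pow _ 2 _ _ A) (is_derive_pow _ 2 _ _ B)). }
    destruct DM as [lM DM].
    assert (DU : exists l, is_derive (fun t => Re (csqrt (f t))) x l).
    { eexists. unfold csqrt, Re at 1; simpl.
      apply is_derive_sqrt_comp; [|lra].
      apply (is_derive_scal_l (K:=R_AbsRing) (V:=R_NormedModule) _ x _ (/ 2)
        (is_derive_plus _ _ _ _ _ DM A)). }
    destruct DU as [lU DU].
    assert (DV : exists l, is_derive (fun t => Im (csqrt (f t))) x l).
    { eexists. unfold csqrt, Im at 1; simpl.
      apply (is_derive_div _ _ _ _ _ B (is_derive_scal _ _ 2 _ DU)).
      unfold csqrt, Re, Im in *; simpl in *. unfold Re in *; lra. }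
    destruct DV as [lV DV]. now exists (lU, lV). }
  destruct ex as [l L]. eapply cder_eq; [exact L|].
  assert (E : cder f x (l * csqrt (f x) + csqrt (f x) * l)%C).
  { eapply cder_ext_loc; [|apply (cder_mult _ _ _ _ _ L L)].
    revert Hl; apply filter_imp. intros t Ht. now apply csqrt_sqr. }
  rewrite (cder_unique _ _ _ _ D E). field.
  intros Z. rewrite Z in U. unfold Re in U; simpl in U; lra.
Qed.

(** * The energy estimate *)

Lemma nonneg_derive_incr (f df : R -> R) a b :
  a <= b -> (forall t, a <= t <= b -> is_derive f t (df t) /\ 0 <= df t) -> f a <= f b.
Proof.
  intros Hab H. destruct (MVT_gen f a b df) as [c [Hc E]].
  - rewrite Rmin_left, Rmax_right by lra. intros; apply H; lra.
  - rewrite Rmin_left, Rmax_right by lra. intros x Hx.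
    apply continuity_pt_filterlim, (ex_derive_continuous (K:=R_AbsRing) (V:=R_NormedModule)).
    eexists; now apply H.
  - rewrite Rmin_left, Rmax_right in Hc by lra.
    assert (0 <= df c) by now apply H. nra.
Qed.

(** [f + M V] is nondecreasing. Working with a primitive [V] of the majorant [w] replaces all
    integrals of [w]. *)
Lemma dominated_derive_bound (f df V w : R -> R) a b M :
  a <= b ->
  (forall t, a <= t <= b -> is_derive f t (df t) /\ is_derive V t (w t) /\ - (M * w t) <= df t) ->
  f a <= f b + M * (V b - V a).
Proof.
  intros Hab H.
  enough (f a + M * V a <= f b + M * V b) by lra.
  apply (nonneg_derive_incr (fun t => f t + M * V t) (fun t => df t + M * w t)); [assumption|].
  intros t Ht. destruct (H t Ht) as [A [B D]]. split; [|lra].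
  apply (is_derive_plus _ _ _ _ _ A (is_derive_scal _ _ M _ B)).
Qed.

Lemma le_plus_eps x y : (forall eps, 0 < eps -> x <= y + eps) -> x <= y.
Proof. intros H. destruct (Rle_or_lt x y) as [|L]; [assumption|]. specialize (H ((x - y) / 2)). lra. Qed.

Lemma Cmod_le_abs (z : C) : Cmod z <= Rabs (Re z) + Rabs (Im z).
Proof.
  assert (N := Cmod_sqr z). assert (P := Cmod_ge_0 z).
  assert (A := Rabs_pos (Re z)). assert (B := Rabs_pos (Im z)).
  assert (EA : Rabs (Re z) ^ 2 = fst z ^ 2) by apply pow2_abs.
  assert (EB : Rabs (Im z) ^ 2 = snd z ^ 2) by apply pow2_abs.
  nra.
Qed.

Lemma Im_abs_le_Cmod (z : C) : Rabs (Im z) <= Cmod z.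
Proof. eapply Rle_trans; [|apply Rmax_Cmod]. apply Rmax_r. Qed.

Lemma Cmod_triangle_sub (z w : C) : Cmod z <= Cmod w + Cmod (z - w).
Proof.
  replace z with (w + (z - w))%C at 1 by ring. apply Cmod_triangle.
Qed.

Definition dot (z w : C) : R := fst z * fst w + snd z * snd w.
Arguments dot (z w)%_C_scope.

Lemma dot_abs_le z w : Rabs (dot z w) <= Cmod z * Cmod w.
Proof.
  assert (A := Cmod_sqr z). assert (B := Cmod_sqr w).
  assert (P := Cmod_ge_0 z). assert (Q := Cmod_ge_0 w).
  apply Rsqr_incr_0_var; [|now apply Rmult_le_pos].
  rewrite <- Rsqr_abs. unfold Rsqr.
  replace (Cmod z * Cmod w * (Cmod z * Cmod w)) with (Cmod z ^ 2 * Cmod w ^ 2) by ring.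
  rewrite A, B. unfold dot.
  assert (0 <= (fst z * snd w - snd z * fst w) ^ 2) by apply pow2_ge_0. nra.
Qed.

Lemma is_derive_Cmod2 f x df :
  cder f x df -> is_derive (fun t => Cmod (f t) ^ 2) x (2 * dot (f x) df).
Proof.
  intros [A B].
  apply (is_derive_ext (fun t => fst (f t) ^ 2 + snd (f t) ^ 2)).
  { intros t; symmetry; apply Cmod_sqr. }
  eapply is_derive_eq.
  - apply (is_derive_plus _ _ _ _ _ (is_derive_pow _ 2 _ _ A) (is_derive_pow _ 2 _ _ B)).
  - unfold dot, plus, Re, Im; simpl; ring.
Qed.

(** The factor 2 arises because the real and imaginary parts are bounded separately and then
    added. *)
Lemma Cmod_diff_bound f (df : R -> C) (V w : R -> R) a b M :
  a <= b ->
  (forall t, a <= t <= b -> cder f t (df t) /\ is_derive V t (w t) /\ Cmod (df t) <= M * w t) ->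
  Cmod (f b - f a) <= 2 * (M * (V b - V a)).
Proof.
  intros Hab H.
  assert (R1 : forall g dg, (forall t, a <= t <= b -> is_derive g t (dg t) /\ Rabs (dg t) <= M * w t) ->
     Rabs (g b - g a) <= M * (V b - V a)).
  { intros g dg Hg. apply Rabs_le. split.
    - enough (g a <= g b + M * (V b - V a)) by lra.
      apply (dominated_derive_bound g dg V w); [assumption|].
      intros t Ht. destruct (Hg t Ht) as [A B]. destruct (H t Ht) as [_ [D _]].
      split; [assumption|split; [assumption|]]. apply Rabs_le_between in B. lra.
    - enough (- g a <= - g b + M * (V b - V a)) by lra.
      apply (dominated_derive_bound (fun t => - g t) (fun t => - dg t) V w); [assumption|].
      intros t Ht. destruct (Hg t Ht) as [A B]. destruct (H t Ht) as [_ [D _]].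
      split; [apply (is_derive_opp _ _ _ A)|split; [assumption|]].
      apply Rabs_le_between in B. lra. }
  eapply Rle_trans; [apply Cmod_le_abs|].
  assert (A := R1 (fun t => Re (f t)) (fun t => Re (df t))).
  assert (B := R1 (fun t => Im (f t)) (fun t => Im (df t))).
  simpl in A, B. unfold Re, Im in *. simpl.
  assert (Rabs (fst (f b) - fst (f a)) <= M * (V b - V a)).
  { apply A. intros t Ht. destruct (H t Ht) as [[D _] [_ L]]. split; [exact D|].
    eapply Rle_trans; [apply (re_le_Cmod (df t))|assumption]. }
  assert (Rabs (snd (f b) - snd (f a)) <= M * (V b - V a)).
  { apply B. intros t Ht. destruct (H t Ht) as [[_ D] [_ L]]. split; [exact D|].
    eapply Rle_trans; [apply (Im_abs_le_Cmod (df t))|assumption]. }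
  unfold Rminus in *. lra.
Qed.

(** The term [2 S k] contributes [2 Re S |k|^2], which is nonnegative and is dropped; this is how
    the size of [S] disappears from the estimates. *)
Lemma dot_growth (S k u : C) :
  0 <= Re S -> - (2 * (Cmod k * Cmod u)) <= dot k (2 * S * k - 2 * u)%C.
Proof.
  intros HS. assert (A := dot_abs_le k u). apply Rabs_le_between in A.
  replace (dot k (2 * S * k - 2 * u)%C) with (2 * (Re S * (fst k ^ 2 + snd k ^ 2)) - 2 * dot k u)
    by (unfold dot, Re; simpl; ring).
  assert (0 <= Re S * (fst k ^ 2 + snd k ^ 2)) by (apply Rmult_le_pos; nra). lra.
Qed.

Lemma exp_1_le_3 x : x <= 1 -> exp x <= 3.
Proof.
  intros H. eapply Rle_trans; [|apply exp_le_3].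
  destruct H as [H| ->]; [left; now apply exp_increasing|right; reflexivity].
Qed.

Section Energy.
Variables (H k S e : R -> C) (V w : R -> R) (c : C) (E : R).
Hypothesis dH : forall t, 0 <= t -> cder H t (e t * (H t + k t / 2))%C.
Hypothesis dk : forall t, 0 <= t -> cder k t (2 * S t * k t - 2 * (e t * (H t + k t / 2)))%C.
Hypothesis dV : forall t, 0 <= t -> is_derive V t (w t).
Hypothesis S_pos : forall t, 0 <= t -> 0 <= Re (S t).
Hypothesis e_le : forall t, 0 <= t -> Cmod (e t) <= w t.
Hypothesis V_le : forall s t, 0 <= s -> s <= t -> V t - V s <= E.
Hypothesis E_small : E <= / 4.
Hypothesis c_neq0 : (c <> 0)%C.
Hypothesis lim : forall eps, 0 < eps -> exists X, 0 <= X /\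
  forall t, X <= t -> Cmod (H t - c) <= eps /\ Cmod (k t) <= eps.

Let h t := (H t + k t / 2)%C.

Let h_le t : Cmod (h t) <= Cmod (H t) + Cmod (k t) / 2.
Proof.
  unfold h. eapply Rle_trans; [apply Cmod_triangle|].
  right. f_equal. unfold Cdiv. rewrite Cmod_mult, Cmod_inv.
  - rewrite Cmod_R, Rabs_pos_eq by lra. reflexivity.
  - intros Z. apply (f_equal fst) in Z. simpl in Z. lra.
Qed.

Let G t := Cmod (H t) ^ 2 + / 4 * Cmod (k t) ^ 2.

Let w_pos t : 0 <= t -> 0 <= w t.
Proof. intros Ht. eapply Rle_trans; [apply Cmod_ge_0|now apply e_le]. Qed.

Let eh_le t : 0 <= t -> Cmod (e t * h t) <= w t * (Cmod (H t) + Cmod (k t) / 2).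
Proof.
  intros Ht. rewrite Cmod_mult. apply Rmult_le_compat; auto using Cmod_ge_0.
Qed.

(** The weight 1/4 in [G] makes the two losses combine into a perfect square: [G'] is at least
    [-2 w (|H| + |k|/2)^2], hence at least [-4 w G]. The factor [exp (4 V)] absorbs this. *)
Lemma energy_monotone x X : 0 <= x -> x <= X -> G x * exp (4 * V x) <= G X * exp (4 * V X).
Proof.
  intros Hx HX.
  apply (nonneg_derive_incr (fun t => G t * exp (4 * V t))
    (fun t => (2 * dot (H t) (e t * h t) + / 4 * (2 * dot (k t) (2 * S t * k t - 2 * (e t * h t)))) * exp (4 * V t)
      + G t * (4 * w t * exp (4 * V t)))); [assumption|].
  intros t Ht. assert (0 <= t) by lra. split.
  - apply (is_derive_Rmult G (fun t => exp (4 * V t))).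

    + apply (is_derive_plus (fun t => Cmod (H t) ^ 2) (fun t => / 4 * Cmod (k t) ^ 2)).
      * now apply is_derive_Cmod2, dH.
      * apply is_derive_scal, is_derive_Cmod2, dk; assumption.
    + apply (is_derive_comp exp (fun t => 4 * V t)); [apply is_derive_exp|].
      now apply is_derive_scal, dV.
  - replace (_ + _) with (((2 * dot (H t) (e t * h t) + / 4 * (2 * dot (k t) (2 * S t * k t - 2 * (e t * h t))))
       + 4 * w t * G t) * exp (4 * V t)) by ring.
    apply Rmult_le_pos; [|left; apply exp_pos].
    assert (A := dot_abs_le (H t) (e t * h t)). apply Rabs_le_between in A.
    assert (B := dot_growth (S t) (k t) (e t * h t) (S_pos t H0)).
    assert (D := eh_le t H0). assert (W := w_pos t H0).
    assert (P1 := Cmod_ge_0 (H t)). assert (P2 := Cmod_ge_0 (k t)).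
    assert (D1 : Cmod (H t) * Cmod (e t * h t) <= Cmod (H t) * (w t * (Cmod (H t) + Cmod (k t) / 2)))
      by now apply Rmult_le_compat_l.
    assert (D2 : Cmod (k t) * Cmod (e t * h t) <= Cmod (k t) * (w t * (Cmod (H t) + Cmod (k t) / 2)))
      by now apply Rmult_le_compat_l.
    unfold G.
    assert (0 <= w t * (Cmod (H t) - Cmod (k t) / 2) ^ 2) by (apply Rmult_le_pos; [assumption|apply pow2_ge_0]).
    nra.
Qed.

(** At a far point [X], closeness [|c|/100] to the limits gives [G X <= 11/10 |c|^2]. Since
    [E <= 1/4], the exponential factor costs at most [exp 1 <= 3], so [G x <= 4 |c|^2]. *)
Lemma energy_bound x : 0 <= x -> Cmod (H x) <= 2 * Cmod c /\ Cmod (k x) <= 4 * Cmod c.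
Proof.
  intros Hx. assert (Pc : 0 < Cmod c) by now apply Cmod_gt_0.
  destruct (lim (Cmod c / 100)) as [X0 [HX0 L]]; [lra|].
  set (X := Rmax X0 x). destruct (L X (Rmax_l _ _)) as [L1 L2].
  assert (xX : x <= X) by apply Rmax_r.
  assert (A := energy_monotone x X Hx xX).
  assert (VX := V_le x X Hx xX).
  assert (GX : G X <= 11/10 * Cmod c ^ 2).
  { unfold G. assert (T := Cmod_triangle_sub (H X) c).
    assert (Q1 := Cmod_ge_0 (H X)). assert (Q2 := Cmod_ge_0 (k X)).
    assert (Cmod (H X) ^ 2 <= (101/100 * Cmod c) ^ 2) by (apply pow_incr; lra).
    assert (Cmod (k X) ^ 2 <= (1/100 * Cmod c) ^ 2) by (apply pow_incr; lra). nra. }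
  assert (GX0 : 0 <= G X) by (unfold G; generalize (pow2_ge_0 (Cmod (H X))) (pow2_ge_0 (Cmod (k X))); lra).
  assert (B : G x <= G X * exp (4 * (V X - V x))).
  { replace (4 * (V X - V x)) with (4 * V X + - (4 * V x)) by ring.
    rewrite exp_plus, exp_Ropp. apply Rmult_le_reg_r with (exp (4 * V x)); [apply exp_pos|].
    field_simplify; [lra|]. apply Rgt_not_eq, exp_pos. }
  assert (e3 : exp (4 * (V X - V x)) <= 3) by (apply exp_1_le_3; lra).
  assert (Gx : G x <= 4 * Cmod c ^ 2).
  { eapply Rle_trans; [exact B|]. apply Rle_trans with (G X * 3); [now apply Rmult_le_compat_l|].
    nra. }
  unfold G in Gx. assert (Q1 := Cmod_ge_0 (H x)). assert (Q2 := Cmod_ge_0 (k x)).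
  split; nra.
Qed.

Let eh_bound t : 0 <= t -> Cmod (e t * h t) <= 4 * Cmod c * w t.
Proof.
  intros Ht. eapply Rle_trans; [now apply eh_le|].
  destruct (energy_bound t Ht). assert (W := w_pos t Ht). nra.
Qed.

(** Bootstrap: the crude bounds on [H] and [k] give [|H'| <= 4 |c| w], and integrating this from 0
    to a far point gains the small factor [E]. The 8 includes the 2 of [Cmod_diff_bound]. *)
Lemma energy_H : Cmod (H 0 - c) <= 8 * Cmod c * E.
Proof.
  apply le_plus_eps. intros eps Heps. destruct (lim eps Heps) as [X [HX L]].
  destruct (L X (Rle_refl _)) as [L1 _].
  assert (D : Cmod (H X - H 0) <= 2 * ((4 * Cmod c) * (V X - V 0))).
  { apply (Cmod_diff_bound H (fun t => (e t * h t)%C) V w); [assumption|].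
    intros t Ht. assert (0 <= t) by lra. auto. }
  assert (VX := V_le 0 X (Rle_refl _) HX). assert (P := Cmod_ge_0 c).
  assert (T := Cmod_triangle (H 0 - H X) (H X - c)).
  replace (H 0 - H X + (H X - c))%C with (H 0 - c)%C in T by ring.
  replace (H 0 - H X)%C with (- (H X - H 0))%C in T by ring. rewrite Cmod_opp in T.
  assert (Cmod c * (V X - V 0) <= Cmod c * E) by now apply Rmult_le_compat_l. lra.
Qed.

(* sqrt (|k|^2 + eta^2) is a differentiable substitute for |k|; it cannot decrease faster than 8 |c| w. *)
Lemma energy_k : Cmod (k 0) <= 8 * Cmod c * E.
Proof.
  apply le_plus_eps. intros eps0 Heps0. set (eps := eps0 / 2). assert (Heps : 0 < eps) by (unfold eps; lra).
  destruct (lim eps Heps) as [X [HX L]]. destruct (L X (Rle_refl _)) as [_ L2].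
  set (phi := fun t => sqrt (Cmod (k t) ^ 2 + eps ^ 2)).
  assert (pos : forall t, 0 < Cmod (k t) ^ 2 + eps ^ 2) by (intros t; generalize (pow2_ge_0 (Cmod (k t))); nra).
  assert (phk : forall t, Cmod (k t) <= phi t).
  { intros t. unfold phi. rewrite <- (sqrt_pow2 (Cmod (k t))) at 1 by apply Cmod_ge_0. apply sqrt_le_1_alt. nra. }
  assert (D : phi 0 <= phi X + (8 * Cmod c) * (V X - V 0)).
  { apply (dominated_derive_bound phi
      (fun t => (2 * dot (k t) (2 * S t * k t - 2 * (e t * h t))%C) / (2 * phi t)) V w); [assumption|].
    intros t Ht. assert (H0 : 0 <= t) by lra. split; [|split; [now apply dV|]].
    - unfold phi. apply (is_derive_sqrt_comp (fun t => Cmod (k t) ^ 2 + eps ^ 2)); [|apply pos].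
      eapply is_derive_eq; [apply (is_derive_plus (fun t => Cmod (k t) ^ 2) (fun t => eps ^ 2))|].
      + now apply is_derive_Cmod2, dk.
      + apply (is_derive_const (K := R_AbsRing) (V := R_NormedModule)).
      + unfold plus, zero; simpl; unfold h; ring.
    - assert (B := dot_growth (S t) (k t) (e t * h t) (S_pos t H0)).
      assert (D := eh_bound t H0). assert (W := w_pos t H0). assert (P := Cmod_ge_0 (k t)).
      assert (F : 0 < phi t) by (apply sqrt_lt_R0, pos). assert (K := phk t).
      apply Rmult_le_reg_r with (phi t); [assumption|].
      replace (2 * dot (k t) (2 * S t * k t - 2 * (e t * h t))%C / (2 * phi t) * phi t)
        with (dot (k t) (2 * S t * k t - 2 * (e t * h t))%C) by (field; lra).
      assert (Cmod (k t) * Cmod (e t * h t) <= phi t * (4 * Cmod c * w t))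
        by (apply Rmult_le_compat; auto using Cmod_ge_0).
      lra. }
  assert (VX := V_le 0 X (Rle_refl _) HX). assert (P := Cmod_ge_0 c).
  assert (phX : phi X <= 2 * eps).
  { unfold phi. rewrite <- (sqrt_pow2 (2 * eps)) by lra. apply sqrt_le_1_alt.
    assert (Cmod (k X) ^ 2 <= eps ^ 2) by (apply pow_incr; split; [apply Cmod_ge_0|assumption]). nra. }
  assert (Cmod c * (V X - V 0) <= Cmod c * E) by now apply Rmult_le_compat_l.
  assert (K := phk 0). unfold eps in *. lra.
Qed.
End Energy.

(** * Principal branches and sectors *)

Lemma Cmod_polar_atan x y : 0 < x ->
  cos (atan (y / x)) * Cmod (x, y) = x /\ sin (atan (y / x)) * Cmod (x, y) = y.
Proof.
  intros Hx.
  assert (S : 0 < sqrt (1 + (y / x)²)) by (apply sqrt_lt_R0; generalize (Rle_0_sqr (y / x)); lra).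
  assert (E : Cmod (x, y) = x * sqrt (1 + (y / x)²)).
  { unfold Cmod; simpl. rewrite <- (sqrt_Rsqr x) at 3 by lra. rewrite <- sqrt_mult_alt by apply Rle_0_sqr.
    f_equal. unfold Rsqr. field. lra. }
  rewrite cos_atan, sin_atan, E. split; field; lra.
Qed.

Lemma Carg_polar (z : C) : z <> 0 ->
  cos (Carg z) * Cmod z = fst z /\ sin (Carg z) * Cmod z = snd z.
Proof.
  intros Hz. destruct z as [x y]. unfold Carg; simpl.
  assert (M : Cmod (- x, - y) = Cmod (x, y)) by (unfold Cmod; simpl; f_equal; ring).
  destruct (Rlt_dec 0 x) as [Px|Px]; [now apply Cmod_polar_atan|].
  destruct (Rlt_dec x 0) as [Nx|Nx].
  - assert (A := Cmod_polar_atan (- x) (- y)). rewrite M in A.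
    replace (- y / - x) with (y / x) in A by (field; lra).
    destruct A as [A B]; [lra|].
    destruct (Rle_dec 0 y).
    + rewrite neg_cos, neg_sin. split; lra.
    + unfold Rminus. replace (atan (y / x) + - PI) with (- (- atan (y / x) + PI)) by ring.
      rewrite cos_neg, sin_neg, neg_cos, neg_sin, cos_neg, sin_neg. split; lra.
  - assert (x = 0) by lra. subst x.
    destruct (Rlt_dec 0 y).
    + unfold Cmod; simpl. rewrite cos_PI2, sin_PI2.
      replace (0 * (0 * 1) + y * (y * 1)) with (y ^ 2) by ring. rewrite sqrt_pow2 by lra; split; lra.
    + destruct (Rlt_dec y 0).
      * unfold Cmod; simpl. rewrite cos_neg, sin_neg, cos_PI2, sin_PI2.
        replace (0 * (0 * 1) + y * (y * 1)) with ((- y) ^ 2) by ring. rewrite sqrt_pow2 by lra; split; lra.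
      * exfalso. apply Hz. apply injective_projections; simpl; lra.
Qed.

Lemma Carg_bound z : Rabs (Carg z) <= PI.
Proof.
  destruct z as [x y]. unfold Carg; simpl. assert (A := atan_bound (y / x)). assert (P := PI_RGT_0).
  apply Rabs_le.
  destruct (Rlt_dec 0 x); [lra|]. destruct (Rlt_dec x 0).
  - destruct (Rle_dec 0 y).
    + assert (y / x <= 0).
      { unfold Rdiv. replace 0 with (0 * / x) by ring. apply Rmult_le_compat_neg_l with (r := / x) in r0.
        - lra. - left. now apply Rinv_lt_0_compat. }
      assert (atan (y / x) <= 0) by (rewrite <- atan_0; destruct H as [H|H]; [left; now apply atan_increasing|rewrite H; lra]).
      lra.
    + assert (0 < y / x).
      { unfold Rdiv. replace (y * / x) with (- y * / - x) by (field; lra).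
        apply Rmult_lt_0_compat; [lra|apply Rinv_0_lt_compat; lra]. }
      assert (0 < atan (y / x)) by (rewrite <- atan_0; now apply atan_increasing).
      lra.
  - destruct (Rlt_dec 0 y); [lra|]. destruct (Rlt_dec y 0); lra.
Qed.

Definition clog (z : C) : C := Clog z.

Lemma cexp_clog (z : C) : z <> 0 -> cexp (clog z) = z.
Proof.
  intros Hz. destruct (Carg_polar z Hz) as [A B].
  assert (P : 0 < Cmod z) by now apply Cmod_gt_0.
  unfold cexp, Cexp, clog, Clog; simpl. change (Cnorm z) with (Cmod z).
  rewrite exp_ln by assumption. apply injective_projections; simpl; lra.
Qed.

Definition cpow (z w : C) : C := Defs.Cpow z w.

Lemma cpow_cexp (z w : C) : z <> 0 -> cpow z w = cexp (w * clog z)%C.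
Proof.
  intros Hz. unfold cpow, Defs.Cpow; cbv zeta. change (Cnorm z) with (Cmod z).
  destruct (Rlt_dec 0 (Cmod z)) as [|N]; [reflexivity|]. exfalso; apply N; now apply Cmod_gt_0.
Qed.

Lemma cos_ge_of_abs_le x b : Rabs x <= b -> b <= PI -> cos b <= cos x.
Proof.
  intros H Hb. replace (cos x) with (cos (Rabs x)).
  - apply cos_decr_1; try lra; generalize (Rabs_pos x); lra.
  - unfold Rabs. destruct (Rcase_abs x); [apply cos_neg|reflexivity].
Qed.

(** The polar root has argument [Carg z / 2], within [PI / 2] of 0, so its real part is nonnegative
    and [csqrt_unique] applies. *)
Lemma Csqrt_csqrt (z : C) : 0 < Cmod z + Re z -> Csqrt z = csqrt z.
Proof.
  intros H. assert (Hz : z <> 0).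
  { intros ->. rewrite Cmod_0 in H. simpl in H. lra. }
  change (Csqrt z) with (cpow z (RtoC (/ 2))). rewrite cpow_cexp by assumption.
  apply csqrt_unique; [assumption| |].
  - rewrite <- cexp_plus. rewrite <- (cexp_clog z) at 3 by assumption. f_equal.
    apply injective_projections; simpl; field.
  - unfold cexp, Cexp, Re; simpl. apply Rmult_le_pos; [left; apply exp_pos|].
    assert (B := Carg_bound z). apply Rabs_le_between in B. apply cos_ge_0; lra.
Qed.

(** Collects what is needed about the principal fourth root [l]. Its argument is at most [PI / 4] in
    absolute value; comparing with [cos (PI / 3) = 1/2] gives the rational bound on [Re l]. The last
    clause concerns [l * l], the principal square root. *)
Lemma cpow_quarter (z : C) : z <> 0 -> exists l : C,
  cpow z (RtoC (/ 4)) = l /\ cpow z (RtoC (- / 4)) = (/ l)%C /\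
  (l * l * (l * l) = z)%C /\ Cmod l ^ 4 = Cmod z /\ Cmod l <= 2 * Re l /\
  Re (l * l) = Cmod l ^ 2 * cos (Carg z / 2).
Proof.
  intros Hz. exists (cexp (RtoC (/ 4) * clog z)).
  assert (P : 0 < Cmod z) by now apply Cmod_gt_0.
  assert (E : (cexp (RtoC (/ 4) * clog z) * cexp (RtoC (/ 4) * clog z) *
   (cexp (RtoC (/ 4) * clog z) * cexp (RtoC (/ 4) * clog z)) = z)%C).
  { rewrite <- !cexp_plus. rewrite <- (cexp_clog z) at 5 by assumption. f_equal.
    apply injective_projections; simpl; field. }
  assert (B := Carg_bound z). assert (Pi := PI_RGT_0).
  repeat split.
  - now apply cpow_cexp.
  - rewrite cpow_cexp by assumption. rewrite <- cexp_opp. f_equal.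
    apply injective_projections; simpl; ring.
  - assumption.
  - rewrite <- E at 2. rewrite !Cmod_mult. ring.
  - rewrite Cmod_cexp. unfold cexp, Cexp, Re; simpl.
    assert (C4 : cos (PI / 3) <= cos (/ 4 * Carg z + 0 * ln (Cnorm z))).
    { apply cos_ge_of_abs_le; [|lra]. apply Rabs_le. apply Rabs_le_between in B. lra. }
    rewrite cos_PI3 in C4. assert (X := exp_pos (/ 4 * ln (Cnorm z) - 0 * Carg z)). nra.
  - rewrite <- cexp_plus, Cmod_cexp. unfold cexp, Cexp, Re; simpl.
    rewrite Rmult_1_r, <- exp_plus. f_equal; f_equal; field.
Qed.

(** After squaring, the lower bound on [Re lam] leaves exactly the nonnegative surplus
    [(1 - c^2) (|lam| - s)^2]. *)
Lemma sector_add (lam : C) (c s : R) :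
  0 <= c <= 1 -> (2 * c ^ 2 - 1) * Cmod lam <= Re lam -> 0 <= s ->
  c * (Cmod lam + s) <= Cmod (lam + s).
Proof.
  intros Hc H Hs. assert (P := Cmod_ge_0 lam). assert (N := Cmod_sqr lam).
  apply Rsqr_incr_0_var; [|apply Cmod_ge_0]. unfold Rsqr.
  replace (Cmod (lam + s) * Cmod (lam + s)) with (Cmod (lam + s) ^ 2) by ring.
  rewrite Cmod_sqr; simpl fst; simpl snd. unfold Re in H.
  replace ((fst lam + s) ^ 2 + (snd lam + 0) ^ 2) with (Cmod lam ^ 2 + 2 * s * fst lam + s ^ 2) by (rewrite N; ring).
  assert (s * ((2 * c ^ 2 - 1) * Cmod lam) <= s * fst lam) by now apply Rmult_le_compat_l.
  assert (0 <= (1 - c ^ 2) * (Cmod lam - s) ^ 2) by (apply Rmult_le_pos; [nra|apply pow2_ge_0]).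
  nra.
Qed.

(** Here [2 sin (delta/2)^2 - 1 = cos (PI - delta)]; hence [c = sin (delta/2)] is the constant to
    use in [sector_add]. *)
Lemma sector_Re (lam : C) (delta : R) :
  0 < delta <= PI -> Rabs (Carg lam) <= PI - delta -> lam <> 0 ->
  (2 * sin (delta / 2) ^ 2 - 1) * Cmod lam <= Re lam.
Proof.
  intros Hd H Hz. destruct (Carg_polar lam Hz) as [A _]. unfold Re. rewrite <- A.
  apply Rmult_le_compat_r; [apply Cmod_ge_0|].
  replace (2 * sin (delta / 2) ^ 2 - 1) with (cos (PI - delta)).
  - apply cos_ge_of_abs_le; [assumption|lra].
  - rewrite Rtrigo_facts.cos_pi_minus.
    replace (cos delta) with (cos (2 * (delta / 2))) by (f_equal; field).
    rewrite cos_2a_sin. ring.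
Qed.

(* A complex number that is small relative to the distance from [lam] to the negative
   half-line cannot push [lam + s] onto that half-line. *)
Lemma sector_perturb (lam p : C) (c s : R) :
  0 < c <= 1 -> (2 * c ^ 2 - 1) * Cmod lam <= Re lam -> 0 <= s -> lam <> 0 ->
  Cmod p <= c / 2 * (Cmod lam + s) ->
  c / 2 * (Cmod lam + s) <= Cmod (s + p + lam) /\ 0 < Cmod (s + p + lam) + Re (s + p + lam).
Proof.
  intros Hc H Hs Hz Hp. assert (P : 0 < Cmod lam) by now apply Cmod_gt_0.
  set (q := (s + p + lam)%C).
  assert (LB : c / 2 * (Cmod lam + s) <= Cmod q).
  { assert (A := sector_add lam c s ltac:(lra) H Hs).
    assert (T := Cmod_triangle_sub (lam + s) q).
    replace (lam + s - q)%C with (- p)%C in T by (unfold q; ring). rewrite Cmod_opp in T. lra. }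
  split; [assumption|].
  assert (Q := Rmax_Cmod q). assert (Q1 : Rabs (fst q) <= Cmod q) by (eapply Rle_trans; [apply Rmax_l|exact Q]).
  apply Rabs_le_between in Q1. unfold Re.
  destruct (Rlt_dec 0 (Cmod q + fst q)) as [|N]; [assumption|exfalso].
  assert (E : Cmod q = - fst q) by lra.
  assert (E2 := Cmod_sqr q). rewrite E in E2.
  assert (S0 : snd q = 0) by nra.
  assert (Eq : q = RtoC (- Cmod q)) by (apply injective_projections; [change (fst q = - Cmod q)|change (snd q = 0)]; lra).
  (* If [q] were [-|q|], then [lam + (s + |q|) = -p]. The sector bound would make [|p|] at least
     [c (|lam| + s + |q|)], twice what is allowed. *)
  assert (A := sector_add lam c (s + Cmod q) ltac:(lra) H ltac:(generalize (Cmod_ge_0 q); lra)).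
  replace (lam + RtoC (s + Cmod q))%C with (- p)%C in A.
  - rewrite Cmod_opp in A. assert (0 <= Cmod q) by apply Cmod_ge_0. nra.
  - apply (f_equal (fun z => z - RtoC (- Cmod q))%C) in Eq. unfold q at 1 in Eq.
    rewrite RtoC_plus. replace (-p)%C with (lam + (s + Cmod q) - (s + p + lam - RtoC (- Cmod q)))%C.
    + rewrite Eq. ring.
    + rewrite RtoC_opp. ring.
Qed.

(** Closeness of squares implies closeness of roots, because [|u + w| >= Re w]. It serves for the
    expansion of [sqrt Q], for limits of roots, and for fourth roots at the origin. *)
Lemma sqrt_diff_le (u w : C) : 0 <= Re u -> 0 < Re w ->
  Cmod (u - w) * Re w <= Cmod (u * u - w * w).
Proof.
  intros Hu Hw. replace (u * u - w * w)%C with ((u - w) * (u + w))%C by ring.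
  rewrite Cmod_mult. apply Rmult_le_compat_l; [apply Cmod_ge_0|].
  assert (A := Re_le_Cmod (u + w)). unfold Re in *; simpl in A. lra.
Qed.

(** * The WKB transformation *)

Definition ccont (f : R -> C) x := continuous (fun t => Re (f t)) x /\ continuous (fun t => Im (f t)) x.

Definition CRInt (f : R -> C) (a b : R) : C :=
  (RInt (V := R_CompleteNormedModule) (fun t => Re (f t)) a b,
   RInt (V := R_CompleteNormedModule) (fun t => Im (f t)) a b).

Lemma cder_CRInt f a : (forall x, ccont f x) -> forall x, cder (CRInt f a) x (f x).
Proof.
  intros Hf x.
  assert (L : forall g, (forall x, continuous g x) -> is_derive (fun b => RInt (V := R_CompleteNormedModule) g a b) x (g x)).
  { intros g Hg. apply (is_derive_RInt (V := R_NormedModule) g (fun b => RInt (V := R_CompleteNormedModule) g a b) a x); [|apply Hg].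
    apply filter_forall. intros b. apply (RInt_correct (V := R_CompleteNormedModule)).
    apply (ex_RInt_continuous (V := R_CompleteNormedModule)). intros; apply Hg. }
  split; simpl; apply L; intros; apply Hf.
Qed.

Lemma continuous_max0 x : continuous (fun t => Rmax t 0) x.
Proof.
  apply (continuous_ext (fun t => (t + Rabs t) * / 2)).
  { intros t. unfold Rmax, Rabs. destruct (Rle_dec t 0), (Rcase_abs t); lra. }
  apply (continuous_mult (K := R_AbsRing)); [|apply continuous_const].
  apply (continuous_plus (V := R_NormedModule)); [apply continuous_id|apply continuous_Rabs].
Qed.

(* Freezing [f] at its value at [0] on the negative axis makes the primitive differentiable,
   on both sides, at [0]. *)
Lemma cder_primitive f :
  (forall x, 0 <= x -> ccont f x) ->
  forall x, 0 <= x -> cder (CRInt (fun t => f (Rmax t 0)) 0) x (f x).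
Proof.
  intros Hf x Hx. rewrite <- (Rmax_left x 0) at 2 by assumption.
  apply (cder_CRInt (fun t => f (Rmax t 0))). clear x Hx. intros x.
  destruct (Hf (Rmax x 0) (Rmax_r _ _)) as [A B].
  split; [apply (continuous_comp (fun t => Rmax t 0) (fun t => Re (f t)) x (continuous_max0 x) A)
         |apply (continuous_comp (fun t => Rmax t 0) (fun t => Im (f t)) x (continuous_max0 x) B)].
Qed.

Lemma Re_pos_neq0 (z : C) : 0 < Re z -> z <> 0.
Proof. intros H ->. simpl in H. lra. Qed.

Lemma RtoC_neq0 (x : R) : x <> 0 -> RtoC x <> 0.
Proof. intros H E. apply H. now apply (f_equal fst) in E. Qed.

Ltac cder_auto :=
  lazymatch goal with
  | |- cder (fun t => Cplus (@?f t) (@?g t)) _ _ => refine (cder_plus f g _ _ _ _ _); cder_auto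
  | |- cder (fun t => Cminus (@?f t) (@?g t)) _ _ => refine (cder_minus f g _ _ _ _ _); cder_auto
  | |- cder (fun t => Cmult (@?f t) (@?g t)) _ _ => refine (cder_mult f g _ _ _ _ _); cder_auto
  | |- cder (fun _ => ?c) _ _ => refine (cder_const c _)
  | H : cder ?f ?x _ |- cder ?f ?x _ => exact H
  | H : cder ?f ?x _ |- cder (fun t => ?f t) ?x _ => exact H
  end.

Section WKB.
Variables (y y1 Q Q1 Q2 : R -> C).
Hypothesis dy : forall t, 0 <= t -> cder y t (y1 t).
Hypothesis dy1 : forall t, 0 <= t -> cder y1 t (Q t * y t)%C.
Hypothesis dQ : forall t, 0 <= t -> cder Q t (Q1 t).
Hypothesis dQ1 : forall t, 0 <= t -> cder Q1 t (Q2 t).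
Hypothesis Q_slit : forall t, 0 <= t -> 0 < Cmod (Q t) + Re (Q t).

Definition wkb_S t := csqrt (Q t).
Definition wkb_r t := csqrt (wkb_S t).
Definition wkb_xi := CRInt (fun t => wkb_S (Rmax t 0)) 0.
Definition wkb_E t := cexp (wkb_xi t).
Definition wkb_h t := (y t * wkb_r t * wkb_E t)%C.
(** This is [h' / sqrt Q] with the differentiation carried out. The fifth power of [/ wkb_r t] is
    spelled as a product so that the sum and product rules, with the known derivative of [/ wkb_r],
    suffice to differentiate it. *)
Definition wkb_k t := (wkb_E t * (y1 t * / wkb_r t
   + y t * Q1 t * / 4 * (/ wkb_r t * / wkb_r t * / wkb_r t * / wkb_r t * / wkb_r t)
   + y t * wkb_r t))%C.
Definition wkb_H t := (wkb_h t - wkb_k t * / 2)%C.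
(** Expressed through [r = Q^(1/4)], so that [field] verifies the system with [r] as the only
    quantity required to be nonzero. *)
Definition wkb_e t := ((5 / 16 * Q1 t ^ 2 / wkb_r t ^ 8 - Q2 t / (4 * wkb_r t ^ 4)) / (2 * wkb_r t ^ 2))%C.

Lemma wkb_S_pos t : 0 <= t -> 0 < Re (wkb_S t).
Proof. intros; now apply csqrt_Re_pos, Q_slit. Qed.

Lemma wkb_S_slit t : 0 <= t -> 0 < Cmod (wkb_S t) + Re (wkb_S t).
Proof. intros. generalize (wkb_S_pos t H) (Cmod_ge_0 (wkb_S t)). lra. Qed.

Lemma wkb_S_sqr t : 0 <= t -> (wkb_S t * wkb_S t = Q t)%C.
Proof. intros; now apply csqrt_sqr, Q_slit. Qed.

Lemma wkb_r_pos t : 0 <= t -> 0 < Re (wkb_r t).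
Proof. intros; now apply csqrt_Re_pos, wkb_S_slit. Qed.

Lemma wkb_r_sqr t : 0 <= t -> (wkb_r t * wkb_r t = wkb_S t)%C.
Proof. intros; now apply csqrt_sqr, wkb_S_slit. Qed.

Lemma wkb_r_neq0 t : 0 <= t -> wkb_r t <> 0.
Proof. intros; now apply Re_pos_neq0, wkb_r_pos. Qed.

Lemma wkb_Q_r t : 0 <= t -> (Q t = wkb_r t ^ 4)%C.
Proof. intros. rewrite <- wkb_S_sqr, <- wkb_r_sqr by assumption. ring. Qed.

Lemma cder_wkb_S t : 0 <= t -> cder wkb_S t (Q1 t / (2 * wkb_S t))%C.
Proof. intros. apply cder_csqrt; auto. Qed.

Lemma cder_wkb_r t : 0 <= t -> cder wkb_r t (Q1 t / (4 * wkb_r t ^ 3))%C.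
Proof.
  intros. eapply cder_eq; [apply cder_csqrt; [now apply cder_wkb_S|now apply wkb_S_slit]|].
  fold (wkb_r t). rewrite <- wkb_r_sqr by assumption. field. now apply wkb_r_neq0.
Qed.

Lemma cder_wkb_ir t : 0 <= t -> cder (fun t => / wkb_r t)%C t (- (Q1 t / (4 * wkb_r t ^ 5)))%C.
Proof.
  intros. eapply cder_eq; [apply cder_inv; [now apply cder_wkb_r|now apply wkb_r_neq0]|].
  field. now apply wkb_r_neq0.
Qed.

Lemma cder_wkb_xi t : 0 <= t -> cder wkb_xi t (wkb_S t).
Proof.
  apply cder_primitive. intros x Hx.
  destruct (cder_wkb_S x Hx) as [A B].
  split; eapply (ex_derive_continuous (K:=R_AbsRing) (V:=R_NormedModule)); eexists; eassumption.
Qed.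

Lemma wkb_xi_0 : wkb_xi 0 = 0.
Proof. unfold wkb_xi, CRInt. rewrite !RInt_point. reflexivity. Qed.

Lemma cder_wkb_E t : 0 <= t -> cder wkb_E t (wkb_E t * wkb_S t)%C.
Proof. intros; now apply cder_cexp, cder_wkb_xi. Qed.

Lemma cder_wkb_h t : 0 <= t -> cder wkb_h t (wkb_S t * wkb_k t)%C.
Proof.
  intros Ht. assert (A := dy t Ht). assert (B := cder_wkb_r t Ht). assert (D := cder_wkb_E t Ht).
  eapply cder_eq; [unfold wkb_h; cder_auto|].
  unfold wkb_k. rewrite <- wkb_r_sqr by assumption. field. now apply wkb_r_neq0.
Qed.

Lemma cder_wkb_k t : 0 <= t ->
  cder wkb_k t (2 * wkb_S t * wkb_k t - 2 * (wkb_e t * (wkb_H t + wkb_k t / 2)))%C.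
Proof.
  intros Ht. assert (A := dy t Ht). assert (A1 := dy1 t Ht). assert (B := cder_wkb_r t Ht).
  assert (B1 := cder_wkb_ir t Ht). assert (D := cder_wkb_E t Ht). assert (F := dQ1 t Ht).
  eapply cder_eq; [unfold wkb_k; cder_auto|]. cbv beta.
  unfold wkb_e, wkb_H, wkb_h, wkb_k.
  rewrite wkb_Q_r, <- wkb_r_sqr by assumption. field. now apply wkb_r_neq0.
Qed.

Lemma cder_wkb_H t : 0 <= t -> cder wkb_H t (wkb_e t * (wkb_H t + wkb_k t / 2))%C.
Proof.
  intros Ht. assert (A := cder_wkb_h t Ht). assert (B := cder_wkb_k t Ht).
  eapply cder_eq; [unfold wkb_H at 1; cder_auto|]. unfold wkb_H. field.
Qed.

Lemma Cmod_wkb_r t : 0 <= t -> Cmod (wkb_r t) ^ 4 = Cmod (Q t).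
Proof. intros. rewrite <- Cmod_pow, wkb_Q_r by assumption. reflexivity. Qed.
End WKB.

(** * The coefficients b_j *)

(** A copy with values in the type [C], where [ring] and [field] apply; [peval], [pcoef], [ppow],
    [bcoef] and [nuc] below have the same purpose. *)
Definition csum (f : nat -> C) (n : nat) : C := Csum f n.

Lemma csum_S f n : csum f (S n) = (csum f n + f n)%C.
Proof. reflexivity. Qed.

Lemma csum_ext (f g : nat -> C) n : (forall i, (i < n)%nat -> f i = g i) -> csum f n = csum g n.
Proof.
  induction n; intros H; [reflexivity|]. rewrite !csum_S, IHn, H; auto.
Qed.

Lemma csum_plus (f g : nat -> C) n : csum (fun i => f i + g i)%C n = (csum f n + csum g n)%C.
Proof. induction n; [apply injective_projections; simpl; ring|]. rewrite !csum_S, IHn. ring. Qed.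

Lemma csum_scal (c : C) (f : nat -> C) n : csum (fun i => c * f i)%C n = (c * csum f n)%C.
Proof. induction n; [apply injective_projections; simpl; ring|]. rewrite !csum_S, IHn. ring. Qed.

Lemma csum_scal_r (c : C) (f : nat -> C) n : csum (fun i => f i * c)%C n = (csum f n * c)%C.
Proof. induction n; [apply injective_projections; simpl; ring|]. rewrite !csum_S, IHn. ring. Qed.

Lemma csum_zero (f : nat -> C) n : (forall i, (i < n)%nat -> f i = 0) -> csum f n = 0.
Proof.
  induction n; intros H; [reflexivity|]. rewrite csum_S, IHn, H; auto. ring.
Qed.

Lemma csum_split (f : nat -> C) n p : csum f (n + p) = (csum f n + csum (fun i => f (n + i)%nat) p)%C.
Proof.
  induction p.
  - rewrite Nat.add_0_r. apply injective_projections; simpl; ring.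
  - rewrite <- plus_n_Sm, !csum_S, IHp. ring.
Qed.

Lemma csum_cons (f : nat -> C) n : csum f (S n) = (f 0%nat + csum (fun i => f (S i)) n)%C.
Proof.
  change (S n) with (1 + n)%nat. rewrite csum_split. simpl Nat.add.
  apply injective_projections; simpl; ring.
Qed.

Lemma csum_rev (f : nat -> C) n : csum f n = csum (fun i => f (n - S i)%nat) n.
Proof.
  induction n; [reflexivity|]. rewrite csum_S, csum_cons, IHn.
  replace (S n - 1)%nat with n by lia. rewrite Cplus_comm. f_equal.
Qed.

Lemma csum_swap (f : nat -> nat -> C) n p :
  csum (fun i => csum (fun j => f i j) p) n = csum (fun j => csum (fun i => f i j) n) p.
Proof.
  induction n.
  - symmetry. now apply csum_zero.
  - rewrite csum_S, IHn, <- csum_plus. now apply csum_ext.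
Qed.

Lemma csum_trunc (f : nat -> C) n p : (n <= p)%nat -> (forall i, (n <= i < p)%nat -> f i = 0) -> csum f p = csum f n.
Proof.
  intros Hnp H. replace p with (n + (p - n))%nat by lia. rewrite csum_split.
  rewrite (csum_zero (fun i => f (n + i)%nat)); [ring|]. intros; apply H; lia.
Qed.

Lemma Cmod_csum_le (f : nat -> C) n B : (forall i, (i < n)%nat -> Cmod (f i) <= B) -> Cmod (csum f n) <= INR n * B.
Proof.
  induction n; intros H.
  - change (csum f 0) with (RtoC 0). rewrite Cmod_0. simpl. lra.
  - rewrite csum_S, S_INR. eapply Rle_trans; [apply Cmod_triangle|].
    assert (Cmod (csum f n) <= INR n * B) by (apply IHn; auto). assert (Cmod (f n) <= B) by auto. lra.
Qed.

(** Both sides sum [p i * q j] over the triangle [i + j < N], by diagonals and by rows. It is used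
    for the powers of [P] and for the square of the binomial series. *)
Lemma csum_convolution (p q : nat -> C) N :
  csum (fun n => csum (fun i => p i * q (n - i)%nat)%C (S n)) N = csum (fun i => p i * csum q (N - i))%C N.
Proof.
  induction N; [reflexivity|].
  rewrite csum_S, IHN, !csum_S.
  rewrite (csum_ext (fun i => p i * csum q (S N - i))%C (fun i => p i * csum q (N - i) + p i * q (N - i)%nat)%C).
  - rewrite csum_plus. replace (S N - N)%nat with 1%nat by lia. rewrite Nat.sub_diag, csum_S.
    change (csum q 0) with (RtoC 0). ring.
  - intros i Hi. replace (S N - i)%nat with (S (N - i)) by lia. rewrite csum_S. ring.
Qed.

(** * Powers of P and their coefficients *)

Definition peval m a (z : C) : C := Peval m a z.
Definition pcoef m a i : C := Pcoef m a i.
Definition ppow m a k n : C := Ppow_coef m a k n.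

Lemma Cpown_pow (z : C) n : Cpown z n = (z ^ n)%C.
Proof. induction n; [reflexivity|]. simpl. now rewrite IHn. Qed.

Lemma Cpow_add (z : C) n p : (z ^ (n + p) = z ^ n * z ^ p)%C.
Proof. induction n; simpl; [ring|]. rewrite IHn. ring. Qed.

Lemma Cpow_mul (z : C) n p : (z ^ (n * p) = (z ^ n) ^ p)%C.
Proof. induction p; [rewrite Nat.mul_0_r; reflexivity|]. rewrite Nat.mul_succ_r, Nat.add_comm, Cpow_add, IHp. reflexivity. Qed.

Lemma peval_pcoef m a z : peval m a z = csum (fun i => pcoef m a i * z ^ i)%C m.
Proof.
  unfold peval, Peval. change (Csum ?f m) with (csum f m). rewrite csum_rev.
  apply csum_ext. intros i Hi. rewrite Cpown_pow. unfold pcoef, Pcoef.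
  assert (E : (i <? m)%nat = true) by now apply Nat.ltb_lt. rewrite E.
  replace (S (m - S i)) with (m - i)%nat by lia. replace (m - (m - i))%nat with i by lia. reflexivity.
Qed.

Lemma pcoef_high m a i : (m <= i)%nat -> pcoef m a i = 0.
Proof. intros H. unfold pcoef, Pcoef. now rewrite (proj2 (Nat.ltb_ge i m) H). Qed.

Lemma ppow_S m a k n : ppow m a (S k) n = csum (fun i => pcoef m a i * ppow m a k (n - i))%C (S n).
Proof. reflexivity. Qed.

Lemma ppow_high m a k n : (k * (m - 1) < n)%nat -> ppow m a k n = 0.
Proof.
  revert n; induction k; intros n H.
  - unfold ppow; simpl. destruct n; [simpl in H; lia|reflexivity].
  - rewrite ppow_S. apply csum_zero. intros i Hi. destruct (Nat.le_gt_cases m i).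
    + rewrite pcoef_high by assumption. ring.
    + rewrite IHk; [ring|]. simpl in H. lia.
Qed.

(** The recursion for the coefficients is the Cauchy product of [P] with [P^k]. As [N] exceeds the
    degree of the power, each row of the triangle with [i < m] still contains all of [P^k]. *)
Lemma ppow_spec m a k N z : (1 <= m)%nat -> (k * (m - 1) < N)%nat ->
  csum (fun n => ppow m a k n * z ^ n)%C N = (peval m a z ^ k)%C.
Proof.
  intros Hm. revert N; induction k; intros N HN.
  - rewrite (csum_trunc _ 1) by first [lia | intros [|i] Hi; [lia|unfold ppow; simpl; apply Cmult_0_l]].
    apply injective_projections; simpl; ring.
  - rewrite (csum_ext _ (fun n => csum (fun i => (pcoef m a i * z ^ i) * (ppow m a k (n - i) * z ^ (n - i)))%C (S n))).
    + rewrite (csum_convolution (fun i => pcoef m a i * z ^ i)%C (fun j => ppow m a k j * z ^ j)%C).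
      rewrite (csum_ext _ (fun i => (pcoef m a i * z ^ i) * peval m a z ^ k)%C).
      * rewrite csum_scal_r, (csum_trunc _ m), <- peval_pcoef; [reflexivity|simpl in HN; lia|].
        intros i Hi. rewrite pcoef_high by lia. ring.
      * intros i Hi. destruct (Nat.le_gt_cases m i).
        -- rewrite pcoef_high by assumption. ring.
        -- rewrite IHk; [reflexivity|]. simpl in HN. lia.
    + intros n Hn. rewrite ppow_S, <- csum_scal_r. apply csum_ext. intros i Hi.
      replace (z ^ n)%C with (z ^ i * z ^ (n - i))%C by (rewrite <- Cpow_add; f_equal; lia). ring.
Qed.

(** * The binomial series of exponent 1/2 and its square *)

Lemma INR_C_neq0 n : RtoC (INR (S n)) <> 0.
Proof. apply RtoC_neq0, not_0_INR; lia. Qed.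

Definition beta k : C := RtoC (binom_half k).

Lemma beta_S k : (RtoC (INR (S k)) * beta (S k) = beta k * (/ 2 - RtoC (INR k)))%C.
Proof.
  unfold beta. change (binom_half (S k)) with (binom_half k * (/ 2 - INR k) / INR (S k)).
  rewrite <- RtoC_inv, <- RtoC_minus, <- !RtoC_mult by lra. f_equal.
  field. apply not_0_INR; lia.
Qed.

(** Consecutive coefficients have ratio [(1/2 - k) / (k + 1)], at most 1 in absolute value. *)
Lemma Cmod_beta_le k : Cmod (beta k) <= 1.
Proof.
  unfold beta. rewrite Cmod_R. induction k.
  - simpl. rewrite Rabs_R1. lra.
  - change (binom_half (S k)) with (binom_half k * (/ 2 - INR k) / INR (S k)).
    unfold Rdiv. rewrite Rmult_assoc, Rabs_mult.
    assert (P := pos_INR k). rewrite S_INR.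
    assert (Rabs ((/ 2 - INR k) * / (INR k + 1)) <= 1).
    { rewrite Rabs_mult, (Rabs_pos_eq (/ _)) by (left; apply Rinv_0_lt_compat; lra).
      apply Rmult_le_reg_r with (INR k + 1); [lra|]. field_simplify; [|lra].
      apply Rabs_le; lra. }
    assert (A := Rabs_pos (binom_half k)). assert (B := Rabs_pos ((/ 2 - INR k) * / (INR k + 1))). nra.
Qed.

(** The coefficient of [u^n] in the formal square of the series of [(1 + u)^(1/2)]; it should be 1,
    1, 0, 0, and so on. *)
Definition beta_conv n : C := csum (fun i => beta i * beta (n - i))%C (S n).

Lemma beta_conv_weighted n :
  (2 * csum (fun i => RtoC (INR i) * (beta i * beta (n - i)))%C (S n) = RtoC (INR n) * beta_conv n)%C.
Proof.
  set (A := csum _ _). replace (2 * A)%C with (A + A)%C by ring.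
  unfold A at 2. rewrite csum_rev. unfold A, beta_conv. rewrite <- csum_plus, <- csum_scal.
  apply csum_ext. intros i Hi.
  replace (S n - S i)%nat with (n - i)%nat by lia. replace (n - (n - i))%nat with i by lia.
  rewrite minus_INR, RtoC_minus by lia. ring.
Qed.

(** The coefficient form of [(1 + u) g' = g] for [g] the square of the series; this replaces any
    appeal to convergence or to the Vandermonde identity. The factor [1 - n] vanishes at [n = 1],
    which kills all later coefficients. *)
Lemma beta_conv_rec n :
  (RtoC (INR (S n)) * beta_conv (S n) = (1 - RtoC (INR n)) * beta_conv n)%C.
Proof.
  rewrite <- beta_conv_weighted, csum_cons.
  rewrite (csum_ext _ (fun i => / 2 * (beta i * beta (n - i)) + - (1) * (RtoC (INR i) * (beta i * beta (n - i))))%C).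
  - rewrite csum_plus, !csum_scal. fold (beta_conv n).
    replace ((1 - RtoC (INR n)) * beta_conv n)%C with (beta_conv n - RtoC (INR n) * beta_conv n)%C by ring.
    rewrite <- beta_conv_weighted. simpl INR. field.
  - intros i Hi. simpl Nat.sub.
    replace (RtoC (INR (S i)) * (beta (S i) * beta (n - i)))%C
      with (RtoC (INR (S i)) * beta (S i) * beta (n - i))%C by ring.
    rewrite beta_S. ring.
Qed.

Lemma beta_conv_0 : beta_conv 0 = 1.
Proof. apply injective_projections; unfold beta_conv, beta; simpl; ring. Qed.

Lemma beta_conv_1 : beta_conv 1 = 1.
Proof.
  assert (E := beta_conv_rec 0). rewrite beta_conv_0 in E. simpl INR in E.
  replace (beta_conv 1) with (RtoC 1 * beta_conv 1)%C by ring. rewrite E. ring.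
Qed.

Lemma beta_conv_high n : (2 <= n)%nat -> beta_conv n = 0.
Proof.
  induction 1 as [|n Hn IH].
  - assert (E := beta_conv_rec 1). rewrite beta_conv_1 in E.
    replace (beta_conv 2) with (RtoC (INR 2) * beta_conv 2 / RtoC (INR 2))%C by (field; apply INR_C_neq0).
    rewrite E. simpl INR. field. apply (INR_C_neq0 1).
  - assert (E := beta_conv_rec n). rewrite IH in E.
    replace (beta_conv (S n)) with (RtoC (INR (S n)) * beta_conv (S n) / RtoC (INR (S n)))%C by (field; apply INR_C_neq0).
    rewrite E. field. apply INR_C_neq0.
Qed.

Definition sqrt_taylor n (u : C) : C := csum (fun k => beta k * u ^ k)%C (S n).

Lemma pow_le_1_anti x i j : 0 <= x <= 1 -> (i <= j)%nat -> x ^ j <= x ^ i.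
Proof.
  intros Hx Hij. replace j with (i + (j - i))%nat by lia. rewrite pow_add.
  assert (0 <= x ^ i) by (apply pow_le; lra).
  assert (x ^ (j - i) <= 1) by (rewrite <- (pow1 (j - i)); apply pow_incr; lra).
  nra.
Qed.

(** The part of the square of degree at most [n] is exactly [1 + u], since [n >= 1] keeps both
    nonzero coefficients. What remains consists of products of degree above [n], each bounded by
    [|u|^(n+1)] because the coefficients are at most 1. *)
Lemma sqrt_taylor_sqr n u : (1 <= n)%nat -> Cmod u <= 1 ->
  Cmod (sqrt_taylor n u * sqrt_taylor n u - (1 + u)) <= INR (S n) * (INR (S n) * Cmod u ^ S n).
Proof.
  intros Hn Hu. assert (P := Cmod_ge_0 u).
  set (p := fun k => (beta k * u ^ k)%C).
  assert (pb : forall k, Cmod (p k) <= Cmod u ^ k).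
  { intros k. unfold p. rewrite Cmod_mult, Cmod_pow. assert (B := Cmod_beta_le k).
    assert (0 <= Cmod u ^ k) by (now apply pow_le). assert (A := Cmod_ge_0 (beta k)). nra. }
  assert (E : (1 + u)%C = csum (fun i => p i * csum p (S n - i))%C (S n)).
  { rewrite <- csum_convolution.
    rewrite (csum_ext _ (fun j => beta_conv j * u ^ j)%C).
    - rewrite (csum_trunc _ 2) by first [lia | intros i Hi; rewrite beta_conv_high by lia; ring].
      rewrite !csum_S, beta_conv_0, beta_conv_1. change (csum _ 0) with (RtoC 0). simpl. ring.
    - intros j Hj. unfold beta_conv. rewrite <- csum_scal_r. apply csum_ext. intros i Hi. unfold p.
      replace (u ^ j)%C with (u ^ i * u ^ (j - i))%C by (rewrite <- Cpow_add; f_equal; lia). ring. }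
  rewrite E. unfold sqrt_taylor. fold p.
  rewrite <- csum_scal_r.
  replace (csum (fun i => p i * csum p (S n))%C (S n) - csum (fun i => p i * csum p (S n - i))%C (S n))%C
    with (csum (fun i => p i * csum p (S n) + - (1) * (p i * csum p (S n - i)))%C (S n))
    by (rewrite csum_plus, csum_scal; ring).
  apply Cmod_csum_le. intros i Hi.
  replace (p i * csum p (S n) + - (1) * (p i * csum p (S n - i)))%C
    with (p i * (csum p (S n) - csum p (S n - i)))%C by ring.
  replace (csum p (S n)) with (csum p ((S n - i) + i)) by (f_equal; lia).
  rewrite csum_split.
  replace (csum p (S n - i) + csum (fun j => p (S n - i + j)%nat) i - csum p (S n - i))%C
    with (csum (fun j => p (S n - i + j)%nat) i) by ring.
  rewrite Cmod_mult.
  assert (B : Cmod (csum (fun j => p (S n - i + j)%nat) i) <= INR i * Cmod u ^ (S n - i)).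
  { apply Cmod_csum_le. intros j Hj. eapply Rle_trans; [apply pb|]. apply pow_le_1_anti; [lra|lia]. }
  replace (INR (S n) * Cmod u ^ S n) with (Cmod u ^ i * (INR (S n) * Cmod u ^ (S n - i))).
  - apply Rmult_le_compat; auto using Cmod_ge_0. eapply Rle_trans; [exact B|].
    apply Rmult_le_compat_r; [now apply pow_le|]. apply le_INR; lia.
  - replace (Cmod u ^ S n) with (Cmod u ^ i * Cmod u ^ (S n - i)) by (rewrite <- pow_add; f_equal; lia). ring.
Qed.

(** * Expansion of sqrt Q at infinity *)

Definition bigO (f : R -> C) (n : nat) : Prop :=
  exists K X, 0 <= K /\ 1 <= X /\ forall x, X <= x -> Cmod (f x) <= K * (/ x) ^ n.

Lemma inv_le_1 x : 1 <= x -> 0 <= / x <= 1.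
Proof.
  intros H. split; [left; apply Rinv_0_lt_compat; lra|].
  rewrite <- Rinv_1. apply Rinv_le_contravar; lra.
Qed.

Lemma bigO_ext f g n : (forall x, 1 <= x -> f x = g x) -> bigO f n -> bigO g n.
Proof.
  intros E [K [X [HK [HX H]]]]. exists K, X. repeat split; auto.
  intros x Hx. rewrite <- E by lra. auto.
Qed.

Lemma bigO_plus f g n : bigO f n -> bigO g n -> bigO (fun x => f x + g x)%C n.
Proof.
  intros [K [X [HK [HX H]]]] [K' [X' [HK' [HX' H']]]].
  exists (K + K'), (Rmax X X'). repeat split; [lra| |].
  - eapply Rle_trans; [exact HX|apply Rmax_l].
  - intros x Hx. assert (A := Rmax_l X X'). assert (B := Rmax_r X X').
    eapply Rle_trans; [apply Cmod_triangle|].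
    assert (Cmod (f x) <= K * (/ x) ^ n) by (apply H; lra).
    assert (Cmod (g x) <= K' * (/ x) ^ n) by (apply H'; lra). lra.
Qed.

Lemma bigO_mult f g n p : bigO f n -> bigO g p -> bigO (fun x => f x * g x)%C (n + p).
Proof.
  intros [K [X [HK [HX H]]]] [K' [X' [HK' [HX' H']]]].
  exists (K * K'), (Rmax X X'). repeat split; [now apply Rmult_le_pos| |].
  - eapply Rle_trans; [exact HX|apply Rmax_l].
  - intros x Hx. assert (A := Rmax_l X X'). assert (B := Rmax_r X X').
    rewrite Cmod_mult, pow_add.
    replace (K * K' * ((/ x) ^ n * (/ x) ^ p)) with (K * (/ x) ^ n * (K' * (/ x) ^ p)) by ring.
    apply Rmult_le_compat; try apply Cmod_ge_0; [apply H|apply H']; lra.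
Qed.

Lemma bigO_weaken f n p : (p <= n)%nat -> bigO f n -> bigO f p.
Proof.
  intros Hp [K [X [HK [HX H]]]]. exists K, X. repeat split; auto.
  intros x Hx. eapply Rle_trans; [now apply H|]. apply Rmult_le_compat_l; [assumption|].
  apply pow_le_1_anti; [apply inv_le_1; lra|assumption].
Qed.

Lemma bigO_const c : bigO (fun _ => c) 0.
Proof.
  exists (Cmod c), 1. repeat split; [apply Cmod_ge_0|lra|]. intros. simpl. lra.
Qed.

Lemma bigO_scal c f n : bigO f n -> bigO (fun x => c * f x)%C n.
Proof. intros H. apply (bigO_mult _ _ 0 n (bigO_const c) H). Qed.

Lemma bigO_minus f g n : bigO f n -> bigO g n -> bigO (fun x => f x - g x)%C n.
Proof.
  intros Hf Hg. apply (bigO_ext (fun x => f x + (- (1)) * g x)%C); [intros; ring|].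
  apply bigO_plus; [assumption|now apply bigO_scal].
Qed.

Lemma bigO_inv_pow n : bigO (fun x => RtoC (/ x) ^ n)%C n.
Proof.
  exists 1, 1. repeat split; try lra. intros x Hx. rewrite Cmod_pow, Cmod_R, Rabs_pos_eq; [lra|].
  apply inv_le_1; lra.
Qed.

Lemma bigO_csum (f : nat -> R -> C) n N :
  (forall i, (i < N)%nat -> bigO (f i) n) -> bigO (fun x => csum (fun i => f i x) N) n.
Proof.
  induction N; intros H.
  - exists 0, 1. repeat split; try lra. intros x Hx. change (csum _ 0) with (RtoC 0). rewrite Cmod_0. lra.
  - apply (bigO_ext (fun x => csum (fun i => f i x) N + f N x)%C); [reflexivity|].
    apply bigO_plus; auto.
Qed.

Lemma bigO_pow f k : bigO f 1 -> bigO (fun x => f x ^ k)%C k.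
Proof.
  intros H. induction k.
  - apply (bigO_const 1).
  - apply (bigO_mult f (fun x => f x ^ k)%C 1 k H IHk).
Qed.

Lemma bigO_small f n eps : (1 <= n)%nat -> bigO f n -> 0 < eps ->
  exists X, 1 <= X /\ forall x, X <= x -> Cmod (f x) <= eps.
Proof.
  intros Hn H He. apply (bigO_weaken f n 1 Hn) in H. destruct H as [K [X [HK [HX H]]]].
  exists (Rmax X (K / eps)). split; [eapply Rle_trans; [exact HX|apply Rmax_l]|].
  intros x Hx. assert (A := Rmax_l X (K / eps)). assert (B := Rmax_r X (K / eps)).
  eapply Rle_trans; [apply H; lra|]. simpl. rewrite Rmult_1_r.
  apply Rmult_le_reg_r with x; [lra|]. rewrite Rmult_assoc, Rinv_l, Rmult_1_r by lra.
  assert (K / eps * eps <= x * eps) by (apply Rmult_le_compat_r; lra).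
  replace (K / eps * eps) with K in H0 by (field; lra). lra.
Qed.

Definition bcoef m a j : C := bj m a j.

Lemma RtoC_inv_l x : 1 <= x -> (RtoC x * RtoC (/ x) = 1)%C.
Proof. intros. rewrite <- RtoC_mult, Rinv_r by lra. reflexivity. Qed.

Lemma Cpow_inv_sub x n p : 1 <= x -> (p <= n)%nat -> (RtoC x ^ (n - p) * RtoC (/ x) ^ n = RtoC (/ x) ^ p)%C.
Proof.
  intros Hx Hp. replace n with ((n - p) + p)%nat at 2 by lia. rewrite Cpow_add, Cmult_assoc, <- Cpow_mult_l.
  rewrite RtoC_inv_l, Cpow_1_l by assumption. ring.
Qed.

Section Expansion.
Variables (m : nat) (a : nat -> Cx).
Hypothesis m_pos : (1 <= m)%nat.

Let u x := (peval m a (RtoC x) * RtoC (/ x) ^ m)%C.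

(** Reversing the order of the coefficients turns [P^k / x^(m k)] into a polynomial in [1/x]; the
    coefficient of [x^(-j)] is then the one at [m k - j], the index used in [bjk]. *)
Lemma rescaled_pow_expansion k x : (1 <= k)%nat -> 1 <= x ->
  (u x ^ k = csum (fun j => ppow m a k (m * k - j) * RtoC (/ x) ^ j) (S (m * k)))%C.
Proof.
  intros Hk Hx. unfold u. rewrite Cpow_mult_l, <- Cpow_mul.
  rewrite <- (ppow_spec m a k (S (m * k))) by (try assumption; nia).
  rewrite <- csum_scal_r, csum_rev. apply csum_ext. intros j Hj.
  replace (S (m * k) - S j)%nat with (m * k - j)%nat by lia.
  rewrite <- (Cpow_inv_sub x (m * k) j) by (try assumption; lia). ring.
Qed.

Lemma bigO_rescaled : bigO u 1.
Proof.
  apply (bigO_ext (fun x => csum (fun j => ppow m a 1 (m * 1 - j) * RtoC (/ x) ^ j) (S (m * 1)))%C).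
  { intros x Hx. rewrite <- rescaled_pow_expansion by (try assumption; lia). simpl. ring. }
  apply bigO_csum. intros [|j] Hj.
  - rewrite ppow_high by lia.
    apply (bigO_ext (fun x => 0 * RtoC (/ x) ^ 1)%C); [intros; ring|]. apply bigO_scal, bigO_inv_pow.
  - apply (bigO_weaken _ (S j)); [lia|]. apply bigO_scal, bigO_inv_pow.
Qed.

Variable J : nat.
Hypothesis J_pos : (1 <= J)%nat.
Hypothesis J_lt : (J < m)%nat.

Lemma rescaled_pow_truncation k : (1 <= k)%nat ->
  bigO (fun x => u x ^ k - csum (fun j => ppow m a k (m * k - j) * RtoC (/ x) ^ j) (S J))%C (S J).
Proof.
  intros Hk.
  apply (bigO_ext (fun x => csum (fun i => ppow m a k (m * k - (S J + i)) * RtoC (/ x) ^ (S J + i)) (m * k - J))%C).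
  - intros x Hx. rewrite rescaled_pow_expansion by assumption.
    replace (S (m * k)) with (S J + (m * k - J))%nat by nia. rewrite csum_split. ring.
  - apply bigO_csum. intros i Hi. apply (bigO_weaken _ (S J + i)); [lia|]. apply bigO_scal, bigO_inv_pow.
Qed.

Definition b_sum x := (1 + csum (fun i => bcoef m a (S i) * RtoC (/ x) ^ S i) J)%C.

(** The definition of [b_j] stops at [k = j], but extending the sum to [k = J] adds nothing: for
    [k > j] the index [m k - j] exceeds the degree [k (m - 1)]. For [j = 0] every term vanishes. *)
Lemma bcoef_sum j : (j <= J)%nat ->
  csum (fun i => beta (S i) * ppow m a (S i) (m * S i - j))%C J = (if Nat.eqb j 0 then RtoC 0 else bcoef m a j).
Proof.
  intros Hj. assert (Z : forall i, (j <= i)%nat -> ppow m a (S i) (m * S i - j) = 0)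
    by (intros; apply ppow_high; nia).
  rewrite (csum_trunc _ j) by first [assumption | intros i Hi; rewrite Z by lia; ring].
  destruct j; reflexivity.
Qed.

(** Exchanging the sums over [j] and [k] shows that [b_sum] is the binomial polynomial in [u] with
    each [u^k] truncated after [x^(-J)]. *)
Lemma b_sum_taylor : bigO (fun x => b_sum x - sqrt_taylor J (u x))%C (S J).
Proof.
  apply (bigO_ext (fun x => csum (fun k => (- beta (S k)) *
     (u x ^ S k - csum (fun j => ppow m a (S k) (m * S k - j) * RtoC (/ x) ^ j) (S J)))%C J)).
  - intros x Hx. unfold b_sum, sqrt_taylor. rewrite (csum_cons _ J).
    replace (csum (fun i => bcoef m a (S i) * RtoC (/ x) ^ S i) J)%C with
      (csum (fun k => beta (S k) * csum (fun j => ppow m a (S k) (m * S k - j) * RtoC (/ x) ^ j) (S J)) J)%C.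
    + rewrite (csum_ext _ (fun k => beta (S k) * csum (fun j => ppow m a (S k) (m * S k - j) * RtoC (/ x) ^ j) (S J)
          + - (1) * (beta (S k) * u x ^ S k))%C) by (intros; ring).
      rewrite csum_plus, csum_scal. replace (beta 0) with (RtoC 1) by reflexivity. simpl Cpow at 3. ring.
    + rewrite (csum_ext _ (fun k => csum (fun j => beta (S k) * ppow m a (S k) (m * S k - j) * RtoC (/ x) ^ j)%C (S J)))
        by (intros; rewrite <- csum_scal; apply csum_ext; intros; ring).
      rewrite csum_swap, csum_cons.
      rewrite csum_scal_r, (bcoef_sum 0) by lia. simpl Nat.eqb. cbv iota.
      rewrite Cmult_0_l, Cplus_0_l. apply csum_ext. intros j Hj.
      rewrite csum_scal_r, bcoef_sum by lia. reflexivity.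
  - apply bigO_csum. intros k Hk. apply bigO_scal, rescaled_pow_truncation. lia.
Qed.

Lemma b_sum_bounded : bigO b_sum 0.
Proof.
  apply bigO_plus; [apply bigO_const|]. apply bigO_csum. intros i Hi. apply bigO_scal.
  apply (bigO_weaken _ (S i)); [lia|]. apply bigO_inv_pow.
Qed.

Lemma sqrt_taylor_bounded : bigO (fun x => sqrt_taylor J (u x)) 0.
Proof.
  apply bigO_csum. intros i Hi. apply bigO_scal. apply (bigO_weaken _ i); [lia|].
  apply bigO_pow, bigO_rescaled.
Qed.

(** Since [J < m], the contribution [lam x^(-m)] is already within the error; this is why the [b_j]
    do not involve [lam]. *)
Lemma b_sum_sqr lam :
  bigO (fun x => b_sum x * b_sum x - (1 + (peval m a (RtoC x) + lam) * RtoC (/ x) ^ m))%C (S J).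
Proof.
  apply (bigO_ext (fun x =>
     (b_sum x - sqrt_taylor J (u x)) * (b_sum x + sqrt_taylor J (u x))
     + (sqrt_taylor J (u x) * sqrt_taylor J (u x) - (1 + u x)) - lam * RtoC (/ x) ^ m)%C).
  { intros; unfold u; ring. }
  apply bigO_minus; [apply bigO_plus|].
  - rewrite <- (Nat.add_0_r (S J)). apply bigO_mult; [apply b_sum_taylor|].
    apply bigO_plus; [apply b_sum_bounded|apply sqrt_taylor_bounded].
  - destruct (bigO_small u 1 1 (le_n _) bigO_rescaled Rlt_0_1) as [X0 [HX0 H0]].
    destruct (bigO_pow u (S J) bigO_rescaled) as [K [X [HK [HX H]]]].
    exists (INR (S J) * (INR (S J) * K)), (Rmax X0 X).
    assert (P := pos_INR (S J)).
    repeat split; [repeat apply Rmult_le_pos; assumption|eapply Rle_trans; [exact HX|apply Rmax_r]|].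
    intros x Hx. assert (A := Rmax_l X0 X). assert (B := Rmax_r X0 X).
    eapply Rle_trans; [apply sqrt_taylor_sqr; [assumption|apply H0; lra]|].
    rewrite !Rmult_assoc. do 2 (apply Rmult_le_compat_l; [assumption|]).
    rewrite <- Cmod_pow. apply H; lra.
  - apply bigO_scal. apply (bigO_weaken _ m); [lia|]. apply bigO_inv_pow.
Qed.

Lemma b_sum_to_1 : bigO (fun x => b_sum x - 1)%C 1.
Proof.
  apply (bigO_ext (fun x => csum (fun i => bcoef m a (S i) * RtoC (/ x) ^ S i) J)%C).
  { intros. unfold b_sum. ring. }
  apply bigO_csum. intros i Hi. apply bigO_scal, (bigO_weaken _ (S i)); [lia|]. apply bigO_inv_pow.
Qed.
End Expansion.

Lemma Rpower_half_sqr x n : 0 < x -> Rpower x (INR n / 2) * Rpower x (INR n / 2) = x ^ n.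
Proof.
  intros Hx. rewrite <- Rpower_plus. replace (INR n / 2 + INR n / 2) with (INR n) by field.
  now apply Rpower_pow.
Qed.

(** The squares of [S x / x^(m/2)] and of [b_sum] agree up to the stated order. For large [x] the
    real part of [b_sum] is at least 1/2, so [sqrt_diff_le] transfers the order to the roots and
    fixes the branch. *)
Lemma sqrt_expansion m a J lam (S : R -> C) :
  (1 <= J)%nat -> (J < m)%nat ->
  (forall x, 0 <= x -> (S x * S x = RtoC x ^ m + peval m a (RtoC x) + lam)%C /\ 0 <= Re (S x)) ->
  bigO (fun x => S x * RtoC (/ Rpower x (INR m / 2)) - b_sum m a J x)%C (Datatypes.S J).
Proof.
  intros HJ Hm HS.
  destruct (b_sum_sqr m a ltac:(lia) J HJ Hm lam) as [K [X [HK [HX H]]]].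
  destruct (bigO_small _ 1 (/ 2) (le_n _) (b_sum_to_1 m a ltac:(lia) J HJ Hm)) as [X0 [HX0 H0]]; [lra|].
  exists (2 * K), (Rmax X X0). repeat split; [lra|eapply Rle_trans; [exact HX|apply Rmax_l]|].
  intros x Hx. assert (A := Rmax_l X X0). assert (B := Rmax_r X X0).
  specialize (H x ltac:(lra)). specialize (H0 x ltac:(lra)).
  destruct (HS x ltac:(lra)) as [E P].
  set (p := Rpower x (INR m / 2)) in *. set (b := b_sum m a J x) in *.
  assert (Pp : 0 < p) by apply exp_pos.
  assert (pp : p * p = x ^ m) by (apply Rpower_half_sqr; lra).
  assert (Rb : / 2 <= Re b).
  { assert (T := re_le_Cmod (b - 1)). change (Re (b - 1)%C) with (Re b - 1) in T.
    apply Rabs_le_between in T. lra. }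
  set (s := (S x * RtoC (/ p))%C).
  assert (Rs : 0 <= Re s).
  { unfold s. simpl. rewrite Rmult_0_r, Rminus_0_r. apply Rmult_le_pos; [assumption|left; now apply Rinv_0_lt_compat]. }
  assert (D := sqrt_diff_le s b Rs ltac:(lra)).
  assert (Es : (s * s = 1 + (peval m a (RtoC x) + lam) * RtoC (/ x) ^ m)%C).
  { unfold s. replace (S x * RtoC (/ p) * (S x * RtoC (/ p)))%C with ((S x * S x) * RtoC (/ (p * p)))%C.
    - rewrite E, pp, <- pow_inv, RtoC_pow.
      replace ((RtoC x ^ m + peval m a (RtoC x) + lam) * RtoC (/ x) ^ m)%C with
        (RtoC x ^ m * RtoC (/ x) ^ m + (peval m a (RtoC x) + lam) * RtoC (/ x) ^ m)%C by ring.
      rewrite <- Cpow_mult_l, (RtoC_inv_l x), Cpow_1_l by lra. reflexivity.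
    - rewrite Rinv_mult, RtoC_mult. ring. }
  rewrite <- Cmod_opp in H. replace (- (b * b - (1 + (peval m a (RtoC x) + lam) * RtoC (/ x) ^ m)))%C
    with (s * s - b * b)%C in H by (rewrite Es; ring).
  assert (N := Cmod_ge_0 (s - b)). nra.
Qed.

(** * The integral L *)

Lemma cder_csum (f : nat -> R -> C) (d : nat -> C) n x :
  (forall i, (i < n)%nat -> cder (f i) x (d i)) ->
  cder (fun t => csum (fun i => f i t) n) x (csum d n).
Proof.
  induction n; intros H; [apply (cder_const 0)|].
  apply (cder_plus (fun t => csum (fun i => f i t) n) (f n)); auto.
Qed.

Lemma is_derive_Rpower p x : 0 < x -> is_derive (fun t => Rpower t p) x (p * Rpower x (p - 1)).
Proof. intros. apply is_derive_Reals. now apply derivable_pt_lim_power. Qed.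

Lemma cder_scal (c : C) f x l : cder f x l -> cder (fun t => c * f t)%C x (c * l)%C.
Proof.
  intros H. eapply cder_eq; [apply (cder_mult (fun _ => c) f _ _ _ (cder_const c x) H)|]. ring.
Qed.

(** * Primitives near 0 and at infinity, and improper integrals *)

Definition tends0 (f : R -> C) : Prop :=
  forall eta, 0 < eta -> exists d, 0 < d /\ forall x, 0 < x < d -> Cmod (f x) <= eta.

Lemma tends0_plus f g : tends0 f -> tends0 g -> tends0 (fun x => f x + g x)%C.
Proof.
  intros Hf Hg eta He. destruct (Hf (eta / 2)) as [d [Hd H]]; [lra|].
  destruct (Hg (eta / 2)) as [d' [Hd' H']]; [lra|].
  exists (Rmin d d'). split; [now apply Rmin_glb_lt|]. intros x Hx.
  assert (A := Rmin_l d d'). assert (B := Rmin_r d d').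
  eapply Rle_trans; [apply Cmod_triangle|].
  assert (Cmod (f x) <= eta / 2) by (apply H; lra). assert (Cmod (g x) <= eta / 2) by (apply H'; lra). lra.
Qed.

Lemma tends0_scal (c : C) f : tends0 f -> tends0 (fun x => c * f x)%C.
Proof.
  intros Hf eta He. assert (P := Cmod_ge_0 c).
  destruct (Hf (eta / (Cmod c + 1))) as [d [Hd H]]; [apply Rdiv_lt_0_compat; lra|].
  exists d. split; [assumption|]. intros x Hx. rewrite Cmod_mult.
  apply Rle_trans with (Cmod c * (eta / (Cmod c + 1))).
  - apply Rmult_le_compat_l; auto.
  - apply Rmult_le_reg_r with (Cmod c + 1); [lra|]. field_simplify; [|lra]. nra.
Qed.

Lemma tends0_csum (f : nat -> R -> C) n :
  (forall i, (i < n)%nat -> tends0 (f i)) -> tends0 (fun x => csum (fun i => f i x) n).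
Proof.
  induction n; intros H.
  - intros eta He. exists 1. split; [lra|]. intros. change (csum _ 0) with (RtoC 0). rewrite Cmod_0. lra.
  - apply (tends0_plus (fun x => csum (fun i => f i x) n) (f n)); auto.
Qed.

Lemma tends0_Rpower p : 0 < p -> tends0 (fun x => RtoC (Rpower x p)).
Proof.
  intros Hp eta He. exists (Rpower eta (/ p)). split; [apply exp_pos|]. intros x Hx.
  rewrite Cmod_R, Rabs_pos_eq by (left; apply exp_pos).
  replace eta with (Rpower (Rpower eta (/ p)) p)
    by (rewrite Rpower_mult, Rinv_l, Rpower_1; lra).
  apply Rle_Rpower_l; lra.
Qed.

Lemma tends0_ln1p : tends0 (fun x => RtoC (ln (x + 1))).
Proof.
  intros eta He. exists eta. split; [assumption|]. intros x Hx.
  assert (0 < ln (x + 1)) by (rewrite <- ln_1; apply ln_increasing; lra).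
  rewrite Cmod_R, Rabs_pos_eq by lra.
  assert (E := exp_ineq1 (ln (x + 1))). rewrite exp_ln in E by lra. lra.
Qed.

Lemma tends0_ccont f : ccont f 0 -> f 0 = 0 -> tends0 f.
Proof.
  intros [A B] Z eta He.
  assert (A' := proj1 (filterlim_locally _ _) A (mkposreal (eta / 2) ltac:(lra))).
  assert (B' := proj1 (filterlim_locally _ _) B (mkposreal (eta / 2) ltac:(lra))).
  destruct A' as [d Hd]. destruct B' as [d' Hd'].
  exists (Rmin d d'). split; [apply Rmin_glb_lt; apply cond_pos|]. intros x Hx.
  assert (M := Rmin_l d d'). assert (M' := Rmin_r d d').
  assert (bx : forall r, x < r -> Rabs (x - 0) < r) by (intros; rewrite Rminus_0_r, Rabs_pos_eq; lra).
  specialize (Hd x (bx d ltac:(lra))). specialize (Hd' x (bx d' ltac:(lra))).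
  rewrite Z in Hd, Hd'.
  change (Rabs (Re (f x) - 0) < eta / 2) in Hd. change (Rabs (Im (f x) - 0) < eta / 2) in Hd'.
  rewrite Rminus_0_r in Hd, Hd'.
  eapply Rle_trans; [apply Cmod_le_abs|]. lra.
Qed.

Lemma cauchy_at_infinity (G : R -> C) :
  (forall eps, 0 < eps -> exists X, forall s t, X <= s -> s <= t -> Cmod (G t - G s) <= eps) ->
  exists v : C, forall eps, 0 < eps -> exists X, forall t, X <= t -> Cmod (G t - v) <= eps.
Proof.
  intros HC.
  assert (comp : forall (g : R -> R), (forall s t, Rabs (g t - g s) <= Cmod (G t - G s)) ->
    exists l, Un_cv (fun n => g (INR n)) l).
  { intros g Hg. destruct (Rcomplete.R_complete (fun n => g (INR n))) as [l Hl]; [|now exists l].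
    intros eps He. destruct (HC (eps / 2)) as [X HX]; [lra|].
    destruct (INR_unbounded X) as [N HN]. exists N. intros n p Hn Hp.
    apply le_INR in Hn, Hp. unfold Rdist.
    destruct (Rle_dec (INR n) (INR p)).
    - rewrite Rabs_minus_sym. eapply Rle_lt_trans; [apply Hg|].
      eapply Rle_lt_trans; [apply HX; lra|]. lra.
    - eapply Rle_lt_trans; [apply Hg|]. eapply Rle_lt_trans; [apply HX; lra|]. lra. }
  destruct (comp (fun t => Re (G t))) as [lr Hr]; [intros s t; apply (re_le_Cmod (G t - G s))|].
  destruct (comp (fun t => Im (G t))) as [li Hi]; [intros s t; apply (Im_abs_le_Cmod (G t - G s))|].
  exists (lr, li). intros eps He.
  destruct (HC (eps / 3)) as [X HX]; [lra|]. exists X. intros t Ht.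
  destruct (Hr (eps / 3)) as [N1 H1]; [lra|]. destruct (Hi (eps / 3)) as [N2 H2]; [lra|].
  destruct (INR_unbounded t) as [N3 HN3].
  set (n := (N1 + N2 + N3)%nat).
  specialize (H1 n ltac:(unfold n; lia)). specialize (H2 n ltac:(unfold n; lia)).
  assert (t <= INR n) by (unfold n; rewrite plus_INR; generalize (pos_INR (N1 + N2)); lra).
  unfold Rdist in H1, H2.
  replace (G t - (lr, li))%C with (- (G (INR n) - G t) + (G (INR n) - (lr, li)))%C by ring.
  eapply Rle_trans; [apply Cmod_triangle|]. rewrite Cmod_opp.
  assert (Cmod (G (INR n) - G t) <= eps / 3) by now apply HX.
  assert (M := Cmod_le_abs (G (INR n) - (lr, li))).
  change (Re (G (INR n) - (lr, li))%C) with (Re (G (INR n)) - lr) in M.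
  change (Im (G (INR n) - (lr, li))%C) with (Im (G (INR n)) - li) in M. lra.
Qed.

Lemma Defs_is_RInt g lo hi v : is_RInt (V := R_NormedModule) g lo hi v -> Defs.is_RInt g lo hi v.
Proof.
  intros H. assert (ex : ex_RInt g lo hi) by (exists v; exact H).
  exists (ex_RInt_Reals_0 _ _ _ ex). rewrite <- RInt_Reals.
  apply (is_RInt_unique (V := R_CompleteNormedModule)). exact H.
Qed.

(** The fundamental theorem on each compact interval inside the open half-line; differentiability of
    [g] supplies the continuity it asks for. *)
Lemma improper_integral_of_primitive (g G : R -> C) (v : C) :
  (forall x, 0 < x -> cder G x (g x)) -> (forall x, 0 < x -> exists l, cder g x l) ->
  tends0 G -> (forall eps, 0 < eps -> exists X, forall t, X <= t -> Cmod (G t - v) <= eps) ->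
  is_improper_integral_0_inf g v.
Proof.
  intros dG dg G0 Gv eta He.
  destruct (G0 (eta / 3)) as [d [Hd H0]]; [lra|]. destruct (Gv (eta / 3)) as [X HX]; [lra|].
  exists (Rmin d 1), (Rmax X 1). split; [apply Rmin_glb_lt; lra|]. intros eps Y Heps HY.
  assert (A := Rmin_l d 1). assert (A' := Rmin_r d 1). assert (B := Rmax_l X 1). assert (B' := Rmax_r X 1).
  exists (Re (G Y) - Re (G eps)), (Im (G Y) - Im (G eps)).
  assert (I : forall x, Rmin eps Y <= x <= Rmax eps Y -> 0 < x) by (rewrite Rmin_left, Rmax_right by lra; intros; lra).
  split; [|split].
  - apply Defs_is_RInt.
    apply (is_RInt_derive (V := R_CompleteNormedModule) (fun x => Re (G x)) (fun x => Re (g x))).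
    + intros x Hx. apply dG; auto.
    + intros x Hx. destruct (dg x) as [l [D _]]; auto.
      apply (ex_derive_continuous (K:=R_AbsRing) (V:=R_NormedModule)). now exists (Re l).
  - apply Defs_is_RInt.
    apply (is_RInt_derive (V := R_CompleteNormedModule) (fun x => Im (G x)) (fun x => Im (g x))).
    + intros x Hx. apply dG; auto.
    + intros x Hx. destruct (dg x) as [l [_ D]]; auto.
      apply (ex_derive_continuous (K:=R_AbsRing) (V:=R_NormedModule)). now exists (Im l).
  - change (Cmod ((G Y - G eps) - v)%C < eta).
    replace ((G Y - G eps) - v)%C with ((G Y - v) + - G eps)%C by ring.
    eapply Rle_lt_trans; [apply Cmod_triangle|]. rewrite Cmod_opp.
    assert (Cmod (G eps) <= eta / 3) by (apply H0; lra).
    assert (Cmod (G Y - v) <= eta / 3) by (apply HX; lra). lra.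
Qed.

Definition Qfun m a (lam : C) (x : R) : C := (RtoC x ^ m + peval m a (RtoC x) + lam)%C.

Definition nuc m a : C := nu m a.

Lemma ccont_of_cder f x l : cder f x l -> ccont f x.
Proof.
  intros [A B]; split; apply (ex_derive_continuous (K:=R_AbsRing) (V:=R_NormedModule)); eexists; eassumption.
Qed.

Section ImproperIntegral.
Variables (m : nat) (a : nat -> Cx) (lam : C) (S xi : R -> C).
Hypothesis Hm : (3 <= m)%nat.
Hypothesis slit : forall x, 0 <= x -> 0 < Cmod (Qfun m a lam x) + Re (Qfun m a lam x).
Hypothesis S_def : forall x, S x = csqrt (Qfun m a lam x).
Hypothesis dS : forall x, 0 <= x -> exists l, cder S x l.
Hypothesis dxi : forall x, 0 <= x -> cder xi x (S x).
Hypothesis xi_0 : xi 0 = 0.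

Let J0 := Nat.div (m + 1) 2.
Let ex i := INR m + 2 - 2 * INR (Datatypes.S i).

(** With [j = i + 1] this is [2 j <= m + 1 < m + 2]. It keeps the denominators in [F] nonzero and
    makes every term of [F] vanish at 0. *)
Let ex_pos i : (i < J0)%nat -> 0 < ex i.
Proof.
  intros Hi. unfold ex.
  assert (H : (2 * Datatypes.S i <= m + 1)%nat).
  { assert (D := Nat.Div0.mul_div_le (m + 1) 2). fold J0 in D. lia. }
  apply le_INR in H. rewrite mult_INR, plus_INR in H. simpl INR in H at 1 3. simpl (INR 1) in H. lra.
Qed.

Definition Freal x := (RtoC (2 / (INR m + 2)) * RtoC (Rpower x ((INR m + 2) / 2)) +
  csum (fun i => RtoC (2 / ex i) * (bcoef m a (Datatypes.S i) * RtoC (Rpower x (ex i / 2)))) J0)%C.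

Lemma Ffun_Freal x : 0 < x -> Ffun m a (RtoC x) = Freal x.
Proof.
  intros Hx.
  assert (E : forall p, Defs.Cpow (RtoC x) (Defs.RtoC p) = RtoC (Rpower x p)).
  { intros p. change (cpow (RtoC x) (RtoC p) = RtoC (Rpower x p)).
    rewrite cpow_cexp by (apply RtoC_neq0; lra).
    unfold clog, Clog, Carg, cexp, Cexp. simpl. change (Cnorm (RtoC x)) with (Cmod (RtoC x)).
    destruct (Rlt_dec 0 x); [|lra]. replace (0 / x) with 0 by (field; lra). rewrite atan_0, Cmod_R, Rabs_pos_eq by lra.
    apply injective_projections; simpl; unfold Rpower; rewrite ?Rmult_0_r, ?Rmult_0_l, ?Rplus_0_r, ?Rminus_0_r, ?cos_0, ?sin_0; ring. }
  unfold Ffun, Freal. rewrite E. unfold Cadd at 1. change (Cadd ?p ?q) with (Cplus p q).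
  change (Csum ?f ?n) with (csum f n). cbv zeta.
  apply (f_equal2 Cplus); [reflexivity|]. apply csum_ext. intros i Hi. rewrite E. reflexivity.
Qed.

Definition Lreal x := (S x - RtoC (Rpower x (INR m / 2))
  - csum (fun i => bcoef m a (Datatypes.S i) * RtoC (Rpower x (INR m / 2 - INR (Datatypes.S i)))) J0
  - nuc m a * RtoC (/ (x + 1)))%C.

Lemma Lintegrand_Lreal x : 0 < x -> Lintegrand m a lam x = Lreal x.
Proof.
  intros Hx. unfold Lintegrand, Lreal. rewrite S_def.
  assert (E : Csqrt (Cadd (Cadd (Cpown (Defs.RtoC x) m) (Peval m a (Defs.RtoC x))) lam) = csqrt (Qfun m a lam x)).
  { rewrite Cpown_pow. apply Csqrt_csqrt, slit. lra. }
  rewrite E. rewrite RtoC_inv by lra. reflexivity.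
Qed.

Definition Lprim x := (xi x - Freal x - nuc m a * RtoC (ln (x + 1)))%C.

Lemma cder_Freal x : 0 < x -> cder Freal x
  (RtoC (Rpower x (INR m / 2)) + csum (fun i => bcoef m a (Datatypes.S i) * RtoC (Rpower x (INR m / 2 - INR (Datatypes.S i)))) J0)%C.
Proof.
  intros Hx. unfold Freal. assert (P := pos_INR m).
  apply (cder_plus (fun x => RtoC (2 / (INR m + 2)) * RtoC (Rpower x ((INR m + 2) / 2)))%C).
  - eapply cder_eq; [apply cder_scal, cder_RtoC, is_derive_Rpower; assumption|].
    rewrite <- RtoC_mult. f_equal. replace ((INR m + 2) / 2 - 1) with (INR m / 2) by field. field. lra.
  - apply (cder_csum (fun i x => RtoC (2 / ex i) * (bcoef m a (Datatypes.S i) * RtoC (Rpower x (ex i / 2))))%C).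
    intros i Hi. assert (Q := ex_pos i Hi).
    eapply cder_eq; [apply cder_scal, cder_scal, cder_RtoC, is_derive_Rpower; assumption|].
    replace (ex i / 2 - 1) with (INR m / 2 - INR (Datatypes.S i)) by (unfold ex; field).
    rewrite RtoC_mult.
    replace (bcoef m a (Datatypes.S i)) with (RtoC (2 / ex i * (ex i / 2)) * bcoef m a (Datatypes.S i))%C at 2.
    + rewrite RtoC_mult. ring.
    + replace (2 / ex i * (ex i / 2)) with 1 by (field; lra). ring.
Qed.

Lemma cder_Lprim x : 0 < x -> cder Lprim x (Lreal x).
Proof.
  intros Hx. unfold Lprim.
  eapply cder_eq; [apply (cder_minus (fun x => xi x - Freal x)%C); [apply cder_minus; [apply dxi; lra|now apply cder_Freal]|]|].
  - apply cder_scal, cder_RtoC. apply (is_derive_comp ln (fun t => t + 1)); [apply is_derive_ln; lra|].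
    apply (is_derive_plus (fun t : R => t) (fun _ => 1)); [apply (is_derive_id (K:=R_AbsRing))|apply (is_derive_const (K := R_AbsRing) (V := R_NormedModule))].
  - unfold Lreal. simpl. unfold scal, plus, one, zero; simpl. unfold mult; simpl.
    replace ((1 + 0) * / (x + 1)) with (/ (x + 1)) by ring. ring.
Qed.

Lemma ex_cder_Lreal x : 0 < x -> exists l, cder Lreal x l.
Proof.
  intros Hx. destruct (dS x) as [l Hl]; [lra|]. eexists. unfold Lreal.
  apply (cder_minus (fun x => S x - RtoC (Rpower x (INR m / 2))
    - csum (fun i => bcoef m a (Datatypes.S i) * RtoC (Rpower x (INR m / 2 - INR (Datatypes.S i)))) J0)%C);
  [apply (cder_minus (fun x => S x - RtoC (Rpower x (INR m / 2)))%C);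
   [apply cder_minus; [exact Hl|apply cder_RtoC, is_derive_Rpower; assumption]|]|].
  - apply (cder_csum (fun i x => bcoef m a (Datatypes.S i) * RtoC (Rpower x (INR m / 2 - INR (Datatypes.S i))))%C).
    intros i Hi. apply cder_scal, cder_RtoC, is_derive_Rpower; assumption.
  - apply cder_scal, cder_RtoC.
    apply (is_derive_inv (fun t => t + 1)); [|lra].
    apply (is_derive_plus (fun t : R => t) (fun _ => 1)); [apply (is_derive_id (K:=R_AbsRing))|apply (is_derive_const (K := R_AbsRing) (V := R_NormedModule))].
Qed.

Lemma tends0_Lprim : tends0 Lprim.
Proof.
  assert (P := pos_INR m).
  assert (E : forall f g : R -> C, (forall x, f x = g x) -> tends0 f -> tends0 g).
  { intros f g Efg Hf eta He. destruct (Hf eta He) as [d [Hd H]]. exists d. split; [assumption|].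
    intros x Hx. rewrite <- Efg. auto. }
  apply (E (fun x => xi x + (- (1) * Freal x + - nuc m a * RtoC (ln (x + 1))))%C).
  { intros x. unfold Lprim. ring. }
  apply tends0_plus; [|apply tends0_plus].
  - apply tends0_ccont; [|assumption]. eapply ccont_of_cder. apply dxi. lra.
  - apply tends0_scal. unfold Freal. apply tends0_plus.
    + apply tends0_scal, tends0_Rpower. lra.
    + apply tends0_csum. intros i Hi. apply tends0_scal, tends0_scal, tends0_Rpower.
      assert (Q := ex_pos i Hi). lra.
  - apply tends0_scal, tends0_ln1p.
Qed.

Let scaled_b_sum J x : 1 <= x ->
  (RtoC (Rpower x (INR m / 2)) * b_sum m a J x = RtoC (Rpower x (INR m / 2)) +
    csum (fun i => bcoef m a (Datatypes.S i) * RtoC (Rpower x (INR m / 2 - INR (Datatypes.S i)))) J)%C.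
Proof.
  intros Hx. unfold b_sum. rewrite Cmult_plus_distr_l, Cmult_1_r, <- csum_scal. f_equal.
  apply csum_ext. intros i Hi. unfold Rminus. rewrite Rpower_plus, Rpower_Ropp, Rpower_pow by lra.
  rewrite <- pow_inv, RtoC_mult, RtoC_pow. ring.
Qed.

Let Rpower_decay J x : 1 <= x ->
  Rpower x (INR m / 2) * (/ x) ^ J = Rpower x (INR m / 2 - INR J).
Proof.
  intros Hx. unfold Rminus. rewrite Rpower_plus, Rpower_Ropp, Rpower_pow, pow_inv by lra. reflexivity.
Qed.

Let S_expansion J : (1 <= J)%nat -> (J < m)%nat -> exists K X, 0 <= K /\ 1 <= X /\ forall x, X <= x ->
  Cmod (S x - RtoC (Rpower x (INR m / 2))
    - csum (fun i => bcoef m a (Datatypes.S i) * RtoC (Rpower x (INR m / 2 - INR (Datatypes.S i)))) J)%C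
  <= K * Rpower x (INR m / 2 - INR (Datatypes.S J)).
Proof.
  intros HJ HJm. destruct (sqrt_expansion m a J lam S HJ HJm) as [K [X [HK [HX H]]]].
  { intros x Hx. rewrite S_def. split; [exact (csqrt_sqr _ (slit x Hx))|left; exact (csqrt_Re_pos _ (slit x Hx))]. }
  exists K, X. repeat split; [assumption|assumption|]. intros x Hx. specialize (H x Hx).
  set (p := Rpower x (INR m / 2)) in *. assert (Pp : 0 < p) by apply exp_pos.
  match goal with |- Cmod ?z <= _ => replace z with (RtoC p * (S x * RtoC (/ p) - b_sum m a J x))%C end.
  - rewrite Cmod_mult, Cmod_R, Rabs_pos_eq, <- Rpower_decay by lra. fold p.
    replace (K * (p * (/ x) ^ Datatypes.S J)) with (p * (K * (/ x) ^ Datatypes.S J)) by ring.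
    apply Rmult_le_compat_l; lra.
  - replace (RtoC p * (S x * RtoC (/ p) - b_sum m a J x))%C
      with (S x * (RtoC p * RtoC (/ p)) - RtoC p * b_sum m a J x)%C by ring.
    unfold p at 3. rewrite scaled_b_sum by lra. fold p.
    rewrite <- RtoC_mult, Rinv_r by lra. ring.
Qed.

(** For [m = 2 n] the sum stops at [x^0], and the next term is [nu / x]; replacing it by
    [nu / (x + 1)] costs at most [|nu| x^(-2)]. For [m = 2 n + 1] the sum ends with [x^(-1/2)] and
    the remainder is [O(x^(-3/2))]. In both cases the expansion is taken with [J = n + 1], and
    [J < m] follows from [m >= 3]. *)
Lemma Lreal_decay : exists K X, 0 <= K /\ 1 <= X /\ forall x, X <= x ->
  Cmod (Lreal x) <= K * Rpower x (- (3 / 2)).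
Proof.
  destruct (Nat.Even_or_Odd m) as [[n En]|[n En]].
  - assert (EJ : J0 = n) by (unfold J0; rewrite En; replace (2 * n + 1)%nat with (1 + n * 2)%nat by lia;
      rewrite Nat.div_add by lia; reflexivity).
    assert (Hnu : nuc m a = bcoef m a (Datatypes.S n)).
    { unfold nuc, nu. replace (Nat.even m) with true by (symmetry; apply Nat.even_spec; now exists n).
      replace (Nat.div m 2) with n by (rewrite En, Nat.mul_comm, Nat.div_mul by lia; reflexivity).
      rewrite Nat.add_1_r. reflexivity. }
    assert (Em : INR m = 2 * INR n) by (rewrite En, mult_INR; reflexivity).
    destruct (S_expansion (Datatypes.S n)) as [K [X [HK [HX H]]]]; [lia|lia|].
    exists (K + Cmod (nuc m a)), X. assert (N := Cmod_ge_0 (nuc m a)).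
    repeat split; [lra|assumption|]. intros x Hx. specialize (H x Hx).
    rewrite csum_S, <- Hnu in H.
    replace (INR m / 2 - INR (Datatypes.S n)) with (- (1)) in H by (rewrite S_INR, Em; field).
    replace (INR m / 2 - INR (Datatypes.S (Datatypes.S n))) with (- (2)) in H by (rewrite !S_INR, Em; field).
    rewrite Rpower_Ropp, Rpower_1 in H by lra.
    unfold Lreal. rewrite EJ.
    match goal with |- Cmod (?z - ?w - nuc m a * _) <= _ =>
      replace (z - w - nuc m a * RtoC (/ (x + 1)))%C with
       ((z - (w + nuc m a * RtoC (/ x))) + nuc m a * RtoC (/ x - / (x + 1)))%C by (rewrite RtoC_minus; ring) end.
    eapply Rle_trans; [apply Cmod_triangle|]. rewrite Cmod_mult, Cmod_R.
    assert (B : Rpower x (- (2)) <= Rpower x (- (3 / 2))) by (apply Rle_Rpower; lra).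
    assert (D : Rabs (/ x - / (x + 1)) <= Rpower x (- (2))).
    { replace (/ x - / (x + 1)) with (/ (x * (x + 1))) by (field; lra).
      rewrite Rabs_pos_eq by (left; apply Rinv_0_lt_compat; nra).
      rewrite Rpower_Ropp. replace 2 with (INR 2) by reflexivity. rewrite Rpower_pow by lra.
      apply Rinv_le_contravar; simpl; nra. }
    rewrite Rmult_plus_distr_r. apply Rplus_le_compat.
    + eapply Rle_trans; [exact H|]. now apply Rmult_le_compat_l.
    + apply Rmult_le_compat_l; lra.
  - assert (EJ : J0 = Datatypes.S n) by (unfold J0; rewrite En; replace (2 * n + 1 + 1)%nat with (Datatypes.S n * 2)%nat by lia;
      rewrite Nat.div_mul by lia; reflexivity).
    assert (Hnu : nuc m a = 0).
    { unfold nuc, nu. replace (Nat.even m) with false; [reflexivity|].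
      symmetry. rewrite <- Nat.negb_odd. replace (Nat.odd m) with true; [reflexivity|].
      symmetry; apply Nat.odd_spec; now exists n. }
    assert (Em : INR m = 2 * INR n + 1) by (rewrite En, plus_INR, mult_INR; reflexivity).
    destruct (S_expansion (Datatypes.S n)) as [K [X [HK [HX H]]]]; [lia|lia|].
    exists K, X. repeat split; [assumption|assumption|]. intros x Hx. specialize (H x Hx).
    replace (INR m / 2 - INR (Datatypes.S (Datatypes.S n))) with (- (3 / 2)) in H by (rewrite !S_INR, Em; field).
    unfold Lreal. rewrite EJ, Hnu. rewrite Cmult_0_l. unfold Cminus at 1. rewrite Copp_0, Cplus_0_r. exact H.
Qed.

Lemma Lprim_converges : exists v : C,
  forall eps, 0 < eps -> exists X, forall t, X <= t -> Cmod (Lprim t - v) <= eps.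
Proof.
  apply cauchy_at_infinity. intros eps He.
  destruct Lreal_decay as [K [X [HK [HX H]]]].
  (* The majorant [x^(-3/2)] has the primitive [-2 x^(-1/2)]. Beyond [eta^(-2)] the tail is at most
     [2 eta], and the doubled bound [4 K eta] stays below [eps]. *)
  set (eta := eps / (4 * (K + 1))). assert (Heta : 0 < eta) by (apply Rdiv_lt_0_compat; lra).
  exists (Rmax X (Rpower (/ eta) 2)). intros s t Hs Hst.
  assert (A := Rmax_l X (Rpower (/ eta) 2)). assert (B := Rmax_r X (Rpower (/ eta) 2)).
  assert (D : Cmod (Lprim t - Lprim s) <= 2 * (K * (- 2 * Rpower t (- / 2) - - 2 * Rpower s (- / 2)))).
  { apply (Cmod_diff_bound Lprim Lreal (fun x => - 2 * Rpower x (- / 2)) (fun x => Rpower x (- (3 / 2)))); [assumption|].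
    intros x Hx. split; [apply cder_Lprim; lra|split; [|apply H; lra]].
    eapply is_derive_eq; [apply is_derive_scal, is_derive_Rpower; lra|].
    replace (- / 2 - 1) with (- (3 / 2)) by field. lra. }
  assert (P := exp_pos (- / 2 * ln t)). fold (Rpower t (- / 2)) in P.
  assert (E : Rpower s (- / 2) <= eta).
  { rewrite Rpower_Ropp. rewrite <- (Rinv_inv eta). apply Rinv_le_contravar; [now apply Rinv_0_lt_compat|].
    replace (/ eta) with (Rpower (Rpower (/ eta) 2) (/ 2)).
    - apply Rle_Rpower_l; [lra|]. split; [apply exp_pos|lra].
    - rewrite Rpower_mult, Rinv_r, Rpower_1; [reflexivity|now apply Rinv_0_lt_compat|lra]. }
  assert (F : 4 * (K + 1) * eta = eps) by (unfold eta; field; lra).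
  assert (K * (- 2 * Rpower t (- / 2) - - 2 * Rpower s (- / 2)) <= K * (2 * eta)) by (apply Rmult_le_compat_l; lra).
  lra.
Qed.

Lemma is_L_of_limit v :
  (forall eps, 0 < eps -> exists X, forall t, X <= t -> Cmod (Lprim t - v) <= eps) -> is_L m a lam v.
Proof.
  intros H.
  assert (I := improper_integral_of_primitive Lreal Lprim v cder_Lprim ex_cder_Lreal tends0_Lprim H).
  assert (R0 : is_improper_integral_0_inf (Lintegrand m a lam) v); [|exact R0].
  intros eta He. destruct (I eta He) as [e0 [X0 [He0 HI]]]. exists (Rmin e0 1), (Rmax X0 1).
  split; [apply Rmin_glb_lt; lra|]. intros eps X Heps HX.
  assert (A := Rmin_l e0 1). assert (A' := Rmin_r e0 1). assert (B := Rmax_l X0 1). assert (B' := Rmax_r X0 1).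
  destruct (HI eps X ltac:(lra) ltac:(lra)) as [vr [vi [[pr Ir] [[pi Ii] N]]]].
  exists vr, vi. split; [|split; [|exact N]].
  - apply Defs_is_RInt. apply (is_RInt_ext (fun x => fst (Lreal x))).
    + intros x Hx. rewrite Rmin_left in Hx by lra. now rewrite Lintegrand_Lreal by lra.
    + rewrite <- Ir, <- RInt_Reals. apply (RInt_correct (V := R_CompleteNormedModule)). now apply ex_RInt_Reals_1.
  - apply Defs_is_RInt. apply (is_RInt_ext (fun x => snd (Lreal x))).
    + intros x Hx. rewrite Rmin_left in Hx by lra. now rewrite Lintegrand_Lreal by lra.
    + rewrite <- Ii, <- RInt_Reals. apply (RInt_correct (V := R_CompleteNormedModule)). now apply ex_RInt_Reals_1.
Qed.
End ImproperIntegral.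

(** * Bounds on Q, uniform in the coefficients *)

Definition Q1fun (m : nat) (a : nat -> Cx) (x : R) : C :=
  (RtoC (INR m * x ^ (m - 1))
   + csum (fun i => (a (S i) : C) * RtoC (INR (m - S i) * x ^ pred (m - S i))) m)%C.

Definition Q2fun (m : nat) (a : nat -> Cx) (x : R) : C :=
  (RtoC (INR m * (INR (m - 1) * x ^ (m - 2)))
   + csum (fun i => (a (S i) : C) * RtoC (INR (m - S i) * (INR (pred (m - S i)) * x ^ pred (pred (m - S i))))) m)%C.

Lemma peval_real m a x :
  peval m a (RtoC x) = csum (fun i => (a (S i) : C) * RtoC (x ^ (m - S i)))%C m.
Proof.
  unfold peval, Peval. change (Csum ?f ?n) with (csum f n). apply csum_ext.
  intros i Hi. rewrite Cpown_pow, RtoC_pow. reflexivity.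
Qed.

Lemma is_derive_pow_id n x : is_derive (fun t => t ^ n) x (INR n * x ^ pred n).
Proof.
  apply is_derive_Reals, derivable_pt_lim_pow.
Qed.

Lemma cder_Qfun m a lam x : cder (Qfun m a lam) x (Q1fun m a x).
Proof.
  eapply cder_eq.
  - apply (cder_ext (fun t => RtoC (t ^ m) + csum (fun i => (a (S i) : C) * RtoC (t ^ (m - S i))) m + lam)%C).
    + intros t. unfold Qfun. now rewrite peval_real, RtoC_pow.
    + apply (cder_plus (fun t => RtoC (t ^ m) + csum (fun i => (a (S i) : C) * RtoC (t ^ (m - S i))) m)%C);
        [|apply cder_const].
      apply cder_plus; [apply cder_RtoC, is_derive_pow_id|].
      apply (cder_csum (fun i t => (a (S i) : C) * RtoC (t ^ (m - S i)))%C).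
      intros i Hi. apply cder_scal, cder_RtoC, is_derive_pow_id.
  - unfold Q1fun. rewrite Nat.sub_1_r. ring.
Qed.

Lemma cder_Q1fun m a x : cder (Q1fun m a) x (Q2fun m a x).
Proof.
  unfold Q1fun.
  apply (cder_plus (fun t => RtoC (INR m * t ^ (m - 1)))).
  - apply cder_RtoC, is_derive_scal.
    replace (m - 2)%nat with (pred (m - 1)) by lia. apply is_derive_pow_id.
  - apply (cder_csum (fun i t => (a (S i) : C) * RtoC (INR (m - S i) * t ^ pred (m - S i)))%C).
    intros i Hi. apply cder_scal, cder_RtoC, is_derive_scal, is_derive_pow_id.
Qed.

(** [U] will be [x + T]: being at least 1, it lets all lower powers of [x] be absorbed into the top
    one. *)
Lemma pow_le_pow_of_ge_1 x U i j : 0 <= x <= U -> 1 <= U -> (i <= j)%nat -> x ^ i <= U ^ j.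
Proof.
  intros Hx HU Hij. apply Rle_trans with (U ^ i); [now apply pow_incr|now apply Rle_pow].
Qed.

Section Bounds.
Variables (m : nat) (a : nat -> Cx) (Rad : R).
Hypothesis Hm : (3 <= m)%nat.
Hypothesis Rad_pos : 0 <= Rad.
Hypothesis a_le : forall i, (1 <= i <= m)%nat -> Cmod (a i) <= Rad.

Let coeff_term i y B : (i < m)%nat -> 0 <= y <= B -> Cmod ((a (S i) : C) * RtoC y) <= Rad * B.
Proof.
  intros Hi Hy. rewrite Cmod_mult, Cmod_R, Rabs_pos_eq by lra.
  apply Rmult_le_compat; [apply Cmod_ge_0|lra|apply a_le; lia|lra].
Qed.

Let INR_le_m n : (n <= m)%nat -> 0 <= INR n <= INR m.
Proof. intros; split; [apply pos_INR|now apply le_INR]. Qed.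

Lemma peval_bound x U : 0 <= x <= U -> 1 <= U -> Cmod (peval m a (RtoC x)) <= INR m * (Rad * U ^ (m - 1)).
Proof.
  intros Hx HU. rewrite peval_real. apply Cmod_csum_le. intros i Hi.
  apply coeff_term; [assumption|]. split; [apply pow_le; lra|]. apply pow_le_pow_of_ge_1; lra || lia.
Qed.

Lemma Q1fun_bound x U : 0 <= x <= U -> 1 <= U ->
  Cmod (Q1fun m a x) <= (INR m + INR m * (Rad * INR m)) * U ^ (m - 1).
Proof.
  intros Hx HU. unfold Q1fun. eapply Rle_trans; [apply Cmod_triangle|].
  assert (P := pos_INR m).
  rewrite Rmult_plus_distr_r. apply Rplus_le_compat.
  - rewrite Cmod_R, Rabs_pos_eq by (apply Rmult_le_pos; [assumption|apply pow_le; lra]).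
    apply Rmult_le_compat_l; [assumption|]. apply pow_le_pow_of_ge_1; lra || lia.
  - replace (INR m * (Rad * INR m) * U ^ (m - 1)) with (INR m * (Rad * (INR m * U ^ (m - 1)))) by ring.
    apply Cmod_csum_le. intros i Hi. apply coeff_term; [assumption|].
    assert (I := INR_le_m (m - S i) ltac:(lia)).
    assert (0 <= x ^ pred (m - S i)) by (apply pow_le; lra).
    split; [now apply Rmult_le_pos|]. apply Rmult_le_compat; try lra.
    apply pow_le_pow_of_ge_1; lra || lia.
Qed.

Lemma Q2fun_bound x U : 0 <= x <= U -> 1 <= U ->
  Cmod (Q2fun m a x) <= (INR m * INR m + INR m * (Rad * (INR m * INR m))) * U ^ (m - 2).
Proof.
  intros Hx HU. unfold Q2fun. eapply Rle_trans; [apply Cmod_triangle|].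
  assert (P := pos_INR m).
  rewrite Rmult_plus_distr_r. apply Rplus_le_compat.
  - assert (I := INR_le_m (m - 1) ltac:(lia)).
    assert (0 <= x ^ (m - 2)) by (apply pow_le; lra).
    rewrite Cmod_R, Rabs_pos_eq by (repeat apply Rmult_le_pos; lra).
    rewrite Rmult_assoc. apply Rmult_le_compat_l; [assumption|].
    apply Rmult_le_compat; try lra. apply pow_le_pow_of_ge_1; lra || lia.
  - replace (INR m * (Rad * (INR m * INR m)) * U ^ (m - 2))
      with (INR m * (Rad * (INR m * (INR m * U ^ (m - 2))))) by ring.
    apply Cmod_csum_le. intros i Hi. apply coeff_term; [assumption|].
    assert (I := INR_le_m (m - S i) ltac:(lia)). assert (I' := INR_le_m (pred (m - S i)) ltac:(lia)).
    assert (0 <= x ^ pred (pred (m - S i))) by (apply pow_le; lra).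
    assert (x ^ pred (pred (m - S i)) <= U ^ (m - 2)) by (apply pow_le_pow_of_ge_1; lra || lia).
    split; [repeat apply Rmult_le_pos; lra|].
    apply Rmult_le_compat; try lra; [apply Rmult_le_pos; lra|]. apply Rmult_le_compat; lra.
Qed.

Lemma pow_add_le x T : 0 <= x -> 0 <= T -> (x + T) ^ m <= 2 ^ m * (T ^ m + x ^ m).
Proof.
  intros Hx HT. assert (A := pow_le x m Hx). assert (B := pow_le T m HT).
  assert (D : 0 <= 2 ^ m) by (apply pow_le; lra).
  destruct (Rle_dec x T).
  - apply Rle_trans with ((2 * T) ^ m); [apply pow_incr; lra|]. rewrite Rpow_mult_distr.
    apply Rmult_le_compat_l; lra.
  - apply Rle_trans with ((2 * x) ^ m); [apply pow_incr; lra|]. rewrite Rpow_mult_distr.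
    apply Rmult_le_compat_l; lra.
Qed.

(** With [T = |lam|^(1/m)] the sum [x^m + |lam|] is comparable to [(x + T)^m], the loss being [2^m].
    The polynomial [P] has size [(x + T)^(m-1)], smaller by a factor [T]; the threshold on [T]
    brings it below [c/2] times that sum, as [sector_perturb] requires. *)
Lemma Qfun_lower lam c T x :
  0 < c <= 1 -> (2 * c ^ 2 - 1) * Cmod lam <= Re lam -> 1 <= T -> Cmod lam = T ^ m ->
  2 * (INR m * Rad) * 2 ^ m / c <= T -> 0 <= x ->
  c / 2 / 2 ^ m * (x + T) ^ m <= Cmod (Qfun m a lam x) /\
  0 < Cmod (Qfun m a lam x) + Re (Qfun m a lam x).
Proof.
  intros Hc Hs HT El HT0 Hx.
  assert (D : 0 < 2 ^ m) by (apply pow_lt; lra).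
  assert (TT : 0 < T ^ m) by (apply pow_lt; lra). assert (XX := pow_le x m Hx).
  assert (PU := pow_add_le x T Hx ltac:(lra)).
  assert (Pb := peval_bound x (x + T) ltac:(lra) ltac:(lra)).
  set (U := x + T) in *. set (q := T ^ m + x ^ m) in *.
  assert (Uq : U ^ (m - 1) * T <= 2 ^ m * q).
  { apply Rle_trans with (U ^ m); [|assumption].
    replace m with (S (m - 1)) at 2 by lia. simpl. rewrite Rmult_comm.
    apply Rmult_le_compat_r; [apply pow_le|]; unfold U; lra. }
  assert (MR : 0 <= INR m * Rad) by (apply Rmult_le_pos; [apply pos_INR|assumption]).
  assert (Small : Cmod (peval m a (RtoC x)) <= c / 2 * q).
  { eapply Rle_trans; [exact Pb|].
    apply Rmult_le_reg_r with T; [lra|].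
    assert (A1 : INR m * (Rad * U ^ (m - 1)) * T <= INR m * Rad * (2 ^ m * q)).
    { replace (INR m * (Rad * U ^ (m - 1)) * T) with (INR m * Rad * (U ^ (m - 1) * T)) by ring.
      now apply Rmult_le_compat_l. }
    assert (A2 : INR m * Rad * 2 ^ m <= c / 2 * T).
    { replace (INR m * Rad * 2 ^ m) with (c / 2 * (2 * (INR m * Rad) * 2 ^ m / c)) by (field; lra).
      apply Rmult_le_compat_l; lra. }
    assert (0 <= q) by (unfold q; lra). nra. }
  assert (Lz : lam <> 0) by (apply Cmod_gt_0; lra).
  destruct (sector_perturb lam (peval m a (RtoC x)) c (x ^ m) Hc Hs XX Lz) as [A B].
  { rewrite El. exact Small. }
  rewrite RtoC_pow, El in A. rewrite RtoC_pow in B. fold q in A. change (RtoC x ^ m + peval m a (RtoC x) + lam)%C with (Qfun m a lam x) in *.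
  split; [|exact B]. eapply Rle_trans; [|exact A].
  apply Rmult_le_reg_r with (2 ^ m); [assumption|].
  replace (c / 2 / 2 ^ m * U ^ m * 2 ^ m) with (c / 2 * U ^ m) by (field; lra).
  rewrite Rmult_assoc. apply Rmult_le_compat_l; lra.
Qed.

End Bounds.

Lemma Cmod_div_le (z w : C) Bz bw : Cmod z <= Bz -> 0 < bw <= Cmod w -> Cmod (z / w) <= Bz / bw.
Proof.
  intros Hz Hw. rewrite Cmod_div by (apply Cmod_gt_0; lra).
  unfold Rdiv. apply Rmult_le_compat; [apply Cmod_ge_0| |assumption|].
  - left; apply Rinv_0_lt_compat; lra.
  - apply Rinv_le_contravar; lra.
Qed.

Lemma Cmod_RtoC_pos x : 0 <= x -> Cmod (RtoC x) = x.
Proof. intros. rewrite Cmod_R. now apply Rabs_pos_eq. Qed.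

(* With |r|^4 = |Q| bounded below by U^m, every derivative of Q gains a factor 1/U. *)
Lemma wkb_term_bounds m (q1 q2 r : C) U c0 M1 M2 :
  (2 <= m)%nat -> 1 <= U -> 0 < c0 -> 0 <= M1 -> 0 <= M2 ->
  Cmod q1 <= M1 * U ^ (m - 1) -> Cmod q2 <= M2 * U ^ (m - 2) -> c0 * U ^ m <= Cmod r ^ 4 ->
  Cmod ((5 / 16 * q1 ^ 2 / r ^ 8 - q2 / (4 * r ^ 4)) / (2 * r ^ 2))
    <= (5 / 16 * M1 ^ 2 / c0 ^ 2 + M2 / (4 * c0)) / (2 * sqrt c0) * Rpower U (- (2 + INR m / 2)) /\
  Cmod (q1 / (4 * r ^ 6)) <= M1 / (4 * (c0 * sqrt c0)) * Rpower U (- (1 + INR m / 2)).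
Proof.
  intros Hm HU Hc H1 H2 B1 B2 Br.
  set (p := Rpower U (INR m / 2)). assert (Pp : 0 < p) by apply exp_pos.
  assert (pp : p * p = U ^ m) by (apply Rpower_half_sqr; lra).
  assert (UU : 0 < U ^ m) by (apply pow_lt; lra).
  assert (Sc : 0 < sqrt c0) by now apply sqrt_lt_R0.
  assert (Sc2 : sqrt c0 * sqrt c0 = c0) by (apply sqrt_sqrt; lra).
  assert (Pr := Cmod_ge_0 r).
  assert (r2 : sqrt c0 * p <= Cmod r ^ 2).
  { apply Rsqr_incr_0_var; [|apply pow2_ge_0]. unfold Rsqr.
    replace (sqrt c0 * p * (sqrt c0 * p)) with (sqrt c0 * sqrt c0 * (p * p)) by ring. rewrite Sc2, pp.
    replace (Cmod r ^ 2 * Cmod r ^ 2) with (Cmod r ^ 4) by ring. assumption. }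
  assert (cU : 0 < c0 * U ^ m) by now apply Rmult_lt_0_compat.
  assert (sp : 0 < sqrt c0 * p) by now apply Rmult_lt_0_compat.
  assert (Ui : 0 < / U) by (apply Rinv_0_lt_compat; lra).
  assert (e1 : U ^ (m - 1) = U ^ m * / U).
  { replace m with (S (m - 1)) at 2 by lia. simpl. field. lra. }
  assert (e2 : U ^ (m - 2) = U ^ m * (/ U * / U)).
  { replace m with (S (S (m - 2))) at 2 by lia. simpl. field. lra. }
  assert (R1 : Rpower U (- (1 + INR m / 2)) = / U * / p).
  { rewrite Rpower_Ropp, Rpower_plus, Rpower_1 by lra. fold p. field. lra. }
  assert (R2 : Rpower U (- (2 + INR m / 2)) = / U * / U * / p).
  { rewrite Rpower_Ropp, Rpower_plus. replace 2 with (INR 2) at 1 by reflexivity. rewrite Rpower_pow by lra.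
    fold p. simpl. field. lra. }
  assert (M2c : Cmod (2 * r ^ 2) = 2 * Cmod r ^ 2) by (rewrite Cmod_mult, Cmod_pow, Cmod_RtoC_pos; lra).
  assert (M4c : Cmod (4 * r ^ 4) = 4 * Cmod r ^ 4) by (rewrite Cmod_mult, Cmod_pow, Cmod_RtoC_pos; lra).
  assert (M6c : Cmod (4 * r ^ 6) = 4 * (Cmod r ^ 4 * Cmod r ^ 2)) by (rewrite Cmod_mult, Cmod_pow, Cmod_RtoC_pos; lra).
  assert (M8c : Cmod (r ^ 8) = Cmod r ^ 4 * Cmod r ^ 4) by (rewrite Cmod_pow; ring).
  split.
  - replace (_ * Rpower U _) with (((5 / 16 * (M1 * U ^ (m - 1)) ^ 2 / ((c0 * U ^ m) * (c0 * U ^ m)))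
       + M2 * U ^ (m - 2) / (4 * (c0 * U ^ m))) / (2 * (sqrt c0 * p)))
      by (rewrite R2, e1, e2; field; repeat split; lra).
    apply Cmod_div_le; [|rewrite M2c; lra].
    eapply Rle_trans; [apply Cmod_triangle|]. rewrite Cmod_opp. apply Rplus_le_compat.
    + apply Cmod_div_le.
      * rewrite Cmod_mult, Cmod_pow. replace (5 / 16)%C with (RtoC (5 / 16)) by (rewrite RtoC_div; [reflexivity|lra]).
        rewrite Cmod_RtoC_pos by lra. apply Rmult_le_compat_l; [lra|].
        apply pow_incr. split; [apply Cmod_ge_0|assumption].
      * rewrite M8c. split; [now apply Rmult_lt_0_compat|]. apply Rmult_le_compat; lra.
    + apply Cmod_div_le; [assumption|rewrite M4c; lra].
  - replace (_ * Rpower U _) with (M1 * U ^ (m - 1) / (4 * ((c0 * U ^ m) * (sqrt c0 * p))))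
      by (rewrite R1, e1; field; repeat split; lra).
    apply Cmod_div_le; [assumption|rewrite M6c].
    split; [repeat apply Rmult_lt_0_compat; lra|].
    apply Rmult_le_compat_l; [lra|]. apply Rmult_le_compat; lra.
Qed.

(** * Limits at infinity *)

Definition clim (f : R -> C) (l : C) : Prop :=
  forall eps, 0 < eps -> exists X, forall t, X <= t -> Cmod (f t - l) <= eps.

Lemma clim_eventually f g l X : (forall t, X <= t -> f t = g t) -> clim f l -> clim g l.
Proof.
  intros E H eps He. destruct (H eps He) as [Y HY]. exists (Rmax X Y). intros t Ht.
  assert (A := Rmax_l X Y). assert (B := Rmax_r X Y). rewrite <- E by lra. apply HY; lra.
Qed.

Lemma clim_const c : clim (fun _ => c) c.
Proof. intros eps He. exists 0. intros. replace (c - c)%C with (RtoC 0) by ring. rewrite Cmod_0. lra. Qed.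

Lemma clim_0_domin f (b : R -> R) X :
  (forall t, X <= t -> Cmod (f t) <= b t) -> clim (fun t => RtoC (b t)) 0 -> clim f 0.
Proof.
  intros H Hb eps He. destruct (Hb eps He) as [Y HY]. exists (Rmax X Y). intros t Ht.
  assert (A := Rmax_l X Y). assert (B := Rmax_r X Y).
  replace (f t - 0)%C with (f t) by ring. eapply Rle_trans; [apply H; lra|].
  specialize (HY t ltac:(lra)). replace (RtoC (b t) - 0)%C with (RtoC (b t)) in HY by ring.
  rewrite Cmod_R in HY. generalize (Rle_abs (b t)). lra.
Qed.

Lemma clim_plus f g l l' : clim f l -> clim g l' -> clim (fun t => f t + g t)%C (l + l')%C.
Proof.
  intros H H' eps He. destruct (H (eps / 2)) as [X HX]; [lra|]. destruct (H' (eps / 2)) as [Y HY]; [lra|].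
  exists (Rmax X Y). intros t Ht. assert (A := Rmax_l X Y). assert (B := Rmax_r X Y).
  replace (f t + g t - (l + l'))%C with ((f t - l) + (g t - l'))%C by ring.
  eapply Rle_trans; [apply Cmod_triangle|]. specialize (HX t ltac:(lra)). specialize (HY t ltac:(lra)). lra.
Qed.

Lemma clim_mult_0 f g l : clim f 0 -> clim g l -> clim (fun t => f t * g t)%C 0.
Proof.
  intros H H' eps He. assert (P := Cmod_ge_0 l).
  destruct (H (eps / (Cmod l + 1))) as [X HX]; [apply Rdiv_lt_0_compat; lra|].
  destruct (H' 1) as [Y HY]; [lra|].
  exists (Rmax X Y). intros t Ht. assert (A := Rmax_l X Y). assert (B := Rmax_r X Y).
  specialize (HX t ltac:(lra)). specialize (HY t ltac:(lra)).
  replace (f t - 0)%C with (f t) in HX by ring. replace (f t * g t - 0)%C with (f t * g t)%C by ring.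
  rewrite Cmod_mult. assert (G := Cmod_triangle_sub (g t) l).
  replace eps with (eps / (Cmod l + 1) * (Cmod l + 1)) by (field; lra).
  apply Rmult_le_compat; try apply Cmod_ge_0; lra.
Qed.

Lemma clim_scal (c : C) f l : clim f l -> clim (fun t => c * f t)%C (c * l)%C.
Proof.
  intros H. assert (Z : clim (fun t => f t - l)%C 0).
  { intros eps He. destruct (H eps He) as [X HX]. exists X. intros t Ht.
    replace (f t - l - 0)%C with (f t - l)%C by ring. auto. }
  assert (A := clim_plus _ _ _ _ (clim_mult_0 _ _ _ Z (clim_const c)) (clim_const (c * l)%C)).
  rewrite Cplus_0_l in A. revert A. apply (clim_eventually _ _ _ 0). intros; ring.
Qed.

Lemma clim_minus f g l l' : clim f l -> clim g l' -> clim (fun t => f t - g t)%C (l - l')%C.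
Proof.
  intros H H'. apply (clim_eventually (fun t => f t + (- (1)) * g t)%C _ _ 0); [intros; ring|].
  replace (l - l')%C with (l + (- (1)) * l')%C by ring. now apply clim_plus, clim_scal.
Qed.

Lemma clim_shift f l : clim f l -> clim (fun t => f t - l)%C 0.
Proof. intros H. replace (RtoC 0) with (l - l)%C by ring. now apply clim_minus, clim_const. Qed.

Lemma clim_mult f g l l' : clim f l -> clim g l' -> clim (fun t => f t * g t)%C (l * l')%C.
Proof.
  intros H H'.
  assert (A := clim_plus _ _ _ _ (clim_mult_0 _ _ _ (clim_shift _ _ H) H') (clim_scal l _ _ H')).
  rewrite Cplus_0_l in A. revert A. apply (clim_eventually _ _ _ 0). intros; ring.
Qed.

Lemma clim_inv_1 f : clim f 1 -> clim (fun t => / f t)%C 1.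
Proof.
  intros H eps He. destruct (H (Rmin (/ 2) (eps / 2))) as [X HX]; [apply Rmin_glb_lt; lra|].
  exists X. intros t Ht. specialize (HX t Ht).
  assert (A := Rmin_l (/ 2) (eps / 2)). assert (B := Rmin_r (/ 2) (eps / 2)).
  assert (L : / 2 <= Cmod (f t)).
  { assert (T := Cmod_triangle_sub 1 (f t)). rewrite Cmod_1 in T.
    replace (1 - f t)%C with (- (f t - 1))%C in T by ring. rewrite Cmod_opp in T. lra. }
  assert (N : f t <> 0) by (apply Cmod_gt_0; lra).
  replace (/ f t - 1)%C with (- (f t - 1) / f t)%C by (field; assumption).
  replace eps with ((eps / 2) / (/ 2)) by (field; lra).
  apply Cmod_div_le; [rewrite Cmod_opp|]; lra.
Qed.

(** Along the segment from 0 to [z] the derivative is at most [exp 1 |z| <= 3 |z|]; the bound on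
    differences doubles this. *)
Lemma cexp_near_1 (z : C) : Cmod z <= 1 -> Cmod (cexp z - 1) <= 6 * Cmod z.
Proof.
  intros Hz. set (p := fun t => cexp (RtoC t * z)).
  replace (cexp z - 1)%C with (p 1 - p 0)%C.
  - replace (6 * Cmod z) with (2 * ((3 * Cmod z) * (1 - 0))) by ring.
    apply (Cmod_diff_bound p (fun t => cexp (RtoC t * z) * z)%C (fun t => t) (fun _ => 1)); [lra|].
    intros t Ht. split; [|split].
    + apply cder_cexp. eapply cder_eq.
      * apply (cder_mult (fun t => RtoC t) (fun _ => z) t (RtoC 1)); [|apply cder_const].
        apply cder_RtoC, (is_derive_id (K:=R_AbsRing)).
      * ring.
    + apply (is_derive_id (K:=R_AbsRing)).
    + rewrite Cmod_mult, Cmod_cexp. rewrite Rmult_1_r. apply Rmult_le_compat_r; [apply Cmod_ge_0|].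
      apply exp_1_le_3. eapply Rle_trans; [apply Re_le_Cmod|]. rewrite Cmod_mult, Cmod_RtoC_pos by lra.
      assert (P := Cmod_ge_0 z). nra.
  - unfold p. rewrite Cmult_0_l, cexp_0, Cmult_1_l. reflexivity.
Qed.

Lemma clim_cexp f l : clim f l -> clim (fun t => cexp (f t)) (cexp l).
Proof.
  intros H.
  assert (A : clim (fun t => cexp (f t - l)) 1).
  { intros eps He. destruct (clim_shift _ _ H (Rmin 1 (eps / 6))) as [X HX]; [apply Rmin_glb_lt; lra|].
    exists X. intros t Ht. specialize (HX t Ht). replace (f t - l - 0)%C with (f t - l)%C in HX by ring.
    assert (B := Rmin_l 1 (eps / 6)). assert (B' := Rmin_r 1 (eps / 6)).
    eapply Rle_trans; [apply cexp_near_1; lra|]. lra. }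
  assert (B := clim_scal (cexp l) _ _ A). rewrite Cmult_1_r in B. revert B.
  apply (clim_eventually _ _ _ 0). intros t _. rewrite <- cexp_plus. f_equal. ring.
Qed.

Lemma clim_Rpower_neg p : p < 0 -> clim (fun t => RtoC (Rpower t p)) 0.
Proof.
  intros Hp eps He. exists (Rpower eps (/ p)). intros t Ht.
  assert (P : 0 < Rpower eps (/ p)) by apply exp_pos.
  replace (RtoC (Rpower t p) - 0)%C with (RtoC (Rpower t p)) by ring.
  rewrite Cmod_RtoC_pos by (left; apply exp_pos).
  replace eps with (Rpower (Rpower eps (/ p)) p) by (rewrite Rpower_mult, Rinv_l, Rpower_1; lra).
  replace p with (- (- p)) by ring. rewrite !(Rpower_Ropp _ (- p)).
  apply Rinv_le_contravar; [apply exp_pos|]. apply Rle_Rpower_l; [lra|].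
  rewrite Ropp_involutive. lra.
Qed.

(** A relative error [O(t^(-1/2))] does not change a limit. This is the only use made of the error
    terms in Sibuya's asymptotics, so their constants leave no trace. *)
Lemma clim_relative f g l K X :
  (forall t, X <= t -> Cmod (f t - g t) <= K * Rpower t (- / 2) * Cmod (g t)) -> clim g l -> clim f l.
Proof.
  intros H Hg.
  assert (A : clim (fun t => f t - g t)%C 0).
  { apply (clim_0_domin _ (fun t => K * Rpower t (- / 2) * Cmod (g t)) X H).
    assert (N : clim (fun t => RtoC (Cmod (g t))) (RtoC (Cmod l))).
    { intros eps He. destruct (Hg eps He) as [Y HY]. exists Y. intros t Ht. eapply Rle_trans; [|apply HY, Ht].
      rewrite <- RtoC_minus, Cmod_R. apply Rabs_le.
      assert (T1 := Cmod_triangle_sub (g t) l). assert (T2 := Cmod_triangle_sub l (g t)).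
      replace (l - g t)%C with (- (g t - l))%C in T2 by ring. rewrite Cmod_opp in T2. lra. }
    assert (B := clim_mult_0 _ _ _ (clim_Rpower_neg (- / 2) ltac:(lra)) (clim_scal (RtoC K) _ _ N)).
    revert B. apply (clim_eventually _ _ _ 0). intros t _. rewrite !RtoC_mult. ring. }
  assert (B := clim_plus _ _ _ _ A Hg). rewrite Cplus_0_l in B. revert B.
  apply (clim_eventually _ _ _ 0). intros; ring.
Qed.

Lemma clim_ln_ratio : clim (fun t => RtoC (ln (t + 1) - ln t)) 0.
Proof.
  apply (clim_0_domin _ (fun t => Rpower t (- (1))) 1); [|apply clim_Rpower_neg; lra].
  intros t Ht. rewrite Rpower_Ropp, Rpower_1 by lra.
  assert (ln t < ln (t + 1)) by (apply ln_increasing; lra).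
  rewrite Cmod_RtoC_pos by lra.
  rewrite <- ln_div by lra. rewrite <- (ln_exp (/ t)).
  apply Rcomplements.ln_le; [apply Rdiv_lt_0_compat; lra|].
  replace ((t + 1) / t) with (1 + / t) by (field; lra). apply exp_ineq1_le.
Qed.

Lemma clim_sqrt_1 (s : R -> C) X : (forall t, X <= t -> 0 <= Re (s t)) -> clim (fun t => s t * s t)%C 1 -> clim s 1.
Proof.
  intros Hs H eps He. destruct (H eps He) as [Y HY]. exists (Rmax X Y). intros t Ht.
  assert (A := Rmax_l X Y). assert (B := Rmax_r X Y).
  assert (D := sqrt_diff_le (s t) 1 (Hs t ltac:(lra)) ltac:(simpl; lra)).
  rewrite Cmult_1_l in D. simpl in D. specialize (HY t ltac:(lra)). lra.
Qed.

Lemma bigO_clim f n l : (1 <= n)%nat -> bigO (fun x => f x - l)%C n -> clim f l.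
Proof.
  intros Hn H eps He. destruct (bigO_small _ n eps Hn H He) as [X [_ HX]]. now exists X.
Qed.

Lemma clog_RtoC t : 0 < t -> clog (RtoC t) = RtoC (ln t).
Proof.
  intros Ht. unfold clog, Clog, Carg. simpl. change (Cnorm (RtoC t)) with (Cmod (RtoC t)).
  destruct (Rlt_dec 0 t); [|lra]. replace (0 / t) with 0 by (field; lra).
  rewrite atan_0, Cmod_RtoC_pos by lra. reflexivity.
Qed.

Lemma cexp_RtoC x : cexp (RtoC x) = RtoC (exp x).
Proof. apply injective_projections; unfold cexp, Cexp; simpl; rewrite ?cos_0, ?sin_0; ring. Qed.

(** * Limits of the WKB coordinates at infinity *)

Section Limits.
Variables (m : nat) (a : nat -> Cx) (lam v : C) (y y1 : R -> C).
Hypothesis Hm : (3 <= m)%nat.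
Let Q := Qfun m a lam.
Hypothesis slit : forall x, 0 <= x -> 0 < Cmod (Q x) + Re (Q x).
Let xi := wkb_xi Q.
Let r := wkb_r Q.
Hypothesis Lim : clim (Lprim m a xi) v.
Let M (e : R) t := cexp ((RtoC e - nuc m a) * RtoC (ln t) - Freal m a t).
Variables K X : R.
Hypothesis y_asym : forall t, X <= t ->
  Cmod (y t - M (- (INR m / 4)) t) <= K * Rpower t (- / 2) * Cmod (M (- (INR m / 4)) t).
Hypothesis y1_asym : forall t, X <= t ->
  Cmod (y1 t + M (INR m / 4) t) <= K * Rpower t (- / 2) * Cmod (M (INR m / 4) t).
Hypothesis q_small : clim (fun t => Q1fun m a t / (4 * r t ^ 6))%C 0.

Let sigma t := (RtoC (Rpower t (- (INR m / 4))) * r t)%C.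
Let Z t := cexp (Lprim m a xi t + nuc m a * RtoC (ln (t + 1) - ln t)).

(** The fourth power of [sigma] is [Q / t^m], which tends to 1. The roots are removed one at a time
    with [clim_sqrt_1], real parts being positive at each stage. *)
Lemma sigma_lim : clim sigma 1.
Proof.
  assert (Sp : forall t, 0 <= t -> 0 < Re (r t)) by (intros; now apply wkb_r_pos).
  assert (SS : forall t, 0 <= t -> 0 < Re (wkb_S Q t)) by (intros; now apply wkb_S_pos).
  assert (scal_pos : forall p (z : C), 0 < p -> 0 < Re z -> 0 <= Re (RtoC p * z)%C).
  { intros p z Hp Hz. simpl. unfold Re in Hz. nra. }
  apply (clim_sqrt_1 _ 0); [intros t Ht; apply scal_pos; [apply exp_pos|auto]|].
  apply (clim_eventually (fun t => RtoC (Rpower t (- (INR m / 2))) * wkb_S Q t)%C _ _ 1).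
  { intros t Ht. unfold sigma, r. rewrite <- wkb_r_sqr by (try assumption; lra).
    replace (- (INR m / 2)) with (- (INR m / 4) + - (INR m / 4)) by field.
    rewrite Rpower_plus, RtoC_mult. ring. }
  apply (clim_sqrt_1 _ 0); [intros t Ht; apply scal_pos; [apply exp_pos|auto]|].
  apply (clim_eventually (fun t => 1 + (peval m a (RtoC t) * RtoC (/ t) ^ m + lam * RtoC (/ t) ^ m))%C _ _ 1).
  { intros t Ht.
    replace (RtoC (Rpower t (- (INR m / 2))) * wkb_S Q t * (RtoC (Rpower t (- (INR m / 2))) * wkb_S Q t))%C
      with (RtoC (Rpower t (- (INR m / 2)) * Rpower t (- (INR m / 2))) * (wkb_S Q t * wkb_S Q t))%C
      by (rewrite RtoC_mult; ring).
    rewrite wkb_S_sqr by (try assumption; lra).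
    rewrite Rpower_Ropp, <- Rinv_mult, Rpower_half_sqr, <- pow_inv, RtoC_pow by lra.
    unfold Q, Qfun.
    replace (RtoC (/ t) ^ m * (RtoC t ^ m + peval m a (RtoC t) + lam))%C with
      (RtoC t ^ m * RtoC (/ t) ^ m + (peval m a (RtoC t) + lam) * RtoC (/ t) ^ m)%C by ring.
    rewrite <- Cpow_mult_l, RtoC_inv_l, Cpow_1_l by lra. ring. }
  apply (bigO_clim _ 1); [lia|].
  apply (bigO_ext (fun t => peval m a (RtoC t) * RtoC (/ t) ^ m + lam * RtoC (/ t) ^ m)%C); [intros; ring|].
  apply bigO_plus; [apply (bigO_rescaled m a); lia|].
  apply bigO_scal, (bigO_weaken _ m); [lia|]. apply bigO_inv_pow.
Qed.

Lemma Z_lim : clim Z (cexp v).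
Proof.
  apply clim_cexp. replace v with (v + nuc m a * 0)%C by ring.
  apply clim_plus; [exact Lim|]. apply clim_scal, clim_ln_ratio.
Qed.

(** The factor [t^(-nu)] of the main term meets [nu ln (t + 1)] from the regularised integral; the
    discrepancy [nu (ln (t + 1) - ln t)] is kept in [Z] and tends to 0. *)
Let M_E e t : 0 < t -> (M e t * wkb_E Q t = Z t * RtoC (Rpower t e))%C.
Proof.
  intros Ht. unfold M, wkb_E, Z, Rpower. rewrite <- cexp_RtoC, <- !cexp_plus. f_equal.
  fold xi. unfold Lprim. rewrite RtoC_minus, RtoC_mult. ring.
Qed.

Lemma wkb_h_lim : clim (wkb_h y Q) (cexp v).
Proof.
  apply (clim_relative _ (fun t => Z t * sigma t)%C _ K (Rmax X 1)).
  - intros t Ht. assert (A := Rmax_l X 1). assert (B := Rmax_r X 1).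
    replace (Z t * sigma t)%C with (M (- (INR m / 4)) t * (r t * wkb_E Q t))%C
      by (unfold sigma; replace (M (- (INR m / 4)) t * (r t * wkb_E Q t))%C with
          (r t * (M (- (INR m / 4)) t * wkb_E Q t))%C by ring; rewrite M_E by lra; ring).
    unfold wkb_h. fold (r t).
    replace (y t * r t * wkb_E Q t - M (- (INR m / 4)) t * (r t * wkb_E Q t))%C with
      ((y t - M (- (INR m / 4)) t) * (r t * wkb_E Q t))%C by ring.
    rewrite (Cmod_mult _ (r t * wkb_E Q t)), (Cmod_mult (M _ t)), <- Rmult_assoc.
    apply Rmult_le_compat_r; [apply Cmod_ge_0|]. apply y_asym; lra.
  - rewrite <- (Cmult_1_r (cexp v)). apply clim_mult; [apply Z_lim|apply sigma_lim].
Qed.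

Lemma wkb_y1_lim : clim (fun t => wkb_E Q t * (y1 t * / r t))%C (- cexp v)%C.
Proof.
  apply (clim_relative _ (fun t => - (Z t * / sigma t))%C _ K (Rmax X 1)).
  - intros t Ht. assert (A := Rmax_l X 1). assert (B := Rmax_r X 1).
    assert (rn : r t <> 0) by (apply wkb_r_neq0; [assumption|lra]).
    assert (pn : RtoC (Rpower t (- (INR m / 4))) <> 0) by (apply RtoC_neq0, Rgt_not_eq, exp_pos).
    replace (Z t * / sigma t)%C with (M (INR m / 4) t * (/ r t * wkb_E Q t))%C.
    + replace (wkb_E Q t * (y1 t * / r t) - - (M (INR m / 4) t * (/ r t * wkb_E Q t)))%C with
        ((y1 t + M (INR m / 4) t) * (/ r t * wkb_E Q t))%C by ring.
      rewrite Cmod_opp, (Cmod_mult _ (/ r t * wkb_E Q t)), (Cmod_mult (M _ t)), <- Rmult_assoc.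
      apply Rmult_le_compat_r; [apply Cmod_ge_0|]. apply y1_asym; lra.
    + replace (M (INR m / 4) t * (/ r t * wkb_E Q t))%C with
        (/ r t * (M (INR m / 4) t * wkb_E Q t))%C by ring. rewrite M_E by lra.
      assert (E1 : (RtoC (Rpower t (INR m / 4)) * RtoC (Rpower t (- (INR m / 4))) = 1)%C).
      { rewrite <- RtoC_mult, <- Rpower_plus, Rplus_opp_r, Rpower_O by lra. reflexivity. }
      unfold sigma.
      replace (RtoC (Rpower t (INR m / 4))) with
        (RtoC (Rpower t (INR m / 4)) * RtoC (Rpower t (- (INR m / 4))) / RtoC (Rpower t (- (INR m / 4))))%C
        by (field; assumption).
      rewrite E1. field. split; assumption.
  - replace (- cexp v)%C with (- (1) * (cexp v * 1))%C by ring.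
    apply (clim_eventually (fun t => - (1) * (Z t * / sigma t))%C _ _ 0); [intros; ring|].
    apply clim_scal, clim_mult; [apply Z_lim|apply clim_inv_1, sigma_lim].
Qed.

(** [k] splits as [E y1 / r + (Q' / (4 r^6)) h + h], with limits [-exp v], 0 and [exp v]. The
    opposite signs in the asymptotics of [f] and [f'] are what makes [k] vanish. *)
Lemma wkb_k_lim : clim (wkb_k y y1 Q (Q1fun m a)) 0.
Proof.
  assert (A := clim_plus _ _ _ _ (clim_plus _ _ _ _ wkb_y1_lim (clim_mult_0 _ _ _ q_small wkb_h_lim)) wkb_h_lim).
  replace (- cexp v + 0 + cexp v)%C with (RtoC 0) in A by ring. revert A.
  apply (clim_eventually _ _ _ 0). intros t Ht. unfold wkb_k, wkb_h. fold (r t).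
  assert (rn : r t <> 0) by (now apply wkb_r_neq0). field. assumption.
Qed.

Lemma wkb_H_lim : clim (wkb_H y y1 Q (Q1fun m a)) (cexp v).
Proof.
  assert (A := clim_plus _ _ _ _ wkb_h_lim (clim_scal (- / 2)%C _ _ wkb_k_lim)).
  replace (cexp v + - / 2 * 0)%C with (cexp v) in A by ring. revert A.
  apply (clim_eventually _ _ _ 0). intros t _. unfold wkb_H. ring.
Qed.
End Limits.

(** * Boundary values *)

Lemma Cderiv_cder (g : C -> C) (x : R) (l : C) :
  Cderiv g (RtoC x) l -> cder (fun t => g (RtoC t)) x l.
Proof.
  intros H.
  assert (D : forall eps, 0 < eps -> exists d : posreal, forall h, h <> 0 -> Rabs h < d ->
     Cmod ((g (RtoC (x + h)) - g (RtoC x)) * RtoC (/ h) - l) < eps).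
  { intros eps He. destruct (H eps He) as [d [Hd Hh]]. exists (mkposreal d Hd). simpl. intros h Hn Hl.
    assert (A : Cmod ((g (RtoC x + RtoC h) - g (RtoC x)) / RtoC h - l)%C < eps).
    { apply (Hh (RtoC h)); [now apply RtoC_neq0|]. change (Cmod (RtoC h) < d). now rewrite Cmod_R. }
    rewrite <- RtoC_plus in A. rewrite RtoC_inv by assumption. exact A. }
  split; apply is_derive_Reals; intros eps He; destruct (D eps He) as [d Hd]; exists d; intros h Hn Hl;
    (eapply Rle_lt_trans; [|apply (Hd h Hn Hl)]).
  - eapply Rle_trans; [|apply re_le_Cmod]. right. f_equal. unfold Re; simpl. field. assumption.
  - eapply Rle_trans; [|apply Im_abs_le_Cmod]. right. f_equal. unfold Im; simpl. field. assumption.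
Qed.

Lemma Sibuya_real_axis m f f1 a lam : is_Sibuya_solution m f f1 ->
  (forall t, cder (fun t => f (RtoC t) a lam) t (f1 (RtoC t) a lam)) /\
  (forall t, cder (fun t => f1 (RtoC t) a lam) t (Qfun m a lam t * f (RtoC t) a lam)%C) /\
  exists K X, forall t, X <= t ->
    let M (e : R) := cexp ((RtoC e - nuc m a) * RtoC (ln t) - Freal m a t) in
    Cmod (f (RtoC t) a lam - M (- (INR m / 4))) <= K * Rpower t (- / 2) * Cmod (M (- (INR m / 4))) /\
    Cmod (f1 (RtoC t) a lam + M (INR m / 4)) <= K * Rpower t (- / 2) * Cmod (M (INR m / 4)).
Proof.
  intros H. destruct (H a lam) as [D As].
  assert (P := pos_INR m). assert (Pi := PI_RGT_0).
  split; [|split].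
  - intros t. apply (Cderiv_cder (fun z => f z a lam)). apply D.
  - intros t. apply (Cderiv_cder (fun z => f1 z a lam)).
    unfold Qfun. rewrite <- Cpown_pow. exact (proj2 (D (RtoC t))).
  (* This choice of [eps] shrinks the sector to [|arg z| <= 0], which still contains the positive
     real axis. *)
  - destruct (As (3 * PI / (INR m + 2))) as [K [R0 HK]]; [apply Rdiv_lt_0_compat; lra|].
    exists K, (Rmax R0 1). intros t Ht. assert (A := Rmax_l R0 1). assert (B := Rmax_r R0 1).
    assert (N : Cmod (RtoC t) = t) by (apply Cmod_RtoC_pos; lra).
    assert (Z : RtoC t <> 0) by (apply RtoC_neq0; lra).
    specialize (HK (RtoC t)). change (Cnorm (RtoC t)) with (Cmod (RtoC t)) in HK. rewrite N in HK.
    assert (E : forall w e, w = (RtoC e - nuc m a)%C ->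
       Cmul (Defs.Cpow (RtoC t) w) (Cexp (Defs.Copp (Ffun m a (RtoC t)))) =
       cexp ((RtoC e - nuc m a) * RtoC (ln t) - Freal m a t)).
    { intros w e Hw. rewrite Ffun_Freal by lra.
      change (cpow (RtoC t) w * cexp (- Freal m a t) = cexp ((RtoC e - nuc m a) * RtoC (ln t) - Freal m a t))%C.
      rewrite cpow_cexp, clog_RtoC, Hw, <- cexp_plus by (assumption || lra). f_equal. }
    assert (Em : Csub (mu m a) (Defs.RtoC (INR m / 2)) = (RtoC (- (INR m / 4)) - nuc m a)%C).
    { change (RtoC (INR m / 4) - nuc m a - RtoC (INR m / 2) = RtoC (- (INR m / 4)) - nuc m a)%C.
      replace (INR m / 2) with (INR m / 4 + INR m / 4) by field. rewrite RtoC_plus, RtoC_opp. ring. }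
    rewrite (E _ _ Em) in HK.
    rewrite (E (mu m a) (INR m / 4) eq_refl) in HK.
    apply HK; [|lra]. unfold Carg; simpl. destruct (Rlt_dec 0 t); [|lra].
    replace (0 / t) with 0 by (field; lra). rewrite atan_0, Rabs_R0. lra.
Qed.

(** [V] is the explicit primitive of the majorant of [|e|]. With [n = m/2] and [T = |lam|^(1/m)] its
    total increase is of order [T^(-(1 + m/2)) = |lam|^(-rho)], the origin of the exponent [rho]. *)
Lemma energy_majorant n A T : 0 <= n -> 0 <= A -> 1 <= T ->
  let V x := - (A / (1 + n)) * Rpower (x + T) (- (1 + n)) in
  (forall x, 0 <= x -> is_derive V x (A * Rpower (x + T) (- (2 + n)))) /\
  (forall s t, 0 <= s -> s <= t -> V t - V s <= A * Rpower T (- (1 + n))).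
Proof.
  intros Hn HA HT V. split.
  - intros x Hx. eapply is_derive_eq.
    + apply (is_derive_scal (fun x => Rpower (x + T) (- (1 + n)))).
      apply (is_derive_comp (fun u => Rpower u (- (1 + n))) (fun x => x + T)).
      * apply is_derive_Rpower. lra.
      * apply (is_derive_plus (fun t : R => t) (fun _ => T)); [apply (is_derive_id (K:=R_AbsRing))|apply (is_derive_const (K := R_AbsRing) (V := R_NormedModule))].
    + replace (- (1 + n) - 1) with (- (2 + n)) by ring.
      unfold scal, plus, one, zero; simpl; unfold mult; simpl. field. lra.
  - intros s t Hs Ht. unfold V.
    assert (P1 : 0 < Rpower (t + T) (- (1 + n))) by apply exp_pos.
    assert (P2 : Rpower (s + T) (- (1 + n)) <= Rpower T (- (1 + n))).
    { rewrite !Rpower_Ropp. apply Rinv_le_contravar; [apply exp_pos|]. apply Rle_Rpower_l; lra. }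
    assert (P3 : 0 < Rpower (s + T) (- (1 + n))) by apply exp_pos.
    assert (Q0 : 0 <= A / (1 + n)) by (apply Rmult_le_pos; [assumption|left; apply Rinv_0_lt_compat; lra]).
    assert (Q1 : A / (1 + n) <= A).
    { apply Rmult_le_reg_r with (1 + n); [lra|]. field_simplify; [|lra]. nra. }
    assert (0 <= A / (1 + n) * Rpower (t + T) (- (1 + n))) by (apply Rmult_le_pos; lra).
    assert (A / (1 + n) * Rpower (s + T) (- (1 + n)) <= A * Rpower T (- (1 + n)))
      by (apply Rmult_le_compat; lra).
    lra.
Qed.

(* The boundary values of the solution at 0, before the fourth root of Q(0) is traded for
   that of lam. *)
Lemma wkb_at_0 m a lam T A E (y y1 : R -> C) (K X : R) :
  (3 <= m)%nat -> 0 <= A -> 1 <= T ->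
  (forall x, 0 <= x -> 0 < Cmod (Qfun m a lam x) + Re (Qfun m a lam x)) ->
  (forall x, 0 <= x -> cder y x (y1 x)) ->
  (forall x, 0 <= x -> cder y1 x (Qfun m a lam x * y x)%C) ->
  (forall t, X <= t ->
    let M (e : R) := cexp ((RtoC e - nuc m a) * RtoC (ln t) - Freal m a t) in
    Cmod (y t - M (- (INR m / 4))) <= K * Rpower t (- / 2) * Cmod (M (- (INR m / 4))) /\
    Cmod (y1 t + M (INR m / 4)) <= K * Rpower t (- / 2) * Cmod (M (INR m / 4))) ->
  (forall x, 0 <= x ->
     Cmod (wkb_e (Qfun m a lam) (Q1fun m a) (Q2fun m a) x) <= A * Rpower (x + T) (- (2 + INR m / 2)) /\
     Cmod (Q1fun m a x / (4 * wkb_r (Qfun m a lam) x ^ 6)) <= A * Rpower (x + T) (- (1 + INR m / 2))) ->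
  E = A * Rpower T (- (1 + INR m / 2)) -> E <= / 4 ->
  exists v : C, is_L m a lam v /\ exists h k q r : C,
    (r * r = csqrt (Qfun m a lam 0))%C /\ 0 < Re r /\
    y 0 = (h / r)%C /\ y1 0 = (r * (k - h - h * q))%C /\
    Cmod (h - cexp v) <= 12 * Cmod (cexp v) * E /\ Cmod k <= 8 * Cmod (cexp v) * E /\ Cmod q <= E.
Proof.
  intros Hm HA HT slit dy dy1 asym bounds HE E4.
  set (Q := Qfun m a lam) in *. set (Q1 := Q1fun m a) in *. set (Q2 := Q2fun m a) in *.
  assert (P := pos_INR m).
  assert (dQ : forall t, 0 <= t -> cder Q t (Q1 t)) by (intros; apply cder_Qfun).
  assert (dQ1 : forall t, 0 <= t -> cder Q1 t (Q2 t)) by (intros; apply cder_Q1fun).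
  assert (dS : forall x, 0 <= x -> exists l, cder (wkb_S Q) x l).
  { intros x Hx. eexists. apply (cder_wkb_S Q Q1); assumption. }
  assert (dxi : forall x, 0 <= x -> cder (wkb_xi Q) x (wkb_S Q x)).
  { intros x Hx. apply (cder_wkb_xi Q Q1); assumption. }
  assert (Sdef : forall x, wkb_S Q x = csqrt (Qfun m a lam x)) by reflexivity.
  destruct (Lprim_converges m a lam (wkb_S Q) (wkb_xi Q) Hm slit Sdef dxi) as [v Hv].
  exists v. split.
  { apply (is_L_of_limit m a lam (wkb_S Q) (wkb_xi Q)); try assumption. apply wkb_xi_0. }
  assert (qlim : clim (fun t => Q1 t / (4 * wkb_r Q t ^ 6))%C 0).
  { apply (clim_0_domin _ (fun t => A * Rpower t (- (1 + INR m / 2))) 1).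
    - intros t Ht. destruct (bounds t) as [_ B]; [lra|]. eapply Rle_trans; [exact B|].
      apply Rmult_le_compat_l; [assumption|]. rewrite !Rpower_Ropp.
      apply Rinv_le_contravar; [apply exp_pos|]. apply Rle_Rpower_l; lra.
    - assert (B := clim_scal (RtoC A) _ _ (clim_Rpower_neg (- (1 + INR m / 2)) ltac:(lra))).
      rewrite Cmult_0_r in B. revert B. apply (clim_eventually _ _ _ 0). intros t _. now rewrite RtoC_mult. }
  assert (y_as := fun t Ht => proj1 (asym t Ht)). assert (y1_as := fun t Ht => proj2 (asym t Ht)).
  assert (klim := wkb_k_lim m a lam v y y1 Hm slit Hv K X y_as y1_as qlim).
  assert (Hlim := wkb_H_lim m a lam v y y1 Hm slit Hv K X y_as y1_as qlim).
  fold Q Q1 in klim, Hlim.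
  destruct (energy_majorant (INR m / 2) A T ltac:(lra) HA HT) as [dV VE]. rewrite <- HE in VE.
  set (V := fun x => - (A / (1 + INR m / 2)) * Rpower (x + T) (- (1 + INR m / 2))) in *.
  set (w := fun x => A * Rpower (x + T) (- (2 + INR m / 2))).
  set (H := wkb_H y y1 Q Q1) in *. set (k := wkb_k y y1 Q Q1) in *. set (e := wkb_e Q Q1 Q2) in *.
  assert (dH : forall t, 0 <= t -> cder H t (e t * (H t + k t / 2))%C)
    by (intros; apply cder_wkb_H; assumption).
  assert (dk : forall t, 0 <= t -> cder k t (2 * wkb_S Q t * k t - 2 * (e t * (H t + k t / 2)))%C)
    by (intros; apply cder_wkb_k; assumption).
  assert (Sp : forall t, 0 <= t -> 0 <= Re (wkb_S Q t)) by (intros; left; apply wkb_S_pos; assumption).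
  assert (ew : forall t, 0 <= t -> Cmod (e t) <= w t) by (intros t Ht; apply (bounds t Ht)).
  assert (lim : forall eps, 0 < eps -> exists X, 0 <= X /\
    forall t, X <= t -> Cmod (H t - cexp v) <= eps /\ Cmod (k t) <= eps).
  { intros eps He. destruct (Hlim eps He) as [X1 H1]. destruct (klim eps He) as [X2 H2].
    exists (Rmax 0 (Rmax X1 X2)). split; [apply Rmax_l|]. intros t Ht.
    assert (B := Rmax_r 0 (Rmax X1 X2)). assert (B1 := Rmax_l X1 X2). assert (B2 := Rmax_r X1 X2).
    split; [apply H1; lra|]. specialize (H2 t ltac:(lra)). replace (k t - 0)%C with (k t) in H2 by ring. exact H2. }
  assert (RH := energy_H H k (wkb_S Q) e V w (cexp v) E dH dk dV Sp ew VE E4 (cexp_neq0 v) lim).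
  assert (Rk := energy_k H k (wkb_S Q) e V w (cexp v) E dH dk dV Sp ew VE E4 (cexp_neq0 v) lim).
  assert (rn : wkb_r Q 0 <> 0) by (apply wkb_r_neq0; [assumption|lra]).
  assert (E0 : wkb_E Q 0 = 1) by (unfold wkb_E; rewrite wkb_xi_0; apply cexp_0).
  exists (wkb_h y Q 0), (k 0), (Q1 0 / (4 * wkb_r Q 0 ^ 6))%C, (wkb_r Q 0).
  split; [|split; [|split; [|split; [|split; [|split]]]]].
  - apply wkb_r_sqr; [assumption|lra].
  - apply wkb_r_pos; [assumption|lra].
  - unfold wkb_h. rewrite E0. field. assumption.
  - unfold k, wkb_k, wkb_h. rewrite E0. field. assumption.
  (* Since [h = H + k/2], the constants add up as [12 = 8 + 8/2]. *)
  - replace (wkb_h y Q 0 - cexp v)%C with ((H 0 - cexp v) + RtoC (/ 2) * k 0)%C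
      by (rewrite RtoC_inv by lra; unfold H, wkb_H; fold k; ring).
    eapply Rle_trans; [apply Cmod_triangle|]. rewrite Cmod_mult, Cmod_RtoC_pos by lra. lra.
  - exact Rk.
  - rewrite HE. replace T with (0 + T) by ring. apply (bounds 0). lra.
Qed.

(** [sqrt_diff_le] is applied twice, first to the square roots and then to the fourth roots. With
    [l^4 = lam] and [p = P(0)], the relative error is [2 M0 / (c |lam|)]. *)
Lemma fourth_root_perturb (S0 r l p : C) (c M0 : R) :
  0 < c -> (r * r = S0)%C -> 0 < Re r -> 0 <= Re S0 -> (S0 * S0 = l * l * (l * l) + p)%C ->
  Cmod p <= M0 -> c * Cmod l ^ 2 <= Re (l * l) -> Cmod l <= 2 * Re l -> l <> 0 ->
  Cmod (r - l) <= 2 * M0 / c / Cmod l ^ 4 * Cmod l.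
Proof.
  intros Hc Hr Rr RS HS Hp Hl2 Hl Hz.
  assert (L : 0 < Cmod l) by now apply Cmod_gt_0.
  assert (L2 : 0 < Cmod l ^ 2) by now apply pow_lt.
  assert (D1 := sqrt_diff_le S0 (l * l) RS ltac:(nra)).
  replace (S0 * S0 - l * l * (l * l))%C with p in D1 by (rewrite HS; ring).
  assert (D2 := sqrt_diff_le r l ltac:(lra) ltac:(lra)). rewrite Hr in D2.
  assert (N := Cmod_ge_0 (S0 - l * l)). assert (N' := Cmod_ge_0 (r - l)).
  assert (B1 : Cmod (S0 - l * l) <= M0 / (c * Cmod l ^ 2)).
  { apply Rmult_le_reg_r with (c * Cmod l ^ 2); [now apply Rmult_lt_0_compat|].
    replace (M0 / (c * Cmod l ^ 2) * (c * Cmod l ^ 2)) with M0 by (field; lra).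
    apply Rle_trans with (Cmod (S0 - l * l) * Re (l * l)); [now apply Rmult_le_compat_l|lra]. }
  apply Rmult_le_reg_r with (Cmod l / 2); [lra|].
  replace (2 * M0 / c / Cmod l ^ 4 * Cmod l * (Cmod l / 2)) with (M0 / (c * Cmod l ^ 2)) by (field; lra).
  apply Rle_trans with (Cmod (r - l) * Re l); [apply Rmult_le_compat_l; lra|lra].
Qed.

(** As [eta <= 1/2], [|r|] lies between [|l|/2] and [3/2 |l|]. The value then has relative error
    [24 E + 2 eta]; the derivative has [3/2 (8 + 12 + 4) E + eta], where [|h| <= 4 |c|] accounts for
    the last 4. The common bound covers both. *)
Lemma boundary_values (h k q r l c : C) (E eta : R) :
  r <> 0 -> l <> 0 -> 0 <= E <= / 4 -> 0 <= eta <= / 2 ->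
  Cmod (r - l) <= eta * Cmod l ->
  Cmod (h - c) <= 12 * Cmod c * E -> Cmod k <= 8 * Cmod c * E -> Cmod q <= E ->
  Cmod (h / r - / l * c) <= (48 * E + 2 * eta) * Cmod (/ l * c) /\
  Cmod (r * (k - h - h * q) + l * c) <= (48 * E + 2 * eta) * Cmod (l * c).
Proof.
  intros Hr Hl HE Heta Hrl Hh Hk Hq.
  assert (L : 0 < Cmod l) by now apply Cmod_gt_0.
  assert (P := Cmod_ge_0 c).
  assert (T1 := Cmod_triangle_sub l r). assert (T2 := Cmod_triangle_sub r l).
  replace (l - r)%C with (- (r - l))%C in T1 by ring. rewrite Cmod_opp in T1.
  assert (r_lo : Cmod l / 2 <= Cmod r) by nra.
  assert (r_hi : Cmod r <= 3 / 2 * Cmod l) by nra.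
  split.
  - replace (h / r - / l * c)%C with ((h - c) / r + c * (- (r - l) / (r * l)))%C by (field; now split).
    eapply Rle_trans; [apply Cmod_triangle|].
    assert (B1 : Cmod ((h - c) / r) <= 12 * Cmod c * E / (Cmod l / 2)) by (apply Cmod_div_le; lra).
    assert (B2 : Cmod (- (r - l) / (r * l)) <= eta * Cmod l / (Cmod l / 2 * Cmod l)).
    { apply Cmod_div_le; [rewrite Cmod_opp; assumption|]. rewrite Cmod_mult. split; [nra|].
      apply Rmult_le_compat_r; lra. }
    rewrite !Cmod_mult, Cmod_inv by assumption.
    replace ((48 * E + 2 * eta) * (/ Cmod l * Cmod c)) with
      (12 * Cmod c * E / (Cmod l / 2) + Cmod c * (eta * Cmod l / (Cmod l / 2 * Cmod l)) + 24 * E * Cmod c * / Cmod l)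
      by (field; lra).
    assert (Cmod c * Cmod (- (r - l) / (r * l)) <= Cmod c * (eta * Cmod l / (Cmod l / 2 * Cmod l)))
      by (apply Rmult_le_compat_l; assumption).
    assert (0 <= 24 * E * Cmod c * / Cmod l)
      by (apply Rmult_le_pos; [nra|left; now apply Rinv_0_lt_compat]).
    lra.
  - replace (r * (k - h - h * q) + l * c)%C with (r * (k - (h - c) - h * q) - c * (r - l))%C by ring.
    eapply Rle_trans; [apply Cmod_triangle|]. rewrite Cmod_opp, !Cmod_mult.
    assert (h_hi : Cmod h <= 4 * Cmod c).
    { assert (T := Cmod_triangle_sub h c). nra. }
    assert (B : Cmod (k - (h - c) - h * q) <= 24 * Cmod c * E).
    { eapply Rle_trans; [apply Cmod_triangle|]. rewrite Cmod_opp, Cmod_mult.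
      assert (U := Cmod_triangle k (- (h - c))). rewrite Cmod_opp in U.
      assert (Cmod h * Cmod q <= 4 * Cmod c * E) by (apply Rmult_le_compat; auto using Cmod_ge_0).
      unfold Cminus at 1. lra. }
    assert (Cmod r * Cmod (k - (h - c) - h * q) <= 3 / 2 * Cmod l * (24 * Cmod c * E))
      by (apply Rmult_le_compat; auto using Cmod_ge_0).
    assert (Cmod c * Cmod (r - l) <= Cmod c * (eta * Cmod l)) by now apply Rmult_le_compat_l.
    assert (0 <= Cmod l * (Cmod c * E)) by (repeat apply Rmult_le_pos; lra).
    assert (0 <= Cmod c * (eta * Cmod l)) by (repeat apply Rmult_le_pos; lra).
    nra.
Qed.

Lemma Rpower_root_pow x n : 0 < x -> (1 <= n)%nat -> Rpower x (/ INR n) ^ n = x.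
Proof.
  intros Hx Hn. rewrite <- Rpower_pow by apply exp_pos.
  rewrite Rpower_mult, Rinv_l, Rpower_1; [reflexivity|assumption|apply not_0_INR; lia].
Qed.

Lemma le_of_pow_le x y n : 0 <= y -> (1 <= n)%nat -> x ^ n <= y ^ n -> x <= y.
Proof.
  intros Hy Hn H. destruct (Rle_or_lt x y) as [|L]; [assumption|exfalso].
  assert (y ^ n < x ^ n); [|lra].
  destruct n; [lia|]. clear -Hy L. induction n; [simpl; lra|].
  change (y * y ^ S n < x * x ^ S n). assert (0 <= y ^ S n) by (apply pow_le; lra). nra.
Qed.

Definition Csol := C -> (nat -> Cx) -> C -> C.

(** The constants are chosen before [f], [a] and [lam], from [m], [delta] and [Rad] alone; this
    order of quantifiers is the uniformity on compact sets. *)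
Lemma sibuya_boundary_values (m : nat) (delta Rad : R) :
  (3 <= m)%nat -> 0 < delta <= PI -> 0 <= Rad ->
  exists K Lam0 : R, forall (f f1 : Csol), is_Sibuya_solution m f f1 ->
    forall a, (forall i, (1 <= i <= m)%nat -> Cmod (a i) <= Rad) ->
    forall lam : C, Rabs (Carg lam) <= PI - delta -> Lam0 <= Cmod lam ->
    exists v : C, is_L m a lam v /\
      Cmod (f 0 a lam - cpow lam (RtoC (- / 4)) * cexp v)
        <= K * Rpower (Cmod lam) (- (/ 2 + / INR m)) * Cmod (cpow lam (RtoC (- / 4)) * cexp v) /\
      Cmod (f1 0 a lam + cpow lam (RtoC (/ 4)) * cexp v)
        <= K * Rpower (Cmod lam) (- (/ 2 + / INR m)) * Cmod (cpow lam (RtoC (/ 4)) * cexp v).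
Proof.
  intros Hm Hd HR. assert (Pi := PI_RGT_0).
  assert (m3 : 3 <= INR m) by (apply le_INR in Hm; simpl in Hm; lra).
  set (c := sin (delta / 2)).
  assert (Hc : 0 < c <= 1).
  { split; [apply sin_gt_0; lra|apply SIN_bound]. }
  set (rho := / 2 + / INR m).
  assert (im : 0 < / INR m <= / 3) by (split; [apply Rinv_0_lt_compat; lra|apply Rinv_le_contravar; lra]).
  assert (Hrho : / 2 < rho <= 1) by (unfold rho; lra).
  assert (MR : 0 <= INR m * Rad) by (apply Rmult_le_pos; lra).
  set (M0 := INR m * Rad) in *.
  set (M1 := INR m + INR m * (Rad * INR m)).
  set (M2 := INR m * INR m + INR m * (Rad * (INR m * INR m))).
  assert (HM1 : 0 <= M1) by (unfold M1; assert (0 <= INR m * (Rad * INR m)) by (repeat apply Rmult_le_pos; lra); lra).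
  assert (HM2 : 0 <= M2) by (unfold M2; assert (0 <= INR m * (Rad * (INR m * INR m))) by (repeat apply Rmult_le_pos; lra); nra).
  assert (two : 0 < 2 ^ m) by (apply pow_lt; lra).
  set (c0 := c / 2 / 2 ^ m). assert (Hc0 : 0 < c0) by (unfold c0; repeat apply Rdiv_lt_0_compat; lra).
  assert (sc : 0 < sqrt c0) by now apply sqrt_lt_R0.
  set (A1 := (5 / 16 * M1 ^ 2 / c0 ^ 2 + M2 / (4 * c0)) / (2 * sqrt c0)).
  set (A2 := M1 / (4 * (c0 * sqrt c0))).
  assert (HA1 : 0 <= A1).
  { unfold A1. apply Rmult_le_pos; [|left; apply Rinv_0_lt_compat; lra].
    apply Rplus_le_le_0_compat; apply Rmult_le_pos; try (left; apply Rinv_0_lt_compat; (apply pow_lt; lra) || lra).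
    - generalize (pow2_ge_0 M1); lra.
    - assumption. }
  assert (HA2 : 0 <= A2).
  { unfold A2. apply Rmult_le_pos; [assumption|]. left. apply Rinv_0_lt_compat.
    apply Rmult_lt_0_compat; [lra|now apply Rmult_lt_0_compat]. }
  set (A := A1 + A2).
  set (T0 := 2 * M0 * 2 ^ m / c).
  assert (HT0 : 0 <= T0) by (unfold T0; apply Rmult_le_pos; [nra|left; apply Rinv_0_lt_compat; lra]).
  set (B := 2 * M0 / c).
  assert (HB : 0 <= B) by (unfold B; apply Rmult_le_pos; [lra|left; apply Rinv_0_lt_compat; lra]).
  set (L0 := Rpower (4 * A + 1) (/ rho)).
  assert (PL0 : 0 < L0) by apply exp_pos.
  assert (PT0 : 0 <= T0 ^ m) by now apply pow_le.
  (* Each summand of the threshold has one task: 1 gives [T >= 1], [T0 ^ m] makes [P] a small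
     perturbation in [Qfun_lower], [L0] forces [E <= 1/4], and [2 * B] forces
     [eta = B / |lam| <= 1/2]. *)
  exists (48 * A + 2 * B), (1 + T0 ^ m + L0 + 2 * B).
  intros f f1 Hsib a Ha lam Harg Hlam.
  set (n := Cmod lam) in *.
  set (T := Rpower n (/ INR m)).
  assert (Tm : n = T ^ m) by (symmetry; apply Rpower_root_pow; lra || lia).
  assert (Tpos : 0 < T) by apply exp_pos.
  assert (T1 : 1 <= T) by (apply (le_of_pow_le 1 T m); [lra|lia|rewrite pow1; lra]).
  assert (T2 : T0 <= T) by (apply (le_of_pow_le T0 T m); [lra|lia|lra]).
  assert (Lz : lam <> 0) by (apply Cmod_gt_0; fold n; lra).
  assert (Hsec : (2 * c ^ 2 - 1) * Cmod lam <= Re lam) by (apply sector_Re; assumption).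
  assert (QL : forall x, 0 <= x -> c0 * (x + T) ^ m <= Cmod (Qfun m a lam x) /\
     0 < Cmod (Qfun m a lam x) + Re (Qfun m a lam x)).
  { intros x Hx. apply (Qfun_lower m a Rad); assumption. }
  assert (slit : forall x, 0 <= x -> 0 < Cmod (Qfun m a lam x) + Re (Qfun m a lam x)) by (intros; now apply QL).
  set (E := A * Rpower T (- (1 + INR m / 2))).
  assert (EA : E = A * Rpower n (- rho)).
  { unfold E, T. rewrite Rpower_mult. do 2 f_equal. unfold rho. field. lra. }
  assert (n_rho : 4 * A + 1 <= Rpower n rho).
  { replace (4 * A + 1) with (Rpower L0 rho).
    - apply Rle_Rpower_l; lra.
    - unfold L0. rewrite Rpower_mult, Rinv_l, Rpower_1; unfold A; lra. }
  assert (E4 : E <= / 4).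
  { rewrite EA, Rpower_Ropp. apply Rmult_le_reg_r with (Rpower n rho); [apply exp_pos|].
    rewrite Rmult_assoc, Rinv_l by (apply Rgt_not_eq, exp_pos). lra. }
  destruct (Sibuya_real_axis m f f1 a lam Hsib) as [dy [dy1 [K [X asym]]]].
  destruct (wkb_at_0 m a lam T A E (fun t => f (RtoC t) a lam) (fun t => f1 (RtoC t) a lam) K X)
    as [v [HL [h [k [q [r [Hr [Rr [Hy [Hy1 [Hh [Hk Hq]]]]]]]]]]]];
    try assumption; try reflexivity; try (intros; auto; fail).
  { unfold A; lra. }
  { intros x Hx. destruct (QL x Hx) as [Ql Qs].
    rewrite <- Cmod_wkb_r in Ql by assumption.
    destruct (wkb_term_bounds m (Q1fun m a x) (Q2fun m a x) (wkb_r (Qfun m a lam) x) (x + T) c0 M1 M2)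
      as [W1 W2]; try assumption; try lia; try lra.
    - apply (Q1fun_bound m a Rad); assumption || lra.
    - apply (Q2fun_bound m a Rad); assumption || lra.
    - fold A1 in W1. fold A2 in W2.
      assert (P1 := exp_pos (- (2 + INR m / 2) * ln (x + T))). fold (Rpower (x + T) (- (2 + INR m / 2))) in P1.
      assert (P2 := exp_pos (- (1 + INR m / 2) * ln (x + T))). fold (Rpower (x + T) (- (1 + INR m / 2))) in P2.
      split; (eapply Rle_trans; [eassumption|]); apply Rmult_le_compat_r; unfold A; lra. }
  exists v. split; [exact HL|].
  destruct (cpow_quarter lam Lz) as [l [El [El' [Hl4 [Nl [Rl Rl2]]]]]].
  assert (lz : l <> 0).
  { intros Z. rewrite Z, Cmod_0 in Nl. fold n in Nl. simpl in Nl. lra. }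
  set (eta := B * / n).
  (* As [rho <= 1], the error of order [1 / |lam|] from exchanging [Q(0)^(1/4)] for [lam^(1/4)] is
     absorbed by the WKB error. *)
  assert (Hinv : / n <= Rpower n (- rho)).
  { rewrite <- (Rpower_1 n) at 1 by lra. rewrite <- Rpower_Ropp. apply Rle_Rpower; lra. }
  assert (n_pos : 0 < / n) by (apply Rinv_0_lt_compat; lra).
  assert (Heta : 0 <= eta <= / 2).
  { unfold eta. split; [apply Rmult_le_pos; lra|].
    apply Rmult_le_reg_r with n; [lra|]. rewrite Rmult_assoc, Rinv_l by lra. lra. }
  assert (Hrl : Cmod (r - l) <= eta * Cmod l).
  { unfold eta, B, n. rewrite <- Nl.
    apply (fourth_root_perturb (csqrt (Qfun m a lam 0)) r l (peval m a (RtoC 0)) c M0); try assumption; try lra.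
    - left. apply csqrt_Re_pos, slit. lra.
    - rewrite csqrt_sqr by (apply slit; lra). rewrite Hl4. unfold Qfun.
      replace (RtoC 0 ^ m)%C with (RtoC 0); [ring|]. destruct m; [lia|]. simpl. ring.
    - rewrite <- (Rmult_1_r M0). unfold M0. rewrite Rmult_assoc. rewrite <- (pow1 (m - 1)).
      apply (peval_bound m a Rad); assumption || lra.
    (* In the sector, half the argument is at most [PI/2 - delta/2], so its cosine is at least
       [sin (delta/2) = c]. *)
    - rewrite Rl2, Rmult_comm. apply Rmult_le_compat_l; [apply pow2_ge_0|].
      unfold c. rewrite <- cos_shift. apply cos_ge_of_abs_le; [|lra].
      unfold Rdiv. rewrite Rabs_mult, (Rabs_pos_eq (/ 2)) by lra. lra. }
  assert (HE0 : 0 <= E <= / 4) by (split; [rewrite EA; apply Rmult_le_pos; [unfold A; lra|left; apply exp_pos]|assumption]).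
  destruct (boundary_values h k q r l (cexp v) E eta) as [F0 F1]; try assumption.
  { now apply Re_pos_neq0. }
  assert (Fac : 48 * E + 2 * eta <= (48 * A + 2 * B) * Rpower n (- rho)).
  { rewrite EA. unfold eta. assert (B * / n <= B * Rpower n (- rho)) by now apply Rmult_le_compat_l. lra. }
  rewrite El, El', Hy, Hy1.
  split; (eapply Rle_trans; [eassumption|]); apply Rmult_le_compat_r; auto using Cmod_ge_0.
Qed.

Import Defs.

Theorem theorem4p1 :
  forall (m : nat) (delta : R) (f f1 : Cx -> (nat -> Cx) -> Cx -> Cx),
    (3 <= m)%nat ->
    0 < delta -> delta <= PI / (INR m + 2) ->
    is_Sibuya_solution m f f1 ->
    let rho := / 2 + / INR m in
    forall Rad : R,
      exists K Lam0 : R,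
        forall (a : nat -> Cx),
          (forall i, (1 <= i <= m)%nat -> Cnorm (a i) <= Rad) ->
          forall lam : Cx,
            Rabs (Carg lam) <= PI - delta -> Lam0 <= Cnorm lam ->
            exists v : Cx,
              is_L m a lam v /\
              (let main0 := Cmul (Cpow lam (RtoC (- / 4))) (Cexp v) in
               Cnorm (Csub (f C0 a lam) main0)
                 <= K * Rpower (Cnorm lam) (- rho) * Cnorm main0) /\
              (let main1 := Cmul (Cpow lam (RtoC (/ 4))) (Cexp v) in
               Cnorm (Cadd (f1 C0 a lam) main1)
                 <= K * Rpower (Cnorm lam) (- rho) * Cnorm main1).
Proof.
  intros m delta f f1 Hm Hd Hd' Hsib rho Rad.
  assert (P := pos_INR m). assert (Pi := PI_RGT_0).
  assert (delta <= PI).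
  { eapply Rle_trans; [exact Hd'|]. apply Rmult_le_reg_r with (INR m + 2); [lra|].
    unfold Rdiv. rewrite Rmult_assoc, Rinv_l by lra. nra. }
  (* [Rad] is an arbitrary real here; the maximum with 0 provides the nonnegative radius
     required. *)
  destruct (sibuya_boundary_values m delta (Rmax Rad 0) Hm) as [K [Lam0 HK]]; [lra|apply Rmax_r|].
  exists K, Lam0. intros a Ha lam Harg Hlam. apply HK; try assumption.
  intros i Hi. eapply Rle_trans; [apply Ha, Hi|apply Rmax_l].
Qed.
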